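(* Let $\mathcal C$ be a finite tensor category, and let $\mathcal M$ and $\mathcal N$ be exact left $\mathcal C$-module categories. The $\mathcal Z(\mathcal C)$-module category $\mathrm{Fun}_{\mathcal C}(\mathcal M,\mathcal N)$ is exact.
   Context: Work over an algebraically closed field $\Bbbk$. A finite tensor category is a finite $\Bbbk$-linear abelian rigid monoidal category with bilinear tensor product and $\mathrm{End}(\mathbb 1)\cong\Bbbk$. A $\mathcal C$-module category is a finite $\Bbbk$-linear category with a $\mathcal C$-action exact in each variable; it is exact if $p\triangleright m$ is projective for every projective $p\in\mathcal C$ and every object $m$. $\mathrm{Fun}_{\mathcal C}(\mathcal M,\mathcal N)$ is the category of $\mathcal C$-module functors $\mathcal M\to\mathcal N$ and module natural transformations. $\mathcal Z(\mathcal C)$ is the Drinfeld center, with objects $(c,\nu)$, $\nu_x\colon c\otimes x\cong x\otimes c$. $\mathcal Z(\mathcal C)$ acts on $\mathrm{Fun}_{\mathcal C}(\mathcal M,\mathcal N)$ by $(c,\nu)\triangleright H=c\triangleright H(-)$, the composition of $H$ with the functor $c\triangleright-\colon\mathcal N\to\mathcal N$, which is a $\mathcal C$-module functor via $\nu$. *)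

(* Defs.v *)
From HB Require Import structures.
From mathcomp Require Import all_boot all_order all_algebra.
From mathcomp Require Import boolp.
Set Implicit Arguments. Unset Strict Implicit. Unset Printing Implicit Defensive.
Import GRing.Theory.
Local Open Scope ring_scope.

(* Hom-spaces of functor categories and of the Drinfeld center are cut out by
   linear conditions from products of hom-spaces; the next two sections give such
   subspaces their [lmodType] structure. *)
Section ProductModule.
Variables (k : fieldType) (I : Type) (V : I -> lmodType k).

Definition prodmod : Type := forall i, V i.

HB.instance Definition _ := gen_eqMixin prodmod.
HB.instance Definition _ := gen_choiceMixin prodmod.

Definition prodmod_zero : prodmod := fun i => 0.
Definition prodmod_opp (f : prodmod) : prodmod := fun i => - f i.
Definition prodmod_add (f g : prodmod) : prodmod := fun i => f i + g i.
Definition prodmod_scale (a : k) (f : prodmod) : prodmod := fun i => a *: f i.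

Fact prodmod_addA : associative prodmod_add.
Proof. by move=> f g h; apply: functional_extensionality_dep => i; exact: addrA. Qed.
Fact prodmod_addC : commutative prodmod_add.
Proof. by move=> f g; apply: functional_extensionality_dep => i; exact: addrC. Qed.
Fact prodmod_add0 : left_id prodmod_zero prodmod_add.
Proof. by move=> f; apply: functional_extensionality_dep => i; exact: add0r. Qed.
Fact prodmod_addN : left_inverse prodmod_zero prodmod_opp prodmod_add.
Proof. by move=> f; apply: functional_extensionality_dep => i; exact: addNr. Qed.

HB.instance Definition _ :=
  GRing.isZmodule.Build prodmod prodmod_addA prodmod_addC prodmod_add0 prodmod_addN.

Fact prodmod_scaleA a b f : prodmod_scale a (prodmod_scale b f) = prodmod_scale (a * b) f.
Proof. by apply: functional_extensionality_dep => i; exact: scalerA. Qed.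
Fact prodmod_scale1 : left_id 1 prodmod_scale.
Proof. by move=> f; apply: functional_extensionality_dep => i; exact: scale1r. Qed.
Fact prodmod_scaleDr : right_distributive prodmod_scale +%R.
Proof. by move=> a f g; apply: functional_extensionality_dep => i; exact: scalerDr. Qed.
Fact prodmod_scaleDl f : {morph prodmod_scale^~ f : a b / a + b}.
Proof. by move=> a b; apply: functional_extensionality_dep => i; exact: scalerDl. Qed.

HB.instance Definition _ := GRing.Zmodule_isLmodule.Build k prodmod
  prodmod_scaleA prodmod_scale1 prodmod_scaleDr prodmod_scaleDl.

End ProductModule.

Section SubModule.
Variables (k : fieldType) (V : lmodType k) (P : V -> Prop).

Definition lin_closed := P 0 /\ forall (a : k) u v, P u -> P v -> P (a *: u + v).

Definition lin_pred & lin_closed : pred V := fun v => `[< P v >].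

Hypothesis clP : lin_closed.

Record subspace := Subspace { subval :> V; _ : lin_pred clP subval }.

HB.instance Definition _ := [isSub for subval].
HB.instance Definition _ := [Choice of subspace by <:].

Fact lin_pred_submod : subsemimod_closed (lin_pred clP).
Proof.
have [P0 PD] := clP; split; [split|].
- exact/asboolP.
- by move=> u v /asboolP Pu /asboolP Pv; apply/asboolP; rewrite -[u]scale1r; apply: PD.
- by move=> a u /asboolP Pu; apply/asboolP; rewrite -[_ *: _]addr0; apply: PD.
Qed.

HB.instance Definition _ := GRing.isSubmodClosed.Build k V (lin_pred clP) lin_pred_submod.
HB.instance Definition _ := [SubChoice_isSubLmodule of subspace by <:].

Lemma subspaceP (u : subspace) : P u.
Proof. by apply/asboolP; case: u. Qed.

Definition mkSub (v : V) (Pv : P v) : subspace := Subspace (asboolT Pv : lin_pred clP v).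

Lemma subspace_eq (u v : subspace) : u = v :> V -> u = v.
Proof. exact: val_inj. Qed.

End SubModule.


Record linCat (k : fieldType) := LinCat {
  ob :> Type;
  mor : ob -> ob -> lmodType k;
  idmor : forall x, mor x x;
  mcomp : forall x y z, mor y z -> mor x y -> mor x z;
  comp_id_l : forall x y (f : mor x y), mcomp (idmor y) f = f;
  comp_id_r : forall x y (f : mor x y), mcomp f (idmor x) = f;
  comp_assoc : forall x y z w (h : mor z w) (g : mor y z) (f : mor x y),
    mcomp h (mcomp g f) = mcomp (mcomp h g) f;
  comp_lin_l : forall x y z (a : k) (g g' : mor y z) (f : mor x y),
    mcomp (a *: g + g') f = a *: mcomp g f + mcomp g' f;
  comp_lin_r : forall x y z (a : k) (g : mor y z) (f f' : mor x y),
    mcomp g (a *: f + f') = a *: mcomp g f + mcomp g f' }.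

Arguments mor {k l} x y.
Arguments idmor {k l} x.
Arguments mcomp {k l x y z} g f.
Notation "g ∘ f" := (mcomp g f) (at level 37, right associativity).

Section Abelian.
Variables (k : fieldType) (C : linCat k).
Implicit Types x y z : C.

(* Isomorphisms carry their (unique) inverse as data. *)
Record isomor x y := Isomor {
  fwd :> mor x y;
  bwd : mor y x;
  fwdK : bwd ∘ fwd = idmor x;
  bwdK : fwd ∘ bwd = idmor y }.

Definition monomor x y (f : mor x y) :=
  forall w (g h : mor w x), f ∘ g = f ∘ h -> g = h.

Definition epimor x y (f : mor x y) :=
  forall w (g h : mor y w), g ∘ f = h ∘ f -> g = h.

Definition is_iso x y (f : mor x y) :=
  exists g : mor y x, g ∘ f = idmor x /\ f ∘ g = idmor y.

Definition isomorphic x y := exists f : mor x y, is_iso f.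

Definition is_zero z :=
  forall x, (forall f : mor x z, f = 0) /\ (forall f : mor z x, f = 0).

Definition is_biproduct x y s :=
  exists (i : mor x s) (j : mor y s) (p : mor s x) (q : mor s y),
    [/\ p ∘ i = idmor x, q ∘ j = idmor y, p ∘ j = 0, q ∘ i = 0
      & i ∘ p + j ∘ q = idmor s].

Definition is_kernel x y w (f : mor x y) (i : mor w x) :=
  f ∘ i = 0 /\
  forall v (g : mor v x), f ∘ g = 0 -> exists! h : mor v w, i ∘ h = g.

Definition is_cokernel x y w (f : mor x y) (p : mor y w) :=
  p ∘ f = 0 /\
  forall v (g : mor y v), g ∘ f = 0 -> exists! h : mor w v, h ∘ p = g.

Record abelian_cat : Prop := Abelian {
  has_zero : exists z, is_zero z;
  has_biproducts : forall x y, exists s, is_biproduct x y s;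
  has_kernels : forall x y (f : mor x y),
    exists w (i : mor w x), is_kernel f i;
  has_cokernels : forall x y (f : mor x y),
    exists w (p : mor y w), is_cokernel f p;
  monos_normal : forall x y (i : mor x y), monomor i ->
    exists z (f : mor y z), is_kernel f i;
  epis_normal : forall x y (p : mor x y), epimor p ->
    exists z (f : mor z x), is_cokernel f p }.

Definition short_exact x y z (i : mor x y) (p : mor y z) :=
  is_kernel p i /\ is_cokernel i p.

Definition simple_ob x :=
  ~ is_zero x /\
  forall y (i : mor y x), monomor i -> is_zero y \/ is_iso i.

(* Existence of a finite composition series. *)
Inductive finite_length : C -> Prop :=
| finite_length_zero x of is_zero x : finite_length x
| finite_length_ext x y s (i : mor x y) (p : mor y s) of
    short_exact i p & finite_length x & simple_ob s : finite_length y.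

Definition projective_ob p :=
  forall x y (e : mor x y) (f : mor p y), epimor e ->
    exists g : mor p x, e ∘ g = f.

Definition finite_dim_hom x y :=
  exists (n : nat) (b : 'I_n -> mor x y), forall f : mor x y,
    exists a : 'I_n -> k, f = \sum_i a i *: b i.

Record finite_category : Prop := FiniteCategory {
  fin_abelian : abelian_cat;
  fin_hom : forall x y, finite_dim_hom x y;
  fin_length : forall x, finite_length x;
  fin_projectives : forall x,
    exists p (e : mor p x), projective_ob p /\ epimor e;
  fin_simples : exists (n : nat) (s : 'I_n -> C),
    forall x, simple_ob x -> exists i, isomorphic x (s i) }.

End Abelian.

Arguments fwd {k C x y} i.
Arguments bwd {k C x y} i.

Record linFun (k : fieldType) (A B : linCat k) := LinFun {
  fob :> A -> B;
  fmor : forall x y, mor x y -> mor (fob x) (fob y);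
  fmor_id : forall x, fmor (idmor x) = idmor (fob x);
  fmor_comp : forall x y z (g : mor y z) (f : mor x y),
    fmor (g ∘ f) = fmor g ∘ fmor f;
  fmor_lin : forall x y (a : k) (f g : mor x y),
    fmor (a *: f + g) = a *: fmor f + fmor g }.

Arguments fmor {k A B} l {x y} f.

(* For linear functors between abelian categories, preserving short exact
   sequences is preserving all finite limits and colimits. *)
Definition exact_functor (k : fieldType) (A B : linCat k) (F : linFun A B) :=
  forall x y z (i : mor x y) (p : mor y z),
    short_exact i p -> short_exact (fmor F i) (fmor F p).

Record bilinFun (k : fieldType) (A B D : linCat k) := BilinFun {
  bob :> A -> B -> D;
  bmor : forall x x' y y', mor x x' -> mor y y' -> mor (bob x y) (bob x' y');
  bmor_id : forall x y, bmor (idmor x) (idmor y) = idmor (bob x y);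
  bmor_comp : forall x x' x'' y y' y'' (f' : mor x' x'') (f : mor x x')
      (g' : mor y' y'') (g : mor y y'),
    bmor (f' ∘ f) (g' ∘ g) = bmor f' g' ∘ bmor f g;
  bmor_lin_l : forall x x' y y' (a : k) (f f' : mor x x') (g : mor y y'),
    bmor (a *: f + f') g = a *: bmor f g + bmor f' g;
  bmor_lin_r : forall x x' y y' (a : k) (f : mor x x') (g g' : mor y y'),
    bmor f (a *: g + g') = a *: bmor f g + bmor f g' }.

Arguments bmor {k A B D} b {x x' y y'} f g.

#[local] Obligation Tactic := idtac.

Section PartialFunctors.
Variables (k : fieldType) (A B D : linCat k) (T : bilinFun A B D).

Program Definition bfix_l (x : A) : linFun B D :=
  @LinFun k B D (T x) (fun y y' g => bmor T (idmor x) g) _ _ _.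
Next Obligation. by move=> x y /=; rewrite bmor_id. Qed.
Next Obligation. by move=> x y y1 y2 g f /=; rewrite -bmor_comp comp_id_l. Qed.
Next Obligation. by move=> * /=; rewrite bmor_lin_r. Qed.

Program Definition bfix_r (y : B) : linFun A D :=
  @LinFun k A D (T^~ y) (fun x x' f => bmor T f (idmor y)) _ _ _.
Next Obligation. by move=> y x /=; rewrite bmor_id. Qed.
Next Obligation. by move=> y x x1 x2 g f /=; rewrite -bmor_comp comp_id_l. Qed.
Next Obligation. by move=> * /=; rewrite bmor_lin_l. Qed.

End PartialFunctors.

Record linMon (k : fieldType) := LinMon {
  mcat :> linCat k;
  tens : bilinFun mcat mcat mcat;
  unit_ob : mcat;
  tassoc : forall x y z, isomor (tens (tens x y) z) (tens x (tens y z));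
  lunit : forall x, isomor (tens unit_ob x) x;
  runit : forall x, isomor (tens x unit_ob) x;
  tassoc_nat : forall x x' y y' z z' (f : mor x x') (g : mor y y') (h : mor z z'),
    tassoc x' y' z' ∘ bmor tens (bmor tens f g) h
    = bmor tens f (bmor tens g h) ∘ tassoc x y z;
  lunit_nat : forall x x' (f : mor x x'),
    lunit x' ∘ bmor tens (idmor unit_ob) f = f ∘ lunit x;
  runit_nat : forall x x' (f : mor x x'),
    runit x' ∘ bmor tens f (idmor unit_ob) = f ∘ runit x;
  tens_pentagon : forall x y z w,
    bmor tens (idmor x) (tassoc y z w) ∘ tassoc x (tens y z) w
      ∘ bmor tens (tassoc x y z) (idmor w)
    = tassoc x y (tens z w) ∘ tassoc (tens x y) z w;
  tens_triangle : forall x y,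
    bmor tens (idmor x) (lunit y) ∘ tassoc x unit_ob y
    = bmor tens (runit x) (idmor y) }.

Arguments tens {k} l.
Arguments unit_ob {k l}.
Arguments tassoc {k l} x y z.
Arguments lunit {k l} x.
Arguments runit {k l} x.

Notation "x ⊗ y" := (bob (tens _) x y) (at level 33, left associativity).
Notation "f [⊗] g" := (bmor (tens _) f g) (at level 33, left associativity).

Section Tensor.
Variables (k : fieldType) (C : linMon k).
Implicit Types x y : C.

(* [y] is a left dual of [x], equivalently [x] is a right dual of [y]. *)
Definition is_left_dual x y :=
  exists (ev : mor (y ⊗ x) unit_ob) (coev : mor unit_ob (x ⊗ y)),
    runit x ∘ (idmor x [⊗] ev) ∘ tassoc x y x ∘ (coev [⊗] idmor x) = lunit x
    /\ lunit y ∘ (ev [⊗] idmor y) ∘ bwd (tassoc y x y) ∘ (idmor y [⊗] coev) = runit y.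

Definition rigid :=
  forall x, (exists y, is_left_dual x y) /\ (exists y, is_left_dual y x).

Record finite_tensor_category : Prop := FiniteTensorCategory {
  ftc_finite : finite_category C;
  ftc_rigid : rigid;
  ftc_unit : forall f : mor (unit_ob : C) unit_ob,
    exists! a : k, f = a *: idmor unit_ob }.

End Tensor.

Record modCat (k : fieldType) (C : linMon k) := ModCat {
  ucat :> linCat k;
  cact : bilinFun C ucat ucat;
  massoc : forall x y m, isomor (cact (x ⊗ y) m) (cact x (cact y m));
  munit : forall m, isomor (cact unit_ob m) m;
  massoc_nat : forall x x' y y' m m' (f : mor x x') (g : mor y y') (h : mor m m'),
    massoc x' y' m' ∘ bmor cact (f [⊗] g) h
    = bmor cact f (bmor cact g h) ∘ massoc x y m;
  munit_nat : forall m m' (f : mor m m'),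
    munit m' ∘ bmor cact (idmor unit_ob) f = f ∘ munit m;
  act_pentagon : forall x y z m,
    bmor cact (idmor x) (massoc y z m) ∘ massoc x (y ⊗ z) m
      ∘ bmor cact (tassoc x y z) (idmor m)
    = massoc x y (cact z m) ∘ massoc (x ⊗ y) z m;
  act_triangle : forall x m,
    bmor cact (idmor x) (munit m) ∘ massoc x unit_ob m
    = bmor cact (runit x) (idmor m) }.

Arguments cact {k C} _.
Arguments massoc {k C _} _ _ _.
Arguments munit {k C _} _.

Notation "x ▷ m" := (bob (cact _) x m) (at level 36, right associativity).
Notation "f [▷] g" := (bmor (cact _) f g) (at level 36, right associativity).

Section ModuleCategory.
Variables (k : fieldType) (C : linMon k) (M : modCat C).

Record module_category : Prop := ModuleCategory {
  mod_finite : finite_category M;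
  mod_exact_l : forall x : C, exact_functor (bfix_l (cact M) x);
  mod_exact_r : forall m : M, exact_functor (bfix_r (cact M) m) }.

Record exact_module_category : Prop := ExactModuleCategory {
  emod_module : module_category;
  emod_projective : forall (p : C) (m : M), projective_ob p -> projective_ob (p ▷ m) }.

End ModuleCategory.

(* Module functors are k-linear; no exactness is required. *)
Record modFun (k : fieldType) (C : linMon k) (M N : modCat C) := ModFun {
  ufun :> linFun M N;
  mstr : forall (x : C) (m : M), isomor (ufun (x ▷ m)) (x ▷ ufun m);
  mstr_nat : forall x x' m m' (f : mor x x') (g : mor m m'),
    mstr x' m' ∘ fmor ufun (f [▷] g) = (f [▷] fmor ufun g) ∘ mstr x m;
  mstr_pentagon : forall x y m,
    massoc x y (ufun m) ∘ mstr (x ⊗ y) m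
    = (idmor x [▷] mstr y m) ∘ mstr x (y ▷ m) ∘ fmor ufun (massoc x y m);
  mstr_triangle : forall m,
    munit (ufun m) ∘ mstr unit_ob m = fmor ufun (munit m) }.

Arguments mstr {k C M N} _ _ _.

Lemma lin_zero (k : fieldType) (U V : lmodType k) (f : U -> V) :
  (forall a u v, f (a *: u + v) = a *: f u + f v) -> f 0 = 0.
Proof.
move=> lin; have := lin 1 0 0; rewrite !scale1r addr0 => e.
by apply: (addrI (f 0)); rewrite addr0 -e.
Qed.

Section CompLemmas.
Variables (k : fieldType) (C : linCat k).
Implicit Types x y z w : C.

Lemma comp_0l x y z (f : mor x y) : (0 : mor y z) ∘ f = 0.
Proof. by apply: (lin_zero (f := fun g : mor y z => g ∘ f)) => *; rewrite comp_lin_l. Qed.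

Lemma comp_0r x y z (g : mor y z) : g ∘ (0 : mor x y) = 0.
Proof. by apply: (lin_zero (f := fun f : mor x y => g ∘ f)) => *; rewrite comp_lin_r. Qed.

Lemma comp_pre x y z (g : mor y z) (f : mor x y) (h : mor x z) :
  g ∘ f = h -> forall w (t : mor w x), g ∘ f ∘ t = h ∘ t.
Proof. by move=> <- w t; rewrite comp_assoc. Qed.

Lemma comp_pre3 x y z v (h : mor z v) (g : mor y z) (f : mor x y) (r : mor x v) :
  h ∘ g ∘ f = r -> forall w (t : mor w x), h ∘ g ∘ f ∘ t = r ∘ t.
Proof. by move=> <- w t; rewrite !comp_assoc. Qed.

Lemma iso_epi x y z (i : isomor x y) (g h : mor y z) : g ∘ i = h ∘ i -> g = h.
Proof.
by move=> e; rewrite -[g]comp_id_r -(bwdK i) comp_assoc e -comp_assoc bwdK comp_id_r.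
Qed.

Lemma iso_mono x y z (i : isomor y z) (g h : mor x y) : i ∘ g = i ∘ h -> g = h.
Proof.
by move=> e; rewrite -[g]comp_id_l -(fwdK i) -comp_assoc e comp_assoc fwdK comp_id_l.
Qed.

Lemma bwd_l x y z (i : isomor y z) (f : mor x y) (g : mor x z) : i ∘ f = g -> f = bwd i ∘ g.
Proof. by move=> <-; rewrite comp_assoc fwdK comp_id_l. Qed.

Definition iso_inv x y (i : isomor x y) : isomor y x := Isomor (bwdK i) (fwdK i).

Definition iso_id x : isomor x x := Isomor (comp_id_l (idmor x)) (comp_id_l (idmor x)).

Program Definition iso_comp x y z (j : isomor y z) (i : isomor x y) : isomor x z :=
  @Isomor k C x z (j ∘ i) (bwd i ∘ bwd j) _ _.
Next Obligation.
by move=> x y z j i; rewrite -comp_assoc (comp_pre (fwdK j)) comp_id_l fwdK.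
Qed.
Next Obligation.
by move=> x y z j i; rewrite -comp_assoc (comp_pre (bwdK i)) comp_id_l bwdK.
Qed.

End CompLemmas.

Program Definition fmor_iso (k : fieldType) (A B : linCat k) (F : linFun A B)
    (x y : A) (i : isomor x y) : isomor (fob F x) (fob F y) :=
  @Isomor k B _ _ (fmor F i) (fmor F (bwd i)) _ _.
Next Obligation. by move=> *; rewrite -fmor_comp fwdK fmor_id. Qed.
Next Obligation. by move=> *; rewrite -fmor_comp bwdK fmor_id. Qed.

Section BilinLemmas.
Variables (k : fieldType) (A B D : linCat k) (T : bilinFun A B D).

Lemma bmor_0l x x' y y' (g : mor y y') : bmor T (0 : mor x x') g = 0.
Proof. by apply: (lin_zero (f := fun f : mor x x' => bmor T f g)) => *; rewrite bmor_lin_l. Qed.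

Lemma bmor_0r x x' y y' (f : mor x x') : bmor T f (0 : mor y y') = 0.
Proof. by apply: (lin_zero (f := fun g : mor y y' => bmor T f g)) => *; rewrite bmor_lin_r. Qed.

Lemma bmor_compl x x' x'' (f' : mor x' x'') (f : mor x x') y :
  bmor T (f' ∘ f) (idmor y) = bmor T f' (idmor y) ∘ bmor T f (idmor y).
Proof. by rewrite -bmor_comp comp_id_l. Qed.

Lemma bmor_compr x y y' y'' (g' : mor y' y'') (g : mor y y') :
  bmor T (idmor x) (g' ∘ g) = bmor T (idmor x) g' ∘ bmor T (idmor x) g.
Proof. by rewrite -bmor_comp comp_id_l. Qed.

Lemma bmor_lr x x' y y' (f : mor x x') (g : mor y y') :
  bmor T f (idmor y') ∘ bmor T (idmor x) g = bmor T f g.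
Proof. by rewrite -bmor_comp comp_id_l comp_id_r. Qed.

Lemma bmor_rl x x' y y' (f : mor x x') (g : mor y y') :
  bmor T (idmor x') g ∘ bmor T f (idmor y) = bmor T f g.
Proof. by rewrite -bmor_comp comp_id_l comp_id_r. Qed.

Program Definition bmor_iso x x' y y' (i : isomor x x') (j : isomor y y') :
    isomor (T x y) (T x' y') :=
  @Isomor k D _ _ (bmor T i j) (bmor T (bwd i) (bwd j)) _ _.
Next Obligation. by move=> *; rewrite -bmor_comp !fwdK bmor_id. Qed.
Next Obligation. by move=> *; rewrite -bmor_comp !bwdK bmor_id. Qed.

End BilinLemmas.

(* [C] as a left module category over itself. *)
Definition regMod (k : fieldType) (C : linMon k) : modCat C :=
  @ModCat k C C (tens C) tassoc lunit (@tassoc_nat k C) (@lunit_nat k C)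
    (@tens_pentagon k C) (@tens_triangle k C).

Section ModuleLemmas.
Variables (k : fieldType) (C : linMon k) (N : modCat C).
Implicit Types (x y : C) (m n : N).

Lemma massoc_natl x x' (f : mor x x') y m :
  massoc x' y m ∘ ((f [⊗] idmor y) [▷] idmor m) = (f [▷] idmor (y ▷ m)) ∘ massoc x y m.
Proof. by rewrite massoc_nat bmor_id. Qed.

Lemma massoc_natm x y y' (g : mor y y') m :
  massoc x y' m ∘ ((idmor x [⊗] g) [▷] idmor m) = (idmor x [▷] g [▷] idmor m) ∘ massoc x y m.
Proof. by rewrite massoc_nat. Qed.

Lemma massoc_natr x y m m' (h : mor m m') :
  massoc x y m' ∘ (idmor (x ⊗ y) [▷] h) = (idmor x [▷] idmor y [▷] h) ∘ massoc x y m.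
Proof. by rewrite -massoc_nat bmor_id. Qed.

Lemma act_unit_inj m n (f g : mor m n) :
  idmor (unit_ob : C) [▷] f = idmor (unit_ob : C) [▷] g -> f = g.
Proof. by move=> e; apply: (iso_epi (i := munit m)); rewrite -!munit_nat e. Qed.

Lemma munit_massoc x m :
  munit (x ▷ m) ∘ massoc unit_ob x m = lunit x [▷] idmor m.
Proof.
apply: act_unit_inj.
apply: (iso_epi (i := massoc unit_ob (unit_ob ⊗ x) m)).
apply: (iso_epi (i := bmor_iso (cact N) (tassoc unit_ob unit_ob x) (iso_id m))).
rewrite /= bmor_compr -!comp_assoc act_pentagon (comp_pre (act_triangle _ _)).
by rewrite -massoc_natl (comp_pre (esym (massoc_natm _ _ _))) -comp_assoc -bmor_compl
  tens_triangle.
Qed.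

Section ModFunUnit.
Variables (D : modCat C) (F : linFun D N) 
  (s : forall (x : C) (m : D), isomor (fob F (x ▷ m)) (x ▷ fob F m)).
Hypothesis s_nat : forall x x' (m m' : D) (f : mor x x') (g : mor m m'),
  s x' m' ∘ fmor F (f [▷] g) = (f [▷] fmor F g) ∘ s x m.
Hypothesis s_pent : forall x y (m : D),
  massoc x y (fob F m) ∘ s (x ⊗ y) m
  = (idmor x [▷] s y m) ∘ s x (y ▷ m) ∘ fmor F (massoc x y m).

Lemma mod_triangle (m : D) : munit (fob F m) ∘ s unit_ob m = fmor F (munit m).
Proof.
apply: act_unit_inj; apply: (iso_epi (i := s unit_ob (unit_ob ▷ m))).
apply: (iso_epi (i := fmor_iso F (massoc unit_ob unit_ob m))).
rewrite /= bmor_compr -!comp_assoc -s_pent (comp_pre (act_triangle _ _)).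
rewrite (comp_pre (esym (s_nat _ _))) -comp_assoc -fmor_comp act_triangle.
by rewrite s_nat fmor_id.
Qed.

End ModFunUnit.

End ModuleLemmas.

Section Strength.
Variables (k : fieldType) (C : linMon k) (N : modCat C).
Variables (c : C) (b : forall x, isomor (c ⊗ x) (x ⊗ c)).
Variable s : forall (x : C) (m : N), isomor (c ▷ x ▷ m) (x ▷ c ▷ m).
Hypothesis s_massoc : forall x m,
  s x m ∘ massoc c x m = massoc x c m ∘ (b x [▷] idmor m).

Lemma strength_nat_of :
  (forall x x' (f : mor x x'), b x' ∘ (idmor c [⊗] f) = (f [⊗] idmor c) ∘ b x) ->
  forall x x' m m' (f : mor x x') (g : mor m m'),
    s x' m' ∘ (idmor c [▷] f [▷] g) = (f [▷] idmor c [▷] g) ∘ s x m.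
Proof.
move=> b_nat x x' m m' f g; apply: (iso_epi (i := massoc c x m)).
rewrite -!comp_assoc s_massoc -massoc_nat (comp_pre (s_massoc _ _)).
rewrite (comp_pre (esym (massoc_nat _ _ _))) -!comp_assoc -!bmor_comp.
by rewrite b_nat comp_id_l comp_id_r.
Qed.

Let hexL x y := tassoc x y c ∘ b (x ⊗ y) ∘ tassoc c x y.
Let hexR x y := (idmor x [⊗] b y) ∘ tassoc x c y ∘ (b x [⊗] idmor y).
Let hexagon_pentagonL x y m :
  (massoc x y (c ▷ m) ∘ s (x ⊗ y) m)
    ∘ massoc c (x ⊗ y) m ∘ (tassoc c x y [▷] idmor m)
  = (idmor x [▷] massoc y c m) ∘ massoc x (y ⊗ c) m ∘ (hexL x y [▷] idmor m).
Proof.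
rewrite -!comp_assoc (comp_pre (s_massoc _ _)) -!comp_assoc.
rewrite (comp_pre (esym (act_pentagon _ _ _ _))) -!comp_assoc.
by rewrite /hexL !bmor_compl.
Qed.
Let hexagon_pentagonR x y m :
  ((idmor x [▷] s y m) ∘ s x (y ▷ m) ∘ (idmor c [▷] massoc x y m))
    ∘ massoc c (x ⊗ y) m ∘ (tassoc c x y [▷] idmor m)
  = (idmor x [▷] massoc y c m) ∘ massoc x (y ⊗ c) m ∘ (hexR x y [▷] idmor m).
Proof.
rewrite -!comp_assoc act_pentagon (comp_pre (s_massoc _ _)) -!comp_assoc.
rewrite -massoc_natl (comp_pre (esym (act_pentagon _ _ _ _))) -!comp_assoc.
rewrite (comp_pre (esym (bmor_compr _ _ _ _))) s_massoc bmor_compr -!comp_assoc.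
by rewrite (comp_pre (esym (massoc_natm _ _ _))) /hexR !bmor_compl -!comp_assoc.
Qed.

Lemma strength_pentagon_of :
  (forall x y, hexL x y = hexR x y) -> forall x y (m : N),
  massoc x y (c ▷ m) ∘ s (x ⊗ y) m
  = (idmor x [▷] s y m) ∘ s x (y ▷ m) ∘ (idmor c [▷] massoc x y m).
Proof.
move=> hex x y m; apply: (iso_epi (i := massoc c (x ⊗ y) m)).
apply: (iso_epi (i := bmor_iso (cact N) (tassoc c x y) (iso_id m))).
by rewrite /= -[LHS]comp_assoc -[RHS]comp_assoc hexagon_pentagonL hexagon_pentagonR hex.
Qed.

Lemma act_hexagon_of :
  (forall x y (m : N),
    massoc x y (c ▷ m) ∘ s (x ⊗ y) m
    = (idmor x [▷] s y m) ∘ s x (y ▷ m) ∘ (idmor c [▷] massoc x y m)) ->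
  forall x y (m : N), hexL x y [▷] idmor m = hexR x y [▷] idmor m.
Proof.
move=> pent x y m; apply: (iso_mono (i := massoc x (y ⊗ c) m)).
apply: (iso_mono (i := bmor_iso (cact N) (iso_id x) (massoc y c m))).
by rewrite /= -hexagon_pentagonL -hexagon_pentagonR pent.
Qed.

End Strength.

Section StrengthTensor.
Variables (k : fieldType) (C : linMon k) (N : modCat C) (c d : C).
Variables (b : forall x, isomor (c ⊗ x) (x ⊗ c)) (g : forall x, isomor (d ⊗ x) (x ⊗ d)).
Variable sc : forall (x : C) (m : N), isomor (c ▷ x ▷ m) (x ▷ c ▷ m).
Variable sd : forall (x : C) (m : N), isomor (d ▷ x ▷ m) (x ▷ d ▷ m).
Variable sq : forall (x : C) (m : N), isomor ((c ⊗ d) ▷ x ▷ m) (x ▷ (c ⊗ d) ▷ m).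
Hypothesis sc_massoc : forall x m,
  sc x m ∘ massoc c x m = massoc x c m ∘ (b x [▷] idmor m).
Hypothesis sd_massoc : forall x m,
  sd x m ∘ massoc d x m = massoc x d m ∘ (g x [▷] idmor m).
Hypothesis sq_massoc : forall x m,
  sq x m ∘ massoc (c ⊗ d) x m
  = massoc x (c ⊗ d) m ∘ ((tassoc x c d ∘ (b x [⊗] idmor d) ∘ bwd (tassoc c x d)
     ∘ (idmor c [⊗] g x) ∘ tassoc c d x) [▷] idmor m).

Lemma strength_tens x m :
  (idmor x [▷] massoc c d m) ∘ sq x m
  = sc x (d ▷ m) ∘ (idmor c [▷] sd x m) ∘ massoc c d (x ▷ m).
Proof.
apply: (iso_epi (i := massoc (c ⊗ d) x m)).
rewrite -!comp_assoc sq_massoc !bmor_compl.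
rewrite -act_pentagon (comp_pre (esym (bmor_compr _ _ _ _))) sd_massoc bmor_compr.
rewrite -!comp_assoc (comp_pre3 (act_pentagon _ _ _ _)) -!comp_assoc.
rewrite (comp_pre (massoc_natl _ _ _)) -!comp_assoc.
rewrite (comp_pre (esym (massoc_natm _ _ _))) -!comp_assoc.
have -> : forall t : mor ((c ⊗ d ⊗ x) ▷ m) ((c ⊗ (x ⊗ d)) ▷ m),
   (idmor c [▷] massoc x d m) ∘ massoc c (x ⊗ d) m ∘ t
   = massoc c x (d ▷ m) ∘ massoc (c ⊗ x) d m ∘ (bwd (tassoc c x d) [▷] idmor m) ∘ t.
  move=> t; rewrite -[in LHS](comp_id_l t) -(bmor_id (cact N)) -(bwdK (tassoc c x d)).
  rewrite bmor_compl -!comp_assoc .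
  by rewrite (comp_pre3 (act_pentagon _ _ _ _)) -!comp_assoc.
by rewrite (comp_pre (sc_massoc _ _)) -!comp_assoc.
Qed.

End StrengthTensor.

Section Transport.
Variables (k : fieldType) (C : linMon k) (D N : modCat C) (F G : linFun D N).
Variables (s : forall (x : C) (m : D), isomor (fob F (x ▷ m)) (x ▷ fob F m)).
Variables (s' : forall (x : C) (m : D), isomor (fob G (x ▷ m)) (x ▷ fob G m)).
Variable e : forall m : D, isomor (fob G m) (fob F m).
Hypothesis e_nat : forall m m' (f : mor m m'), e m' ∘ fmor G f = fmor F f ∘ e m.
Hypothesis e_s : forall x m, (idmor x [▷] e m) ∘ s' x m = s x m ∘ e (x ▷ m).
Hypothesis s_pent : forall x y (m : D),
  massoc x y (fob F m) ∘ s (x ⊗ y) m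
  = (idmor x [▷] s y m) ∘ s x (y ▷ m) ∘ fmor F (massoc x y m).

Lemma transport_pentagon x y (m : D) :
  massoc x y (fob G m) ∘ s' (x ⊗ y) m
  = (idmor x [▷] s' y m) ∘ s' x (y ▷ m) ∘ fmor G (massoc x y m).
Proof.
apply: (iso_mono (i := bmor_iso (cact N) (iso_id x) (bmor_iso (cact N) (iso_id y) (e m)))).
rewrite /= (comp_pre (esym (massoc_natr _ _ _))) -comp_assoc e_s.
rewrite (comp_pre (s_pent _ _ _)) -!comp_assoc -e_nat.
rewrite (comp_pre (esym (bmor_compr _ _ _ _))) e_s bmor_compr -comp_assoc.
by rewrite (comp_pre (e_s _ _)) -comp_assoc.
Qed.

End Transport.

(* Half-braidings of [c], the hexagon being written without inverses of the
   associator. The unit condition on [cbr unit_ob] follows from it. *)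
Record center_ob (k : fieldType) (C : linMon k) := Center {
  cob :> C;
  cbr : forall x, isomor (cob ⊗ x) (x ⊗ cob);
  cbr_nat : forall x x' (f : mor x x'),
    cbr x' ∘ (idmor cob [⊗] f) = (f [⊗] idmor cob) ∘ cbr x;
  cbr_hexagon : forall x y,
    tassoc x y cob ∘ cbr (x ⊗ y) ∘ tassoc cob x y
    = (idmor x [⊗] cbr y) ∘ tassoc x cob y ∘ (cbr x [⊗] idmor y) }.

Arguments cbr {k C} _ _.

Section ModuleFunctors.
Variables (k : fieldType) (C : linMon k).

Program Definition linFun_comp (A B D : linCat k) (G : linFun B D) (F : linFun A B) :
    linFun A D :=
  @LinFun k A D (fun x => fob G (fob F x)) (fun x y f => fmor G (fmor F f)) _ _ _.
Next Obligation. by move=> * /=; rewrite !fmor_id. Qed.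
Next Obligation. by move=> * /=; rewrite !fmor_comp. Qed.
Next Obligation. by move=> * /=; rewrite !fmor_lin. Qed.

Program Definition modFun_comp (L M N : modCat C) (G : modFun M N) (F : modFun L M) :
    modFun L N :=
  @ModFun k C L N (linFun_comp G F)
    (fun x m => iso_comp (mstr G x (F m)) (fmor_iso G (mstr F x m))) _ _ _.
Next Obligation.
move=> L M N G F x x' m m' f g /=.
by rewrite -comp_assoc -fmor_comp mstr_nat fmor_comp comp_assoc mstr_nat comp_assoc.
Qed.
Next Obligation.
move=> L M N G F x y m /=.
rewrite (comp_pre (mstr_pentagon G _ _ _)) -!comp_assoc -fmor_comp mstr_pentagon.
rewrite !fmor_comp bmor_compr -!comp_assoc (comp_pre (mstr_nat G _ _)).
by rewrite -!comp_assoc.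
Qed.
Next Obligation.
by move=> L M N G F m /=; rewrite (comp_pre (mstr_triangle G _)) -fmor_comp mstr_triangle.
Qed.

Section ModNat.
Variables (M N : modCat C).

Definition is_modNat (F G : modFun M N) (e : prodmod (fun m : M => mor (F m) (G m))) :=
  (forall m m' (f : mor m m'), e m' ∘ fmor F f = fmor G f ∘ e m) /\
  (forall x m, mstr G x m ∘ e (x ▷ m) = (idmor x [▷] e m) ∘ mstr F x m).

Lemma modNat_closed F G : lin_closed (@is_modNat F G).
Proof.
split=> [|a e e' [n s] [n' s']]; split=> *.
- by rewrite comp_0l comp_0r.
- by rewrite bmor_0r comp_0l comp_0r.
- by rewrite comp_lin_l comp_lin_r n n'.
- by rewrite bmor_lin_r comp_lin_l comp_lin_r s s'.
Qed.

Definition modNat (F G : modFun M N) : lmodType k := subspace (modNat_closed F G).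

Lemma modNat_id F : @is_modNat F F (fun m => idmor (F m)).
Proof. by split=> *; rewrite ?bmor_id comp_id_l comp_id_r. Qed.

Lemma modNat_comp F G H (e' : modNat G H) (e : modNat F G) :
  @is_modNat F H (fun m => subval e' m ∘ subval e m).
Proof.
have [[n' s'] [n s]] := (subspaceP e', subspaceP e); split=> *.
  by rewrite -comp_assoc n comp_assoc n' comp_assoc.
by rewrite comp_assoc s' -comp_assoc s comp_assoc -bmor_compr.
Qed.

Program Definition funCat : linCat k :=
  @LinCat k (modFun M N) modNat (fun F => mkSub (modNat_closed F F) (modNat_id F))
    (fun F G H e' e => mkSub (modNat_closed F H) (modNat_comp e' e)) _ _ _ _ _.
Next Obligation.
by move=> F G e; apply/subspace_eq/functional_extensionality_dep=> m; exact: comp_id_l.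
Qed.
Next Obligation.
by move=> F G e; apply/subspace_eq/functional_extensionality_dep=> m; exact: comp_id_r.
Qed.
Next Obligation.
by move=> *; apply/subspace_eq/functional_extensionality_dep=> m; exact: comp_assoc.
Qed.
Next Obligation.
by move=> *; apply/subspace_eq/functional_extensionality_dep=> m; exact: comp_lin_l.
Qed.
Next Obligation.
by move=> *; apply/subspace_eq/functional_extensionality_dep=> m; exact: comp_lin_r.
Qed.

Lemma modNat_eq (F G : modFun M N) (e e' : modNat F G) :
  (forall m, subval e m = subval e' m) -> e = e'.
Proof. by move=> h; apply/subspace_eq/functional_extensionality_dep. Qed.

Lemma modNat_inv (F G : modFun M N) (e : forall m, isomor (F m) (G m)) :
  is_modNat (fun m => fwd (e m)) -> @is_modNat G F (fun m => bwd (e m)).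
Proof.
move=> [n s]; split=> [m m' f|x m].
  apply: (iso_epi (i := e m)); apply: (iso_mono (i := e m')).
  by rewrite -!comp_assoc fwdK comp_id_r -n (comp_pre (bwdK _)) comp_id_l.
apply: (iso_epi (i := e (x ▷ m))).
apply: (iso_mono (i := bmor_iso (cact N) (iso_id x) (e m))).
rewrite /= -!comp_assoc fwdK comp_id_r s (comp_pre (esym (bmor_compr _ _ _ _))).
by rewrite bwdK bmor_id comp_id_l.
Qed.

Program Definition modNat_iso (F G : modFun M N) (e : forall m, isomor (F m) (G m))
    (en : is_modNat (fun m => fwd (e m))) : @isomor k funCat F G :=
  @Isomor k funCat F G (mkSub (modNat_closed F G) en)
    (mkSub (modNat_closed G F) (modNat_inv en)) _ _.
Next Obligation. by move=> F G e en; apply: modNat_eq => m; exact: fwdK. Qed.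
Next Obligation. by move=> F G e en; apply: modNat_eq => m; exact: bwdK. Qed.

End ModNat.

End ModuleFunctors.

Section StrengthCentral.
Variables (k : fieldType) (C : linMon k) (N : modCat C) (c d : C) (f : mor c d).
Variables (b : forall x, isomor (c ⊗ x) (x ⊗ c)) (g : forall x, isomor (d ⊗ x) (x ⊗ d)).
Variable sc : forall (x : C) (m : N), isomor (c ▷ x ▷ m) (x ▷ c ▷ m).
Variable sd : forall (x : C) (m : N), isomor (d ▷ x ▷ m) (x ▷ d ▷ m).
Hypothesis sc_massoc : forall x m,
  sc x m ∘ massoc c x m = massoc x c m ∘ (b x [▷] idmor m).
Hypothesis sd_massoc : forall x m,
  sd x m ∘ massoc d x m = massoc x d m ∘ (g x [▷] idmor m).

Let centralL x m : (sd x m ∘ (f [▷] idmor (x ▷ m))) ∘ massoc c x m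
  = massoc x d m ∘ ((g x ∘ (f [⊗] idmor x)) [▷] idmor m).
Proof.
by rewrite -comp_assoc -massoc_natl (comp_pre (sd_massoc _ _)) -comp_assoc -bmor_compl.
Qed.
Let centralR x m : ((idmor x [▷] f [▷] idmor m) ∘ sc x m) ∘ massoc c x m
  = massoc x d m ∘ (((idmor x [⊗] f) ∘ b x) [▷] idmor m).
Proof.
by rewrite -comp_assoc sc_massoc (comp_pre (esym (massoc_natm _ _ _))) -comp_assoc -bmor_compl.
Qed.

Lemma strength_central :
  (forall x, g x ∘ (f [⊗] idmor x) = (idmor x [⊗] f) ∘ b x) ->
  forall x m, sd x m ∘ (f [▷] idmor (x ▷ m)) = (idmor x [▷] f [▷] idmor m) ∘ sc x m.
Proof.
by move=> cf x m; apply: (iso_epi (i := massoc c x m)); rewrite centralL centralR cf.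
Qed.

Lemma act_central :
  (forall x m, sd x m ∘ (f [▷] idmor (x ▷ m)) = (idmor x [▷] f [▷] idmor m) ∘ sc x m) ->
  forall x (m : N), (g x ∘ (f [⊗] idmor x)) [▷] idmor m = ((idmor x [⊗] f) ∘ b x) [▷] idmor m.
Proof.
by move=> e x m; apply: (iso_mono (i := massoc x d m)); rewrite -centralL -centralR e.
Qed.

End StrengthCentral.

(* For a half-braiding [b] of [c], the map [c ▷ (x ▷ m) -> x ▷ (c ▷ m)] it induces
   on a module category. *)
Program Definition strength (k : fieldType) (C : linMon k) (c : C)
    (b : forall x, isomor (c ⊗ x) (x ⊗ c)) (N : modCat C) (x : C) (m : N) :
    isomor (c ▷ x ▷ m) (x ▷ c ▷ m) :=
  @Isomor k N _ _ (massoc x c m ∘ (b x [▷] idmor m) ∘ bwd (massoc c x m))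
    (massoc c x m ∘ (bwd (b x) [▷] idmor m) ∘ bwd (massoc x c m)) _ _.
Next Obligation.
move=> * /=; rewrite -!comp_assoc (comp_pre (fwdK _)) comp_id_l (comp_pre (esym (bmor_compl _ _ _ _))).
by rewrite fwdK bmor_id comp_id_l bwdK.
Qed.
Next Obligation.
move=> * /=; rewrite -!comp_assoc (comp_pre (fwdK _)) comp_id_l (comp_pre (esym (bmor_compl _ _ _ _))).
by rewrite bwdK bmor_id comp_id_l bwdK.
Qed.

Lemma strength_massoc (k : fieldType) (C : linMon k) (c : C)
    (b : forall x, isomor (c ⊗ x) (x ⊗ c)) (N : modCat C) (x : C) (m : N) :
  strength b x m ∘ massoc c x m = massoc x c m ∘ (b x [▷] idmor m).
Proof. by rewrite /= -!comp_assoc fwdK comp_id_r. Qed.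

Lemma tens_unit_inj (k : fieldType) (C : linMon k) (x y : C) (f g : mor x y) :
  f [⊗] idmor (unit_ob : C) = g [⊗] idmor (unit_ob : C) -> f = g.
Proof. by move=> e; apply: (iso_epi (i := runit x)); rewrite -!runit_nat e. Qed.

Section StrengthAssoc.
Variables (k : fieldType) (C : linMon k) (N : modCat C) (c d e : C).
Variable sc : forall (x : C) (m : N), isomor (c ▷ x ▷ m) (x ▷ c ▷ m).
Variable sd : forall (x : C) (m : N), isomor (d ▷ x ▷ m) (x ▷ d ▷ m).
Variable se : forall (x : C) (m : N), isomor (e ▷ x ▷ m) (x ▷ e ▷ m).
Variable scd : forall (x : C) (m : N), isomor ((c ⊗ d) ▷ x ▷ m) (x ▷ (c ⊗ d) ▷ m).
Variable sde : forall (x : C) (m : N), isomor ((d ⊗ e) ▷ x ▷ m) (x ▷ (d ⊗ e) ▷ m).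
Variable sl : forall (x : C) (m : N), isomor ((c ⊗ d ⊗ e) ▷ x ▷ m) (x ▷ (c ⊗ d ⊗ e) ▷ m).
Variable sr : forall (x : C) (m : N), isomor ((c ⊗ (d ⊗ e)) ▷ x ▷ m) (x ▷ (c ⊗ (d ⊗ e)) ▷ m).
Hypothesis sc_nat : forall x m m' (g : mor m m'),
  sc x m' ∘ (idmor c [▷] idmor x [▷] g) = (idmor x [▷] idmor c [▷] g) ∘ sc x m.
Hypothesis scdE : forall x m, (idmor x [▷] massoc c d m) ∘ scd x m
  = sc x (d ▷ m) ∘ (idmor c [▷] sd x m) ∘ massoc c d (x ▷ m).
Hypothesis sdeE : forall x m, (idmor x [▷] massoc d e m) ∘ sde x m
  = sd x (e ▷ m) ∘ (idmor d [▷] se x m) ∘ massoc d e (x ▷ m).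
Hypothesis slE : forall x m, (idmor x [▷] massoc (c ⊗ d) e m) ∘ sl x m
  = scd x (e ▷ m) ∘ (idmor (c ⊗ d) [▷] se x m) ∘ massoc (c ⊗ d) e (x ▷ m).
Hypothesis srE : forall x m, (idmor x [▷] massoc c (d ⊗ e) m) ∘ sr x m
  = sc x ((d ⊗ e) ▷ m) ∘ (idmor c [▷] sde x m) ∘ massoc c (d ⊗ e) (x ▷ m).

Lemma strength_assoc x m :
  sr x m ∘ (tassoc c d e [▷] idmor (x ▷ m)) = (idmor x [▷] tassoc c d e [▷] idmor m) ∘ sl x m.
Proof.
apply: (iso_mono (i := bmor_iso (cact N) (iso_id x) (massoc c (d ⊗ e) m))).
apply: (iso_mono (i := bmor_iso (cact N) (iso_id x)
  (bmor_iso (cact N) (iso_id c) (massoc d e m)))).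
rewrite /= (comp_pre (srE _ _)) -!comp_assoc (comp_pre (esym (sc_nat _ _))) -!comp_assoc.
rewrite (comp_pre (esym (bmor_compr _ _ _ _))) sdeE !bmor_compr -!comp_assoc act_pentagon.
have pentx := congr1 (bmor (cact N) (idmor x)) (act_pentagon c d e m).
rewrite !bmor_compr in pentx; rewrite (comp_pre3 pentx) -comp_assoc slE.
rewrite (comp_pre (scdE _ _)) -!comp_assoc.
by rewrite (comp_pre (massoc_natr _ _ _)) -!comp_assoc.
Qed.

End StrengthAssoc.

Section CenterCategory.
Variables (k : fieldType) (C : linMon k).
Implicit Types z w v : center_ob C.

Definition is_central z w (f : mor (z : C) w) :=
  forall x, cbr w x ∘ (f [⊗] idmor x) = (idmor x [⊗] f) ∘ cbr z x.

Lemma central_closed z w : lin_closed (@is_central z w).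
Proof.
split=> [x|a f g cf cg x]; first by rewrite bmor_0l bmor_0r comp_0l comp_0r.
by rewrite bmor_lin_l bmor_lin_r comp_lin_l comp_lin_r cf cg.
Qed.

Definition center_mor z w : lmodType k := subspace (central_closed z w).

Lemma central_id z : @is_central z z (idmor (z : C)).
Proof. by move=> x; rewrite !bmor_id comp_id_l comp_id_r. Qed.

Lemma central_comp z w v (g : mor (w : C) v) (f : mor (z : C) w) :
  is_central g -> is_central f -> @is_central z v (g ∘ f).
Proof.
by move=> cg cf x; rewrite bmor_compl bmor_compr comp_assoc cg -comp_assoc cf comp_assoc.
Qed.

Lemma central_bwd z w (i : isomor (z : C) w) :
  is_central (fwd i) -> @is_central w z (bwd i).
Proof.
move=> ci x; apply: (iso_mono (i := bmor_iso (tens C) (iso_id x) i)).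
apply: (iso_epi (i := bmor_iso (tens C) i (iso_id x))).
rewrite /= -!comp_assoc -bmor_comp fwdK comp_id_l bmor_id comp_id_r.
by rewrite ci (comp_pre (esym (bmor_compr _ _ _ _))) bwdK bmor_id comp_id_l.
Qed.

Program Definition centerCat : linCat k :=
  @LinCat k (center_ob C) center_mor
    (fun z => mkSub (central_closed z z) (@central_id z))
    (fun z w v g f =>
       mkSub (central_closed z v) (central_comp (subspaceP g) (subspaceP f))) _ _ _ _ _.
Next Obligation. by move=> *; apply/subspace_eq; exact: comp_id_l. Qed.
Next Obligation. by move=> *; apply/subspace_eq; exact: comp_id_r. Qed.
Next Obligation. by move=> *; apply/subspace_eq; exact: comp_assoc. Qed.
Next Obligation. by move=> *; apply/subspace_eq; exact: comp_lin_l. Qed.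
Next Obligation. by move=> *; apply/subspace_eq; exact: comp_lin_r. Qed.

Program Definition center_iso z w (i : isomor (z : C) w) (ci : is_central (fwd i)) :
    @isomor k centerCat z w :=
  @Isomor k centerCat z w (mkSub (central_closed z w) ci)
    (mkSub (central_closed w z) (central_bwd ci)) _ _.
Next Obligation. by move=> *; apply/subspace_eq; exact: fwdK. Qed.
Next Obligation. by move=> *; apply/subspace_eq; exact: bwdK. Qed.

(* The module functor [c ▷ -] of an object [(c, nu)] of the center. *)
Program Definition center_act (N : modCat C) z : modFun N N :=
  @ModFun k C N N (bfix_l (cact N) (z : C)) (fun x m => strength (cbr z) x m) _ _ _.
Next Obligation.
move=> N z x x' m m' f g.
exact: (strength_nat_of (strength_massoc (cbr z) (N := N)) (@cbr_nat k C z)).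
Qed.
Next Obligation.
move=> N z x y m.
exact: (strength_pentagon_of (strength_massoc (cbr z) (N := N)) (@cbr_hexagon k C z)).
Qed.
Next Obligation.
move=> N z m.
apply: (mod_triangle (F := bfix_l (cact N) (z : C)) (s := fun x m => strength (cbr z) x m)).
  move=> x x' m1 m2 f g.
  exact: (strength_nat_of (strength_massoc (cbr z) (N := N)) (@cbr_nat k C z)).
move=> x y m1.
exact: (strength_pentagon_of (strength_massoc (cbr z) (N := N)) (@cbr_hexagon k C z)).
Qed.

(* The half-braiding of [(z, nu) ⊗ (w, mu)]: braid [w] past [x], then [z]. *)
Definition tens_br z w (x : C) : isomor (z ⊗ w ⊗ x) (x ⊗ (z ⊗ w)) :=
  iso_comp (tassoc x z w)
    (iso_comp (bmor_iso (tens C) (cbr z x) (iso_id (w : C)))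
      (iso_comp (iso_inv (tassoc (z : C) x w))
        (iso_comp (bmor_iso (tens C) (iso_id (z : C)) (cbr w x))
          (tassoc (z : C) w x)))).

Lemma strength_tens_br (N : modCat C) z w (x : C) (m : N) :
  (idmor x [▷] massoc (z : C) w m) ∘ strength (tens_br z w) x m
  = strength (cbr z) x ((w : C) ▷ m) ∘ (idmor (z : C) [▷] strength (cbr w) x m)
     ∘ massoc (z : C) w (x ▷ m).
Proof.
exact: (strength_tens (strength_massoc (cbr z) (N := N)) (strength_massoc (cbr w) (N := N))
          (strength_massoc (tens_br z w) (N := N))).
Qed.

Lemma tens_br_nat z w x x' (f : mor x x') :
  tens_br z w x' ∘ (idmor ((z : C) ⊗ w) [⊗] f) = (f [⊗] idmor ((z : C) ⊗ w)) ∘ tens_br z w x.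
Proof.
have inv_nat : bwd (tassoc (z : C) x' w) ∘ (idmor (z : C) [⊗] (f [⊗] idmor (w : C)))
  = (idmor (z : C) [⊗] f [⊗] idmor (w : C)) ∘ bwd (tassoc (z : C) x w).
  apply: (iso_mono (i := tassoc (z : C) x' w)); apply: (iso_epi (i := tassoc (z : C) x w)).
  by rewrite -!comp_assoc fwdK comp_id_r (comp_pre (bwdK _)) comp_id_l tassoc_nat.
rewrite /= -!comp_assoc -(bmor_id (tens C) (z : C) w) tassoc_nat.
rewrite (comp_pre (esym (bmor_compr _ _ _ _))) cbr_nat bmor_compr -comp_assoc.
rewrite (comp_pre inv_nat) -comp_assoc (comp_pre (esym (bmor_compl _ _ _ _))) cbr_nat bmor_compl.
by rewrite -comp_assoc (comp_pre (tassoc_nat _ _ _)) -comp_assoc.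
Qed.

Lemma tens_br_hexagon z w (x y : C) :
  tassoc x y (z ⊗ w) ∘ tens_br z w (x ⊗ y) ∘ tassoc (z ⊗ w) x y
  = (idmor x [⊗] tens_br z w y) ∘ tassoc x (z ⊗ w) y ∘ (tens_br z w x [⊗] idmor y).
Proof.
apply: tens_unit_inj.
apply: (act_hexagon_of (N := regMod C) (strength_massoc (tens_br z w) (N := regMod C))).
pose zw := modFun_comp (center_act (regMod C) z) (center_act (regMod C) w).
apply: (transport_pentagon (D := regMod C) (F := zw)
  (G := bfix_l (tens C) ((z : C) ⊗ w)) (s := mstr zw)
  (e := fun m => massoc (m0 := regMod C) (z : C) w m)).
- by move=> m m' f; exact: massoc_natr.
- by move=> x1 m; rewrite (strength_tens_br (N := regMod C)) comp_assoc.
- by move=> x1 y1 m; exact: (mstr_pentagon zw).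
Qed.

Definition center_tens z w : center_ob C := Center (@tens_br_nat z w) (@tens_br_hexagon z w).

Definition unit_br (x : C) : isomor (unit_ob ⊗ x) (x ⊗ unit_ob) :=
  iso_comp (iso_inv (runit x)) (lunit x).

Lemma strength_unit_br (N : modCat C) (x : C) (m : N) :
  (idmor x [▷] munit m) ∘ strength unit_br x m = munit (x ▷ m).
Proof.
apply: (iso_epi (i := massoc unit_ob x m)); rewrite munit_massoc -comp_assoc.
rewrite (strength_massoc unit_br) (comp_pre (act_triangle _ _)) -bmor_compl /=.
by rewrite (comp_pre (bwdK _)) comp_id_l.
Qed.

Program Definition linFun_id (A : linCat k) : linFun A A :=
  @LinFun k A A id (fun x y f => f) _ _ _.
Next Obligation. by []. Qed.
Next Obligation. by []. Qed.
Next Obligation. by []. Qed.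

Lemma unit_br_nat x x' (f : mor x x') :
  unit_br x' ∘ (idmor (unit_ob : C) [⊗] f) = (f [⊗] idmor (unit_ob : C)) ∘ unit_br x.
Proof.
apply: (iso_mono (i := runit x')); rewrite /= -!comp_assoc.
by rewrite (comp_pre (bwdK _)) comp_id_l lunit_nat (comp_pre (runit_nat _)) -comp_assoc
  (comp_pre (bwdK _)) comp_id_l.
Qed.

Lemma unit_br_hexagon (x y : C) :
  tassoc x y unit_ob ∘ unit_br (x ⊗ y) ∘ tassoc unit_ob x y
  = (idmor x [⊗] unit_br y) ∘ tassoc x unit_ob y ∘ (unit_br x [⊗] idmor y).
Proof.
apply: tens_unit_inj.
apply: (act_hexagon_of (N := regMod C) (strength_massoc unit_br (N := regMod C))).
move=> {}x {}y m.
apply: (transport_pentagon (D := regMod C) (N := regMod C) (F := linFun_id (regMod C))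
  (G := bfix_l (cact (regMod C)) (unit_ob : C))
  (s := fun x (m : regMod C) => iso_id (x ▷ m))
  (s' := fun x m => strength unit_br x m)
  (e := fun m => munit (m0 := regMod C) m)).
- by move=> m1 m2 f; exact: lunit_nat.
- by move=> x1 m1; rewrite /= comp_id_l; exact: (strength_unit_br (N := regMod C)).
- by move=> x1 y1 m1; rewrite /= bmor_id !comp_id_l comp_id_r.
Qed.

Definition center_unit : center_ob C := Center unit_br_nat unit_br_hexagon.

Lemma central_tens z z' w w' (f : center_mor z z') (g : center_mor w w') :
  @is_central (center_tens z w) (center_tens z' w') (subval f [⊗] subval g).
Proof.
move=> x; have [cf cg] := (subspaceP f, subspaceP g).
have inv_nat : bwd (tassoc (z' : C) x w') ∘ (subval f [⊗] (idmor x [⊗] subval g))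
  = (subval f [⊗] idmor x [⊗] subval g) ∘ bwd (tassoc (z : C) x w).
  apply: (iso_mono (i := tassoc (z' : C) x w')); apply: (iso_epi (i := tassoc (z : C) x w)).
  by rewrite -!comp_assoc fwdK comp_id_r (comp_pre (bwdK _)) comp_id_l tassoc_nat.
rewrite /= -!comp_assoc tassoc_nat (comp_pre (esym (bmor_comp _ _ _ _ _))) cg comp_id_l.
rewrite -[in LHS](comp_id_r (subval f)) bmor_comp -comp_assoc (comp_pre inv_nat) -comp_assoc.
rewrite (comp_pre (esym (bmor_comp _ _ _ _ _))) cf comp_id_l.
rewrite -[in LHS](comp_id_r (subval g)) bmor_comp -comp_assoc.
by rewrite (comp_pre (tassoc_nat _ _ _)) -comp_assoc.
Qed.

Program Definition center_tensor : bilinFun centerCat centerCat centerCat :=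
  @BilinFun k centerCat centerCat centerCat center_tens
    (fun z z' w w' f g =>
       mkSub (central_closed (center_tens z w) (center_tens z' w')) (central_tens f g)) _ _ _ _.
Next Obligation. by move=> *; apply/subspace_eq; exact: bmor_id. Qed.
Next Obligation. by move=> *; apply/subspace_eq; exact: bmor_comp. Qed.
Next Obligation. by move=> *; apply/subspace_eq; exact: bmor_lin_l. Qed.
Next Obligation. by move=> *; apply/subspace_eq; exact: bmor_lin_r. Qed.

Lemma central_of_strength z w (f : mor (z : C) w) :
  (forall x (m : regMod C), strength (cbr w) x m ∘ (f [▷] idmor (x ▷ m))
     = (idmor x [▷] f [▷] idmor m) ∘ strength (cbr z) x m) ->
  is_central f.
Proof.
move=> e x; apply: tens_unit_inj.
exact: (act_central (N := regMod C) (strength_massoc (cbr z) (N := regMod C))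
  (strength_massoc (cbr w) (N := regMod C)) e).
Qed.

Lemma central_assoc z w v :
  @is_central (center_tens (center_tens z w) v) (center_tens z (center_tens w v))
    (fwd (tassoc (z : C) w v)).
Proof.
apply: central_of_strength => x m.
apply: (strength_assoc (N := regMod C) (sc := fun x m => strength (cbr z) x m)
  (sd := fun x m => strength (cbr w) x m) (se := fun x m => strength (cbr v) x m)
  (scd := fun x m => strength (tens_br z w) x m)
  (sde := fun x m => strength (tens_br w v) x m)
  (sl := fun x m => strength (tens_br (center_tens z w) v) x m)
  (sr := fun x m => strength (tens_br z (center_tens w v)) x m)) => *.
- exact: (strength_nat_of (strength_massoc (cbr z) (N := regMod C)) (@cbr_nat k C z)).
- exact: (strength_tens_br (N := regMod C) z w).
- exact: (strength_tens_br (N := regMod C) w v).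
- exact: (strength_tens_br (N := regMod C) (center_tens z w) v).
- exact: (strength_tens_br (N := regMod C) z (center_tens w v)).
Qed.

Lemma strength_lunit (N : modCat C) z (x : C) (m : N) :
  strength (cbr z) x m ∘ (lunit (z : C) [▷] idmor (x ▷ m))
  = (idmor x [▷] lunit (z : C) [▷] idmor m) ∘ strength (tens_br center_unit z) x m.
Proof.
rewrite -!munit_massoc bmor_compr -(comp_assoc _ _ (fwd (strength (tens_br _ _) _ _))).
rewrite (strength_tens_br center_unit) (comp_assoc _ (fwd (strength _ _ _))).
by rewrite (strength_unit_br) (comp_pre (munit_nat _)) -!comp_assoc.
Qed.

Lemma strength_runit (N : modCat C) z (x : C) (m : N) :
  strength (cbr z) x m ∘ (runit (z : C) [▷] idmor (x ▷ m))
  = (idmor x [▷] runit (z : C) [▷] idmor m) ∘ strength (tens_br z center_unit) x m.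
Proof.
rewrite -!act_triangle bmor_compr -(comp_assoc _ _ (fwd (strength (tens_br _ _) _ _))).
rewrite (strength_tens_br z center_unit) (comp_assoc _ (fwd (strength _ _ _))).
rewrite -(strength_nat_of (strength_massoc (cbr z) (N := N)) (@cbr_nat k C z)).
by rewrite -comp_assoc (comp_pre (esym (bmor_compr _ _ _ _))) strength_unit_br.
Qed.

Lemma central_lunit z : @is_central (center_tens center_unit z) z (fwd (lunit (z : C))).
Proof. by apply: central_of_strength => x m; exact: strength_lunit. Qed.

Lemma central_runit z : @is_central (center_tens z center_unit) z (fwd (runit (z : C))).
Proof. by apply: central_of_strength => x m; exact: strength_runit. Qed.

Program Definition drinfeld_center : linMon k :=
  @LinMon k centerCat center_tensor center_unit
    (fun z w v => center_iso (@central_assoc z w v))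
    (fun z => center_iso (@central_lunit z)) (fun z => center_iso (@central_runit z))
    _ _ _ _ _.
Next Obligation. by move=> *; apply/subspace_eq; exact: tassoc_nat. Qed.
Next Obligation. by move=> *; apply/subspace_eq; exact: lunit_nat. Qed.
Next Obligation. by move=> *; apply/subspace_eq; exact: runit_nat. Qed.
Next Obligation. by move=> *; apply/subspace_eq; exact: tens_pentagon. Qed.
Next Obligation. by move=> *; apply/subspace_eq; exact: tens_triangle. Qed.

End CenterCategory.

Section FunctorModuleCategory.
Variables (k : fieldType) (C : linMon k) (M N : modCat C).
Implicit Types (z w : center_ob C) (H : modFun M N).

(* [(c, nu) ▷ H] is [H] followed by the module functor [c ▷ -]. *)
Definition fun_act_ob z H : modFun M N := modFun_comp (center_act N z) H.

Lemma modNat_act z w (f : center_mor z w) H H' (e : modNat H H') :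
  @is_modNat k C M N (fun_act_ob z H) (fun_act_ob w H')
    (fun m => subval f [▷] subval e m).
Proof.
have cf := subspaceP f; have [en es] := subspaceP e; split=> [m m' g|x m].
  by rewrite /= -!bmor_comp comp_id_l comp_id_r en.
have cs := strength_central (strength_massoc (cbr z) (N := N))
  (strength_massoc (cbr w) (N := N)) cf x.
have sn := strength_nat_of (strength_massoc (cbr w) (N := N)) (@cbr_nat k C w).
change ((strength (cbr w) x (H' m) ∘ (idmor (w : C) [▷] mstr H' x m))
    ∘ (subval f [▷] subval e (x ▷ m))
  = (idmor x [▷] subval f [▷] subval e m)
    ∘ strength (cbr z) x (H m) ∘ (idmor (z : C) [▷] mstr H x m)).
move: (strength (cbr w)) (strength (cbr z)) cs sn => sw sz cs sn.
rewrite -comp_assoc -bmor_comp comp_id_l es.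
rewrite -[subval f in LHS]comp_id_r bmor_comp comp_assoc.
have -> : sw N x (H' m) ∘ (subval f [▷] (idmor x [▷] subval e m))
  = (idmor x [▷] subval f [▷] subval e m) ∘ sz N x (H m).
  rewrite -(bmor_rl (cact N) (subval f)) comp_assoc sn -comp_assoc cs comp_assoc.
  by rewrite -bmor_compr bmor_rl.
by rewrite comp_assoc.
Qed.

Program Definition fun_act : bilinFun (drinfeld_center C) (funCat M N) (funCat M N) :=
  @BilinFun k (drinfeld_center C) (funCat M N) (funCat M N) fun_act_ob
    (fun z w H H' f e =>
      mkSub (modNat_closed (fun_act_ob z H) (fun_act_ob w H')) (modNat_act f e)) _ _ _ _.
Next Obligation. by move=> *; apply: modNat_eq => m; exact: bmor_id. Qed.
Next Obligation. by move=> *; apply: modNat_eq => m; exact: bmor_comp. Qed.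
Next Obligation. by move=> *; apply: modNat_eq => m; exact: bmor_lin_l. Qed.
Next Obligation. by move=> *; apply: modNat_eq => m; exact: bmor_lin_r. Qed.

Lemma modNat_assoc z w H :
  @is_modNat k C M N (fun_act_ob (center_tens z w) H) (fun_act_ob z (fun_act_ob w H))
    (fun m => fwd (massoc (z : C) w (H m))).
Proof.
split=> [m m' g|x m]; first exact: massoc_natr.
have se := strength_tens_br z w x (H m).
change ((strength (cbr z) x ((w : C) ▷ H m)
      ∘ (idmor (z : C) [▷] (strength (cbr w) x (H m) ∘ (idmor (w : C) [▷] mstr H x m))))
    ∘ massoc (z : C) w (H (x ▷ m))
  = (idmor x [▷] massoc (z : C) w (H m))
    ∘ strength (tens_br z w) x (H m) ∘ (idmor ((z : C) ⊗ w) [▷] mstr H x m)).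
move: (strength (cbr w)) (strength (cbr z)) (strength (tens_br z w)) se => sw sz szw se.
rewrite (comp_pre se) bmor_compr -!comp_assoc; congr (_ ∘ _ ∘ _).
by rewrite massoc_natr.
Qed.

Lemma modNat_unit H :
  @is_modNat k C M N (fun_act_ob (center_unit C) H) H (fun m => fwd (munit (H m))).
Proof.
split=> [m m' g|x m]; first exact: munit_nat.
have se := strength_unit_br x (H m).
change (mstr H x m ∘ munit (H (x ▷ m)) = (idmor x [▷] munit (H m))
   ∘ strength (@unit_br k C) x (H m) ∘ (idmor (unit_ob : C) [▷] mstr H x m)).
by rewrite (comp_pre se) munit_nat.
Qed.

(* [Fun_C(M, N)] as a module category over the Drinfeld center. *)
Program Definition fun_modCat : modCat (drinfeld_center C) :=
  @ModCat k (drinfeld_center C) (funCat M N) fun_act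
    (fun z w H => modNat_iso (modNat_assoc z w H)) (fun H => modNat_iso (modNat_unit H))
    _ _ _ _.
Next Obligation. by move=> *; apply: modNat_eq => m; exact: massoc_nat. Qed.
Next Obligation. by move=> *; apply: modNat_eq => m; exact: munit_nat. Qed.
Next Obligation. by move=> *; apply: modNat_eq => m; exact: act_pentagon. Qed.
Next Obligation. by move=> *; apply: modNat_eq => m; exact: act_triangle. Qed.

End FunctorModuleCategory.

(* Main.v *)
(* Write Fun for Fun_C(M, N), with objects H.

   Fun is finite. Kernels and cokernels are computed pointwise. Since a module functor
   H out of the exact category M preserves epimorphisms (tensor with a projective cover
   of the unit and split), evaluation at a projective generator m0 of M is exact and
   faithful on Fun; this bounds Hom-spaces and lengths. The internal Hom R = Hom(m0, -)
   makes R(-) |> n left adjoint to evaluation, so that these functors, for n projective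
   in N, are enough projectives.

   Exactness. Let p be projective in Z(C) and lift be : p |> H -> G through an
   epimorphism al : F -> G. The pairs (f : x -> p, t : x |> H -> F) with t a mere natural
   transformation and al t = be (f |> H) form a left exact functor of x in C, represented
   by some W. Its universal property endows W with a half-braiding for which f : W -> p
   is central and t : W |> H -> F is a module natural transformation. If f is epi, a
   central section of f gives the lift. That f is epi means that be (g |> H) lifts
   to F for every g : q -> p with q projective in C. Now q |> H splits short exact sequences and
   has projective values; as the field is algebraically closed, such a functor X is
   isomorphic to the sum of the Hom(P_i, -) (x) X(S_i), with P_i the projective covers of
   the simple objects S_i of M, and natural transformations out of it lift through
   pointwise epimorphisms. *)
Require Import Defs.
From HB Require Import structures.
From mathcomp Require Import all_boot all_order all_algebra.
From mathcomp Require Import boolp.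
Set Implicit Arguments. Unset Strict Implicit. Unset Printing Implicit Defensive.
Import GRing.Theory.
Local Open Scope ring_scope.

(** * Abelian categories *)

#[local] Obligation Tactic := idtac.

(** The transformations x ▷ H -> F that are merely natural are represented by an object of [C], the
    end over m of the internal Homs from H m to F m. The object W is the fibre product of p and this
    end over the corresponding end for G.

    The obstacle is that a lift found by projectivity in [C] ignores the module structure. The
    universal property repairs this. As v has a dual, v ⊗ W represents the same problem with v ⊗ p
    and v ▷ F in place of p and F. The two requirements, that f be central and that t respect the
    action of v, together prescribe one such datum on W ⊗ v, and this datum is classified by a
    single map W ⊗ v -> v ⊗ W. Naturality, hexagon and unit law follow from uniqueness, and
    invertibility from rigidity.

    Projectivity of p in the center then enters through the splitting of W -> p, which takes place
    in the center and therefore respects everything. *)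

Program Definition opCat (k : fieldType) (C : linCat k) : linCat k :=
  @LinCat k C (fun x y => @mor k C y x) (fun x => idmor x)
    (fun x y z g f => mcomp f g) _ _ _ _ _.
Next Obligation. by move=> *; exact: comp_id_r. Qed.
Next Obligation. by move=> *; exact: comp_id_l. Qed.
Next Obligation. by move=> *; rewrite /= comp_assoc. Qed.
Next Obligation. by move=> *; exact: comp_lin_r. Qed.
Next Obligation. by move=> *; exact: comp_lin_l. Qed.

Section Additive.
Variables (k : fieldType) (C : linCat k).
Implicit Types x y z w s t : C.

Lemma compDl x y z (g g' : mor y z) (f : mor x y) : (g + g') ∘ f = g ∘ f + g' ∘ f.
Proof. by have := comp_lin_l 1 g g' f; rewrite !scale1r. Qed.

Lemma compDr x y z (g : mor y z) (f f' : mor x y) : g ∘ (f + f') = g ∘ f + g ∘ f'.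
Proof. by have := comp_lin_r 1 g f f'; rewrite !scale1r. Qed.

Lemma compZl x y z a (g : mor y z) (f : mor x y) : (a *: g) ∘ f = a *: (g ∘ f).
Proof. by have := comp_lin_l a g 0 f; rewrite comp_0l !addr0. Qed.

Lemma compZr x y z a (g : mor y z) (f : mor x y) : g ∘ (a *: f) = a *: (g ∘ f).
Proof. by have := comp_lin_r a g f 0; rewrite comp_0r !addr0. Qed.

Lemma compNl x y z (g : mor y z) (f : mor x y) : (- g) ∘ f = - (g ∘ f).
Proof. by rewrite -scaleN1r compZl scaleN1r. Qed.

Lemma compNr x y z (g : mor y z) (f : mor x y) : g ∘ (- f) = - (g ∘ f).
Proof. by rewrite -scaleN1r compZr scaleN1r. Qed.

Lemma compBl x y z (g g' : mor y z) (f : mor x y) : (g - g') ∘ f = g ∘ f - g' ∘ f.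
Proof. by rewrite compDl compNl. Qed.

Lemma compBr x y z (g : mor y z) (f f' : mor x y) : g ∘ (f - f') = g ∘ f - g ∘ f'.
Proof. by rewrite compDr compNr. Qed.

Lemma comp_sumr x y z (I : Type) (r : seq I) (P : pred I) (g : mor y z) (f : I -> mor x y) :
  g ∘ (\sum_(i <- r | P i) f i) = \sum_(i <- r | P i) g ∘ f i.
Proof. by elim/big_rec2: _ => [|i a b _ <-]; rewrite ?comp_0r ?compDr. Qed.

Lemma monor0 x y (f : mor x y) : monomor f -> forall w (g : mor w x), f ∘ g = 0 -> g = 0.
Proof. by move=> mf w g e; apply: mf; rewrite e comp_0r. Qed.

Lemma mono_of0 x y (f : mor x y) : (forall w (g : mor w x), f ∘ g = 0 -> g = 0) -> monomor f.
Proof.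
by move=> h w g g' e; apply/subr0_eq/h; rewrite compBr e subrr.
Qed.

Lemma mono_comp x y z (g : mor y z) (f : mor x y) : monomor g -> monomor f -> monomor (g ∘ f).
Proof. by move=> mg mf w a b; rewrite -!comp_assoc => /mg /mf. Qed.

Lemma mono_cancel x y z (g : mor y z) (f : mor x y) : monomor (g ∘ f) -> monomor f.
Proof. by move=> m w a b e; apply: m; rewrite -!comp_assoc e. Qed.

Lemma split_mono x y (f : mor x y) (r : mor y x) : r ∘ f = idmor x -> monomor f.
Proof. by move=> e w a b h; rewrite -(comp_id_l a) -e -comp_assoc h comp_assoc e comp_id_l. Qed.

Lemma id_mono x : monomor (idmor x).
Proof. by move=> w a b; rewrite !comp_id_l. Qed.

Lemma iso_is_mono x y (f : mor x y) : is_iso f -> monomor f.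
Proof. by case=> g [e _]; exact: split_mono e. Qed.

Lemma is_iso_inv x y (i : isomor x y) : is_iso (fwd i).
Proof. by exists (bwd i); split; [exact: fwdK | exact: bwdK]. Qed.

Lemma comp_bwdK x y z (i : isomor x y) (f : mor y z) : (f ∘ fwd i) ∘ bwd i = f.
Proof. by rewrite -comp_assoc bwdK comp_id_r. Qed.

Lemma isomor_of x y (f : mor x y) : is_iso f -> {i : isomor x y | fwd i = f}.
Proof. by move=> /cid[g [e1 e2]]; exists (Isomor e1 e2). Qed.

Lemma zero_id x : is_zero x <-> idmor x = 0.
Proof.
split=> [h|e y]; first by have [h' _] := h x; exact: h'.
by split=> f; [rewrite -(comp_id_l f) e comp_0l | rewrite -(comp_id_r f) e comp_0r].
Qed.

Lemma kernel_mono x y w (f : mor x y) (i : mor w x) : is_kernel f i -> monomor i.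
Proof.
case=> fi u v g h e; have [|l [_ ul]] := u _ (i ∘ g); first by rewrite comp_assoc fi comp_0l.
by rewrite -(ul g erefl) -(ul h (esym e)).
Qed.

Lemma mk_kernel x y w (f : mor x y) (i : mor w x) : f ∘ i = 0 -> monomor i ->
  (forall v (g : mor v x), f ∘ g = 0 -> exists h : mor v w, i ∘ h = g) -> is_kernel f i.
Proof.
move=> fi mi h; split=> // v g /h[l <-]; exists l; split=> // l' /mi //.
Qed.

Lemma kernel_lift x y w (f : mor x y) (i : mor w x) : is_kernel f i ->
  forall v (g : mor v x), f ∘ g = 0 -> {h : mor v w | i ∘ h = g}.
Proof. by move=> [_ h] v g /h e; apply: cid; case: e => l [? _]; exists l. Qed.

Lemma kernel_comp_mono x y z w (m : mor y z) (f : mor x y) (i : mor w x) :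
  monomor m -> is_kernel f i -> is_kernel (m ∘ f) i.
Proof.
move=> mm [fi h]; split=> [|v g]; first by rewrite -comp_assoc fi comp_0r.
by rewrite -comp_assoc => /(monor0 mm) /h.
Qed.

Lemma kernel_of_comp_mono x y z w (m : mor y z) (f : mor x y) (i : mor w x) :
  monomor m -> is_kernel (m ∘ f) i -> is_kernel f i.
Proof.
move=> mm [fi h]; split=> [|v g e].
  by apply: (monor0 mm); rewrite comp_assoc.
by apply: h; rewrite -comp_assoc e comp_0r.
Qed.

Lemma kernel_unique x y w w' (f : mor x y) (i : mor w x) (i' : mor w' x) :
  is_kernel f i -> is_kernel f i' -> {s : isomor w w' | i' ∘ s = i}.
Proof.
move=> ki ki'; have [[fi _] [fi' _]] := (ki, ki').
have [s es] := kernel_lift ki' fi; have [t et] := kernel_lift ki fi'.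
have ts : t ∘ s = idmor w.
  by apply: (kernel_mono ki); rewrite comp_assoc et es comp_id_r.
have st : s ∘ t = idmor w'.
  by apply: (kernel_mono ki'); rewrite comp_assoc es et comp_id_r.
by exists (Isomor ts st).
Qed.

(** The source of structure isomorphisms on kernels: those of the pointwise kernel of a module
    natural transformation, and the half-braiding on the kernel of a central map. *)
Lemma kernel_transport x y x' y' w w' (f : mor x y) (f' : mor x' y') (i : mor w x)
    (i' : mor w' x') (s : isomor x x') (t : isomor y y') :
  is_kernel f i -> is_kernel f' i' -> f' ∘ s = t ∘ f ->
  {r : isomor w w' | i' ∘ r = s ∘ i}.
Proof.
move=> ki ki' e.
have k2 : is_kernel f (bwd s ∘ i').
  apply: mk_kernel.
  - apply: (iso_mono (i := t)); rewrite comp_assoc -e -comp_assoc (comp_pre (bwdK s)).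
    by rewrite comp_id_l (proj1 ki') comp_0r.
  - apply: mono_comp (kernel_mono ki').
    by apply: iso_is_mono; exact: (is_iso_inv (iso_inv s)).
  - move=> v g eg; have [|h eh] := kernel_lift ki' (g := s ∘ g).
      by rewrite comp_assoc e -comp_assoc eg comp_0r.
    by exists h; rewrite -comp_assoc eh comp_assoc fwdK comp_id_l.
have [r er] := kernel_unique ki k2; exists r.
by rewrite -er -comp_assoc (comp_pre (bwdK s)) comp_id_l.
Qed.

Lemma kernel_iso_mid x y x' w (f : mor x y) (i : mor w x) (s : isomor x' x) :
  is_kernel f i -> is_kernel (f ∘ s) (bwd s ∘ i).
Proof.
move=> ki; apply: mk_kernel.
- by rewrite -comp_assoc (comp_pre (bwdK s)) comp_id_l (proj1 ki).
- apply: mono_comp (kernel_mono ki).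
  by apply: iso_is_mono; exact: (is_iso_inv (iso_inv s)).
- move=> v g; rewrite -comp_assoc => eg; have [h eh] := kernel_lift ki eg.
  by exists h; rewrite -comp_assoc eh comp_assoc fwdK comp_id_l.
Qed.

Lemma kernel_iso_src x y w w' (f : mor x y) (i : mor w x) (s : isomor w' w) :
  is_kernel f i -> is_kernel f (i ∘ s).
Proof.
move=> ki; apply: mk_kernel.
- by rewrite comp_assoc (proj1 ki) comp_0l.
- by apply: mono_comp (kernel_mono ki) _; apply: iso_is_mono; exact: is_iso_inv.
- move=> v g eg; have [h eh] := kernel_lift ki eg.
  by exists (bwd s ∘ h); rewrite -comp_assoc (comp_pre (bwdK s)) comp_id_l.
Qed.

End Additive.

(** * Epimorphisms and cokernels, read off in the opposite category *)

Section AdditiveDual.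
Variables (k : fieldType) (C : linCat k).
Implicit Types x y z w s t : C.

Definition op_iso x y (i : isomor x y) : @isomor _ (opCat C) y x :=
  @Isomor _ (opCat C) y x (fwd i) (bwd i) (bwdK i) (fwdK i).

Definition unop_iso x y (i : @isomor _ (opCat C) y x) : isomor x y :=
  @Isomor _ C x y (fwd i) (bwd i) (bwdK i) (fwdK i).

Lemma epir0 x y (f : mor x y) : epimor f -> forall w (g : mor y w), g ∘ f = 0 -> g = 0.
Proof. exact: (@monor0 _ (opCat C)). Qed.

Lemma epi_of0 x y (f : mor x y) : (forall w (g : mor y w), g ∘ f = 0 -> g = 0) -> epimor f.
Proof. exact: (@mono_of0 _ (opCat C)). Qed.

Lemma epi_comp x y z (g : mor y z) (f : mor x y) : epimor g -> epimor f -> epimor (g ∘ f).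
Proof. by move=> eg ef; exact: (@mono_comp _ (opCat C) _ _ _ f g). Qed.

Lemma epi_cancel x y z (g : mor y z) (f : mor x y) : epimor (g ∘ f) -> epimor g.
Proof. exact: (@mono_cancel _ (opCat C)). Qed.

Lemma split_epi x y (f : mor x y) (s : mor y x) : f ∘ s = idmor y -> epimor f.
Proof. exact: (@split_mono _ (opCat C)). Qed.

Lemma id_epi x : epimor (idmor x).
Proof. exact: (@id_mono _ (opCat C)). Qed.

Lemma iso_is_epi x y (f : mor x y) : is_iso f -> epimor f.
Proof. by case=> g [_ e]; exact: split_epi e. Qed.

Lemma cokernel_epi x y w (f : mor x y) (p : mor y w) : is_cokernel f p -> epimor p.
Proof. exact: (@kernel_mono _ (opCat C)). Qed.

Lemma mk_cokernel x y w (f : mor x y) (p : mor y w) : p ∘ f = 0 -> epimor p ->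
  (forall v (g : mor y v), g ∘ f = 0 -> exists h : mor w v, h ∘ p = g) -> is_cokernel f p.
Proof. exact: (@mk_kernel _ (opCat C)). Qed.

Lemma cokernel_desc x y w (f : mor x y) (p : mor y w) : is_cokernel f p ->
  forall v (g : mor y v), g ∘ f = 0 -> {h : mor w v | h ∘ p = g}.
Proof. exact: (@kernel_lift _ (opCat C)). Qed.

Lemma cokernel_comp_epi x y z w (e : mor z x) (f : mor x y) (p : mor y w) :
  epimor e -> is_cokernel f p -> is_cokernel (f ∘ e) p.
Proof. exact: (@kernel_comp_mono _ (opCat C)). Qed.

Lemma cokernel_of_comp_epi x y z w (e : mor z x) (f : mor x y) (p : mor y w) :
  epimor e -> is_cokernel (f ∘ e) p -> is_cokernel f p.
Proof. exact: (@kernel_of_comp_mono _ (opCat C)). Qed.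

Lemma cokernel_unique x y w w' (f : mor x y) (p : mor y w) (p' : mor y w') :
  is_cokernel f p -> is_cokernel f p' -> {s : isomor w w' | s ∘ p = p'}.
Proof.
move=> kp kp'; have [s es] := @kernel_unique _ (opCat C) _ _ _ _ _ _ _ kp' kp.
by exists (unop_iso s).
Qed.

Lemma cokernel_transport x y x' y' w w' (f : mor y x) (f' : mor y' x') (p : mor x w)
    (p' : mor x' w') (s : isomor x x') (t : isomor y y') :
  is_cokernel f p -> is_cokernel f' p' -> f' ∘ t = s ∘ f ->
  {r : isomor w w' | r ∘ p = p' ∘ s}.
Proof.
move=> kp kp' e.
have [r er] := @kernel_transport _ (opCat C) _ _ _ _ _ _ f' f p' p (op_iso s) (op_iso t)
  kp' kp (esym e).
by exists (unop_iso r).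
Qed.

Lemma cokernel_iso_mid x y x' w (f : mor y x) (p : mor x w) (s : isomor x x') :
  is_cokernel f p -> is_cokernel (s ∘ f) (p ∘ bwd s).
Proof.
exact: (@kernel_iso_mid _ (opCat C) _ _ _ _ f p (op_iso s)).
Qed.

Lemma cokernel_iso_tgt x y w w' (f : mor x y) (p : mor y w) (s : isomor w w') :
  is_cokernel f p -> is_cokernel f (s ∘ p).
Proof.
exact: (@kernel_iso_src _ (opCat C) _ _ _ _ f p (op_iso s)).
Qed.

Lemma zero_src_mono x y (f : mor x y) : is_zero x -> monomor f.
Proof. by move=> z; apply: mono_of0 => w g _; have [h _] := z w; exact: h. Qed.

End AdditiveDual.

Section AbelianLemmas.
Variables (k : fieldType) (C : linCat k).

Lemma op_abelian : abelian_cat C -> abelian_cat (opCat C).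
Proof.
case=> [[z hz] hb hk hc mn en]; split=> //.
- by exists z => x; have [h1 h2] := hz x.
- move=> x y; have [s [i [j [p [q [e1 e2 e3 e4 e5]]]]]] := hb x y.
  by exists s, p, q, i, j; split.
- by move=> x y f; exact: (hc y x f).
- by move=> x y f; exact: (hk y x f).
- by move=> x y f; exact: (en y x f).
- by move=> x y f; exact: (mn y x f).
Qed.

Hypothesis abC : abelian_cat C.
Implicit Types x y z w s t : C.

Lemma mono_kernel_coker x y z (i : mor x y) (p : mor y z) :
  monomor i -> is_cokernel i p -> is_kernel p i.
Proof.
move=> mi [pi hp]; have [w [f [fi kf]]] := monos_normal abC mi.
apply: mk_kernel => // v g pg; have [l [el _]] := hp _ f fi.
by have [|h [? _]] := kf _ g; [rewrite -el -comp_assoc pg comp_0r | exists h].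
Qed.

Lemma mono_short_exact x y (i : mor x y) : monomor i ->
  exists z (p : mor y z), short_exact i p.
Proof.
move=> mi; have [z [p cp]] := has_cokernels abC i; exists z, p.
by split=> //; exact: mono_kernel_coker.
Qed.

Lemma mono_epi_iso x y (f : mor x y) : monomor f -> epimor f -> is_iso f.
Proof.
move=> mf ef; have [z [g [gf kg]]] := monos_normal abC mf.
have g0 : g = 0 by apply: (epir0 ef).
have [|s [es _]] := kg _ (idmor y); first by rewrite g0 comp_0l.
by exists s; split=> //; apply: mf; rewrite comp_assoc es comp_id_l comp_id_r.
Qed.

(** Take for [m] the kernel of the cokernel of [f]. If [h ∘ e = 0], then [f] factors through the
    monomorphism [m ∘ j] with [j] the kernel of [h]. This monomorphism is the kernel of some [d]. As
    [d] kills [f], it factors through the cokernel of [f] and kills [m], so [j] has a right inverse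
    and [h = 0]. *)
Lemma image_fact x y (f : mor x y) :
  exists w (m : mor w y) (e : mor x w), [/\ m ∘ e = f, monomor m & epimor e].
Proof.
have [z [c [cf hc]]] := has_cokernels abC f.
have [w [m km]] := has_kernels abC c; have [e ee] := kernel_lift km cf.
exists w, m, e; split=> //; first exact: kernel_mono km.
apply: epi_of0 => v h he; have [u [j kj]] := has_kernels abC h.
have [e' ee'] := kernel_lift kj he.
have mmj : monomor (m ∘ j) by apply: mono_comp; [exact: kernel_mono km | exact: kernel_mono kj].
have [t [d [dm kd]]] := monos_normal abC mmj.
have df : d ∘ f = 0 by rewrite -ee -ee' (comp_assoc m) (comp_assoc d) dm comp_0l.
have [d' [ed' _]] := hc _ d df.
have [|l [el _]] := kd _ m; first by rewrite -ed' -comp_assoc (proj1 km) comp_0r.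
have jl : j ∘ l = idmor w.
  by apply: (kernel_mono km); rewrite comp_assoc el comp_id_r.
by rewrite -(comp_id_r h) -jl comp_assoc (proj1 kj) comp_0l.
Qed.

End AbelianLemmas.

Section AbelianDual.
Variables (k : fieldType) (C : linCat k).
Hypothesis abC : abelian_cat C.
Implicit Types x y z w s t : C.

Lemma epi_cokernel_ker x y z (i : mor x y) (p : mor y z) :
  epimor p -> is_kernel p i -> is_cokernel i p.
Proof. exact: (@mono_kernel_coker _ _ (op_abelian abC)). Qed.

Lemma epi_short_exact y z (p : mor y z) : epimor p ->
  exists x (i : mor x y), short_exact i p.
Proof.
move=> ep; have [x [i ki]] := has_kernels abC p; exists x, i.
by split=> //; exact: epi_cokernel_ker.
Qed.

(** The pullback is the kernel [l] of [d = e ∘ p - g ∘ q] on the biproduct. Since [d] restricts to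
    [e] on [x], it is epi, hence the cokernel of [l]. A map [h] killing [b] therefore gives [h ∘ q]
    that factors through [d], by a map that kills [e] and so vanishes. *)
Lemma pullback_epi x y z (e : mor x z) (g : mor y z) : epimor e ->
  exists w (a : mor w x) (b : mor w y), e ∘ a = g ∘ b /\ epimor b.
Proof.
move=> ee; have [s [i [j [p [q [pi qj pj qi dec]]]]]] := has_biproducts abC x y.
pose d := e ∘ p - g ∘ q.
have di : d ∘ i = e by rewrite compBl -!comp_assoc pi qi comp_0r subr0 comp_id_r.
have ed : epimor d by apply: (@epi_cancel _ _ _ _ _ _ i); rewrite di.
have [w [l kl]] := has_kernels abC d.
have cl := epi_cokernel_ker ed kl.
exists w, (p ∘ l), (q ∘ l); split.
  by apply/subr0_eq; rewrite !comp_assoc -compBl (proj1 kl).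
apply: epi_of0 => v h; rewrite comp_assoc => hl.
have [h' eh'] := cokernel_desc cl hl.
have h0 : h' = 0.
  by apply: (epir0 ee); rewrite -di comp_assoc eh' -comp_assoc qi comp_0r.
by rewrite -(comp_id_r h) -qj comp_assoc -eh' h0 comp_0l comp_0l.
Qed.

Lemma simple_epi x s (f : mor x s) : simple_ob s -> f <> 0 -> epimor f.
Proof.
move=> [_ hs] f0; have [w [m [e [em mm ee]]]] := image_fact abC f.
case: (hs _ m mm) => [zw|im].
  by case: f0; rewrite -em; have [h _] := zw x; rewrite (h e) comp_0r.
by rewrite -em; apply: epi_comp => //; exact: iso_is_epi.
Qed.

Lemma simple_mono s y (f : mor s y) : simple_ob s -> f <> 0 -> monomor f.
Proof.
move=> [_ hs] f0; have [w [i ki]] := has_kernels abC f.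
case: (hs _ i (kernel_mono ki)) => [zw|[j [ij ji]]].
  apply: mono_of0 => v g fg; have [h <-] := kernel_lift ki fg.
  by have [hz _] := zw v; rewrite (hz h) comp_0r.
by case: f0; rewrite -(comp_id_r f) -ji comp_assoc (proj1 ki) comp_0l.
Qed.

Lemma simple_iso s t (f : mor s t) : simple_ob s -> simple_ob t -> f <> 0 -> is_iso f.
Proof. by move=> hs ht f0; apply: mono_epi_iso; [|exact: simple_mono|exact: simple_epi]. Qed.

Lemma iso_simple s t : isomorphic s t -> simple_ob s -> simple_ob t.
Proof.
move=> [f [g [gf fg]]] [nz hs]; split=> [zt|y i mi].
  apply: nz; apply/zero_id; rewrite -gf -(comp_id_l f).
  by have -> : idmor t = 0 by [apply/zero_id]; rewrite comp_0l comp_0r.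
have mg : monomor g by apply: split_mono fg.
case: (hs _ (g ∘ i) (mono_comp mg mi)) => [|[h [h1 h2]]]; [by left|right].
exists (h ∘ g); split; first by rewrite -comp_assoc.
by apply: mg; rewrite !comp_assoc h2 comp_id_l comp_id_r.
Qed.

End AbelianDual.

(** * Finite-dimensional hom-spaces and polynomials in an endomorphism *)

Section Spanned.
Variable k : fieldType.

(** The number [n] only bounds the dimension. Bounds that strictly decrease are all that the
    inductions below require. *)
Definition spanned (V : lmodType k) n := exists b : 'I_n -> V,
  forall v, exists a : 'I_n -> k, v = \sum_i a i *: b i.

Definition lin_map (U V : lmodType k) (g : U -> V) :=
  forall (a : k) u v, g (a *: u + v) = a *: g u + g v.

Section LinMap.
Variables (U V : lmodType k) (g : U -> V).
Hypothesis lg : lin_map g.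

Lemma lin_map0 : g 0 = 0. Proof. exact: lin_zero lg. Qed.

Lemma lin_mapZ a u : g (a *: u) = a *: g u.
Proof. by have := lg a u 0; rewrite lin_map0 !addr0. Qed.

Lemma lin_mapD u v : g (u + v) = g u + g v.
Proof. by have := lg 1 u v; rewrite !scale1r. Qed.

Lemma lin_mapB u v : g (u - v) = g u - g v.
Proof. by rewrite -scaleN1r addrC lg scaleN1r addrC. Qed.

Lemma lin_map_sum (I : Type) (r : seq I) (P : pred I) (F : I -> U) :
  g (\sum_(i <- r | P i) F i) = \sum_(i <- r | P i) g (F i).
Proof. by elim/big_rec2: _ => [|i a b _ <-]; rewrite ?lin_map0 ?lin_mapD. Qed.

End LinMap.

Section Submodule.
Variables (U V : lmodType k) (g : U -> V) (n : nat) (b : 'I_n -> V).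
Hypotheses (lg : lin_map g) (ig : injective g).
Hypothesis hb : forall v, exists a : 'I_n -> k, v = \sum_i a i *: b i.

Let comb (a : 'rV[k]_n) := \sum_i a 0 i *: b i.
Let sub_im (A : 'M[k]_n) := forall a : 'rV_n, (a <= A)%MS -> exists u, g u = comb a.

Let combD c a a' : comb (c *: a + a') = c *: comb a + comb a'.
Proof.
rewrite /comb scaler_sumr -big_split; apply: eq_bigr => i _ /=.
by rewrite !mxE scalerDl scalerA.
Qed.

(** The vectors [b] need only span, so a vector of [V] may have many coordinate rows. Among the
    matrices whose row space consists of coordinates of images under [g], one of maximal rank
    contains all such coordinates, because adjoining one more row keeps the property. *)
Let max_coords : exists2 A, sub_im A & forall a u, g u = comb a -> (a <= A)%MS.
Proof.
pose P r := `[< exists2 A : 'M[k]_n, sub_im A & \rank A = r >].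
have P0 : exists r, P r.
  exists 0; apply/asboolP; exists 0; last exact: mxrank0.
  move=> a; rewrite submx0 => /eqP ->; exists 0; rewrite (lin_map0 lg) /comb.
  by rewrite big1 // => i _; rewrite mxE scale0r.
have Pb r : P r -> (r <= n)%N by move/asboolP => [A _ <-]; exact: rank_leq_row.
case: (ex_maxnP P0 Pb) => r /asboolP [A sA rA] mx; exists A => // a u gu.
have sAa : sub_im (A + a)%MS.
  move=> c /sub_addsmxP[[d e] ->]; rewrite /= (mx11_scalar e) mul_scalar_mx addrC.
  have [u1 e1] := sA _ (submxMl d A); exists (e 0 0 *: u + u1).
  by rewrite lg combD gu e1.
have := mx _ (asboolT (ex_intro2 _ _ _ sAa erefl)); rewrite -rA => h.
have e : (A == A + a)%MS by rewrite -(geq_leqif (mxrank_leqif_eq (addsmxSl A a))).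
by apply: submx_trans (addsmxSr A a) _; case/andP: e.
Qed.

(** Here [m] is the rank of the maximal matrix, whose row base lifts to spanning vectors of [U].
    Full rank would put every vector of [V] in the image of [g]. *)
Lemma spanned_sub_basis : exists2 m, (m <= n)%N &
  spanned U m /\ ((exists v, forall u, g u <> v) -> (m < n)%N).
Proof.
have [A sA mA] := max_coords; exists (\rank A); first exact: rank_leq_row.
split.
  have rowP i : exists u, g u = comb (row i (row_base A)).
    by apply: sA; rewrite -(eq_row_base A) row_sub.
  have [f ef] := choice rowP; exists f => u; have [c ec] := hb (g u).
  have gu : g u = comb (\row_i c i).
    by rewrite ec; apply: eq_bigr => i _; rewrite mxE.
  have := mA _ _ gu; rewrite -(eq_row_base A) => /submxP[D eD].
  exists (fun i => D 0 i); apply: ig; rewrite (lin_map_sum lg) gu eD.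
  rewrite mulmx_sum_row; transitivity (\sum_i comb (D 0 i *: row i (row_base A))).
    elim/big_rec2: _ => [|i v a _ <-].
      by rewrite /comb big1 // => i _; rewrite mxE scale0r.
    by rewrite -[D 0 i *: _ in RHS]scale1r -[_ *: row _ _ in LHS]scale1r combD !scale1r.
  apply: eq_bigr => i _; rewrite (lin_mapZ lg) ef.
  by rewrite /comb scaler_sumr; apply: eq_bigr => j _; rewrite !mxE scalerA.
case=> v hv; rewrite ltn_neqAle rank_leq_row andbT; apply/negP => fullA.
have [c ec] := hb v; have [|u gu] := sA (\row_i c i).
  exact: submx_full.
by apply: (hv u); rewrite gu ec; apply: eq_bigr => i _; rewrite mxE.
Qed.

End Submodule.

Lemma spanned_sub (U V : lmodType k) (g : U -> V) n : lin_map g -> injective g ->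
  spanned V n -> exists2 m, (m <= n)%N & spanned U m.
Proof. by move=> lg ig [b hb]; have [m le [h _]] := spanned_sub_basis lg ig hb; exists m. Qed.

Lemma spanned_sub_lt (U V : lmodType k) (g : U -> V) n : lin_map g -> injective g ->
  spanned V n -> (exists v, forall u, g u <> v) -> exists2 m, (m < n)%N & spanned U m.
Proof. by move=> lg ig [b hb] hv; have [m le [h /(_ hv) l]] := spanned_sub_basis lg ig hb; exists m. Qed.

Lemma spanned_quot_lt (U V : lmodType k) (g : U -> V) n : lin_map g ->
  (forall v, exists u, g u = v) -> spanned U n -> (exists2 u, u <> 0 & g u = 0) ->
  exists2 m, (m < n)%N & spanned V m.
Proof.
move=> lg sg [b hb] [u u0 gu]; have [a ea] := hb u.
have [j aj] : exists j, a j != 0.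
  apply: contrapT => h; apply: u0; rewrite ea big1 // => i _.
  case: (eqVneq (a i) 0) => [->|ai]; first by rewrite scale0r.
  by case: h; exists i.
case: n b hb a ea j aj => [|n] b hb a ea j aj; first by case: j aj.
exists n => //; exists (fun i => g (b (lift j i))) => v; have [w <-] := sg v.
have [c ec] := hb w; pose t := c j / a j.
have -> : g w = g (w - t *: u) by rewrite (lin_mapB lg) (lin_mapZ lg) gu scaler0 subr0.
exists (fun i => c (lift j i) - t * a (lift j i)).
rewrite ec ea scaler_sumr -sumrB (bigD1_ord j) //= scalerA -scalerBl divfK // subrr scale0r add0r.
rewrite (lin_map_sum lg); apply: eq_bigr => i _.
by rewrite scalerA -scalerBl (lin_mapZ lg).
Qed.

Lemma spanned_prod (U V : lmodType k) m n : spanned U m -> spanned V n ->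
  spanned (U * V)%type (m + n).
Proof.
move=> [b hb] [c hc].
exists (fun i => match split i with inl i => (b i, 0) | inr j => (0, c j) end) => -[u v].
have [s es] := hb u; have [t et] := hc v.
exists (fun i => match split i with inl i => s i | inr j => t j end).
rewrite big_split_ord /=.
under eq_bigr => i _ do rewrite (unsplitK (inl i)).
under [X in _ = _ + X]eq_bigr => i _ do rewrite (unsplitK (inr i)).
have L (f : 'I_m -> k) : \sum_i f i *: ((b i, 0) : (U * V)%type) = (\sum_i f i *: b i, 0).
  elim/big_rec2: _ => [//|i x y _ ->]; congr (_, _); exact: (etrans (congr1 (+%R^~ 0) (scaler0 _ _)) (addr0 _)).
have R (f : 'I_n -> k) : \sum_i f i *: ((0, c i) : (U * V)%type) = (0, \sum_i f i *: c i).
  elim/big_rec2: _ => [//|i x y _ ->]; congr (_, _); exact: (etrans (congr1 (+%R^~ 0) (scaler0 _ _)) (addr0 _)).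
by rewrite L R -es -et; congr (_, _); rewrite /= ?addr0 ?add0r.
Qed.

End Spanned.

(** * Polynomials in an endomorphism *)

Section PolyCalculus.
Variables (k : fieldType) (C : linCat k) (x : C) (phi : mor x x).
Local Notation "1x" := (idmor x).

Fixpoint iter_mor n : mor x x := if n is n'.+1 then phi ∘ iter_mor n' else 1x.

Definition evp (p : {poly k}) : mor x x := \sum_(i < size p) p`_i *: iter_mor i.

Lemma evp_wide (p : {poly k}) n : (size p <= n)%N -> evp p = \sum_(i < n) p`_i *: iter_mor i.
Proof.
move=> le; rewrite /evp (big_ord_widen n (fun i => p`_i *: iter_mor i)) //.
rewrite big_mkcond; apply: eq_bigr => i _; case: ltnP => // h.
by rewrite nth_default // scale0r.
Qed.

Lemma evp_lin (a : k) (p q : {poly k}) : evp (a *: p + q) = a *: evp p + evp q.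
Proof.
pose n := maxn (size (a *: p + q)) (maxn (size p) (size q)).
rewrite (@evp_wide (_ + _) n) ?leq_maxl // (@evp_wide p n) ?(@evp_wide q n); first last.
- by rewrite /n !leq_max leqnn !orbT.
- by rewrite /n !leq_max leqnn !orbT.
rewrite scaler_sumr -big_split; apply: eq_bigr => i _ /=.
by rewrite coefD coefZ scalerDl scalerA.
Qed.

Lemma evpC c : evp c%:P = c *: 1x.
Proof.
by rewrite (@evp_wide _ 1) ?size_polyC_leq1 // big_ord1 coefC.
Qed.

Lemma evpMX (p : {poly k}) : evp (p * 'X) = phi ∘ evp p.
Proof.
rewrite (@evp_wide _ (size p).+1) ?size_polyMX_leq //; last first.
  by case: (eqVneq p 0) => [->|p0]; rewrite ?mul0r ?size_poly0 // size_mulX.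
rewrite big_ord_recl coefMX /= scale0r add0r comp_sumr.
by apply: eq_bigr => i _; rewrite coefMX /= compZr.
Qed.

Lemma evpMXaddC (p : {poly k}) c : evp (p * 'X + c%:P) = phi ∘ evp p + c *: 1x.
Proof. by rewrite -[p * 'X]scale1r evp_lin scale1r evpMX evpC. Qed.

Lemma evpM (p q : {poly k}) : evp (p * q) = evp p ∘ evp q.
Proof.
elim/poly_ind: p => [|p c IH].
  by rewrite mul0r -[0]/(0%:P) evpC scale0r comp_0l.
rewrite mulrDl -mulrA ['X * _]mulrC mulrA -[p * q * 'X]scale1r evp_lin scale1r.
rewrite evpMX IH evpMXaddC compDl comp_assoc.
by rewrite mul_polyC -[c *: q]addr0 evp_lin -[0]/(0%:P) evpC scale0r addr0 compZl comp_id_l.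
Qed.

Lemma comp_evp y (f : mor x y) c p : f ∘ phi = c *: f -> f ∘ evp p = p.[c] *: f.
Proof.
move=> e; elim/poly_ind: p => [|p a IH].
  by rewrite -[0]/(0%:P) evpC hornerC scale0r comp_0r scale0r.
rewrite evpMXaddC compDr comp_assoc e compZl IH.
by rewrite compZr comp_id_r hornerMXaddC scalerDl scalerA mulrC.
Qed.

(** Coordinates of the first [n.+1] iterates of [phi] form a matrix with more rows than columns. A
    nonzero vector of its left kernel gives the coefficients. *)
Lemma evp_annihilator n : spanned (mor x x) n -> exists2 p, p != 0 & evp p = 0.
Proof.
move=> [b hb]; have [c ec] := choice (fun i : 'I_n.+1 => hb (iter_mor i)).
pose A : 'M[k]_(n.+1, n) := \matrix_(i, j) c i j.
have /rowV0Pn[a /sub_kermxP aA a0] : kermx A != 0.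
  rewrite -mxrank_eq0 mxrank_ker subn_eq0 -ltnNge ltnS; exact: rank_leq_col.
exists (\poly_(i < n.+1) a 0 (inord i)).
  apply: contra a0 => /eqP p0; apply/eqP/rowP => i; rewrite mxE.
  by have := congr1 (fun p : {poly k} => p`_i) p0; rewrite coef_poly ltn_ord inord_val coef0.
rewrite (@evp_wide _ n.+1) ?size_poly //.
under eq_bigr => i _ do rewrite coef_poly ltn_ord inord_val (ec i) scaler_sumr.
rewrite exchange_big /= big1 // => j _.
under eq_bigr => i _ do rewrite scalerA.
rewrite -scaler_suml; have := congr1 (fun M : 'rV_n => M 0 j) aA; rewrite !mxE => e.
have -> : \sum_i a 0 i * c i j = 0 by rewrite -[RHS]e; apply: eq_bigr => i _; rewrite mxE.
by rewrite scale0r.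
Qed.

(* Fitting's lemma: if [X^a g] kills [phi], with [g] prime to [X], and
   [u X^a + v g = 1], then [u X^a] is idempotent at [phi]. *)
Lemma fitting_idempotent n : spanned (mor x x) n -> exists e : mor x x,
  [/\ e ∘ e = e, forall y (f : mor x y), f ∘ phi = 0 -> f ∘ e = 0
    & forall y (f : mor x y), f ∘ phi = f -> f ∘ e = f].
Proof.
(* The extra factor makes 0 and 1 roots of [q]. The root 0 gives [0 < a], so that the idempotent
   polynomial [h] vanishes at 0. The root 1 gives [g.[1] = 0], so that [h] takes the value 1 at 1.
   These two values yield the last two claims, by [comp_evp]. *)
move=> /evp_annihilator[q0 q0n0 eq0]; pose q := q0 * ('X * ('X - 1%:P)).
have qn0 : q != 0 by rewrite !mulf_neq0 // ?polyX_eq0 // polyXsubC_eq0.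
have eq : evp q = 0 by rewrite /q evpM eq0 comp_0l.
have [a [g]] := multiplicity_XsubC q 0; rewrite qn0 /= subr0 => g0 qE.
have a0 : (0 < a)%N.
  rewrite lt0n; apply: contra g0 => /eqP a0; have := congr1 (horner^~ 0) qE.
  by rewrite a0 expr0 mulr1 /root => <-; rewrite /q !hornerE /= ?(mul0r, mulr0).
have /Bezout_coprimepP[[u v] /= uv] : coprimep ('X^a) g.
  by rewrite coprimep_expl // coprimep_sym -['X]subr0 coprimep_XsubC.
have [c c0 ec] : exists2 c, c != 0 & u * 'X^a + v * g = c%:P.
  by move: uv; rewrite -size_poly_eq1 => /size_poly1P[c c0 ->]; exists c.
pose h := c^-1 *: (u * 'X^a).
have hE : 1 - h = c^-1 *: (v * g).
  have -> : 1 = c^-1 *: (c%:P : {poly k}).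
    by rewrite -mul_polyC -polyCM mulVf.
  by rewrite -ec scalerDr /h addrC addKr.
have h0 : h.[0] = 0.
  by rewrite /h !hornerE expr0n -[a == 0%N]negbK -lt0n a0 /= !mulr0.
have g1 : g.[1] = 0.
  have := congr1 (horner^~ 1) qE.
  by rewrite /q !hornerE /= ?expr1n ?subrr ?mul0r ?mulr0 ?mulr1 => <-.
have h1 : h.[1] = 1.
  have : (1 - h).[1] = 0 by rewrite hE !hornerE g1; exact: mulr0.
  by rewrite hornerD hornerN hornerC => /subr0_eq <-.
clearbody q; exists (evp h); split.
- rewrite -evpM; apply/esym/subr0_eq.
  have -> : evp h - evp (h * h) = evp (h * (1 - h)).
    by rewrite mulrBr mulr1 addrC -scaleN1r -evp_lin scaleN1r addrC.
  rewrite hE /h -scalerAl -scalerAr mulrACA ['X^a * g]mulrC -qE -!mul_polyC !mulrA.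
  by rewrite evpM eq comp_0r.
- by move=> y f e; rewrite (@comp_evp _ f 0) ?h0 ?scale0r // e.
- by move=> y f e; rewrite (@comp_evp _ f 1) ?h1 ?scale1r // e.
Qed.

End PolyCalculus.

(** * Schur's lemma over an algebraically closed field *)

Section Schur.
Variables (k : closedFieldType) (C : linCat k).
Hypothesis abC : abelian_cat C.

(** Let [c] be a root of a polynomial annihilating [f]. Either [f] is multiplication by [c], or
    [f - c *: idmor s] is mono and the factor ['X - c%:P] can be cancelled, which lowers the
    degree. *)
Lemma schur s n (f : mor s s) : simple_ob (s : C) -> spanned (mor s s) n ->
  exists c : k, f = c *: idmor s.
Proof.
move=> ss /(evp_annihilator f)[q q0 eq].
have [m] := ubnP (size q); elim: m q q0 eq => // m IH q q0 eq sq.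
have [sq1|sq1] := leqP (size q) 1.
  have /size_poly1P[c c0 qc] : size q == 1 by rewrite eqn_leq sq1 lt0n size_poly_eq0.
  case: ss => nz _; case: nz; apply/zero_id.
  move: eq; rewrite qc evpC => /(congr1 (fun t => c^-1 *: t)).
  by rewrite scalerA mulVf // scale1r scaler0.
have /closed_rootP[c /factor_theorem[r rE]] : size q != 1 by rewrite neq_ltn sq1 orbT.
have [/eqP|fc] := eqVneq (f - c *: idmor s) 0.
  by rewrite subr_eq0 => /eqP ->; exists c.
have r0 : r != 0 by apply: contra q0 => /eqP r0; rewrite rE r0 mul0r.
apply: (IH r r0); last first.
  by move: sq; rewrite rE size_Mmonic ?monicXsubC // size_XsubC addn2 /= ltnS.
move: eq; rewrite rE mulrC evpM.
have -> : evp f ('X - c%:P) = f - c *: idmor s.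
  by rewrite -['X]mul1r -polyCN evpMXaddC -[1]/(1%:P) evpC scale1r comp_id_r scaleNr.
apply: monor0; apply: (simple_mono abC) => //; exact/eqP.
Qed.

End Schur.

(** * Finite categories: generators and projective covers *)

Section AbelianConstructions.
Variables (k : fieldType) (C : linCat k).
Hypothesis abC : abelian_cat C.
Implicit Types x y z w s t p q : C.

Lemma proj_lift p x y (e : mor x y) (f : mor p y) :
  projective_ob p -> epimor e -> {g : mor p x | e ∘ g = f}.
Proof. by move=> pp ee; apply: cid; exact: pp. Qed.

Lemma proj_split x p (e : mor x p) : projective_ob p -> epimor e ->
  {s : mor p x | e ∘ s = idmor p}.
Proof. by move=> pp ee; exact: proj_lift. Qed.

Lemma proj_retract p q (i : mor q p) (r : mor p q) :
  r ∘ i = idmor q -> projective_ob p -> projective_ob q.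
Proof.
move=> ri pp x y e f ee; have [g eg] := proj_lift (f ∘ r) pp ee.
by exists (g ∘ i); rewrite comp_assoc eg -comp_assoc ri comp_id_r.
Qed.

Lemma proj_zero z : is_zero z -> projective_ob z.
Proof.
move=> hz x y e f _; exists 0; rewrite comp_0r.
by have [_ h] := hz y; rewrite (h f).
Qed.

Lemma proj_biproduct x y s : is_biproduct x y s ->
  projective_ob x -> projective_ob y -> projective_ob s.
Proof.
move=> [i [j [p [q [pi qj pj qi dec]]]]] px py u v e f ee.
have [g eg] := proj_lift (f ∘ i) px ee; have [h eh] := proj_lift (f ∘ j) py ee.
exists (g ∘ p + h ∘ q).
by rewrite compDr !comp_assoc eg eh -!comp_assoc -compDr dec comp_id_r.
Qed.

Lemma split_idempotent x (e : mor x x) : e ∘ e = e ->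
  exists w (i : mor w x) (r : mor x w), i ∘ r = e /\ r ∘ i = idmor w.
Proof.
move=> ee; have [w [i ki]] := has_kernels abC (idmor x - e).
have [|r er] := kernel_lift ki (g := e); first by rewrite compBl comp_id_l ee subrr.
have ei : e ∘ i = i.
  by have := proj1 ki; rewrite compBl comp_id_l => /subr0_eq.
exists w, i, r; split=> //; apply: (kernel_mono ki).
by rewrite comp_assoc er ei comp_id_r.
Qed.

(** A finite direct sum, remembered only through its retractions. The predicate [G] carries along a
    property, such as projectivity, that the sum is to inherit. *)
Lemma sum_retracts (G : C -> Prop) n (s : 'I_n -> C) :
  (forall z, is_zero z -> G z) ->
  (forall x y t, is_biproduct x y t -> G x -> G y -> G t) -> (forall i, G (s i)) ->
  exists2 t, G t & forall i, exists (f : mor (s i) t) (r : mor t (s i)), r ∘ f = idmor (s i).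
Proof.
move=> G0 GD Gs.
suff H m : (m <= n)%N -> exists2 t, G t & forall i : 'I_n, (i < m)%N ->
    exists (f : mor (s i) t) (r : mor t (s i)), r ∘ f = idmor (s i).
  by have [t Gt ht] := H n (leqnn n); exists t => // i; apply: ht.
elim: m => [_|m IH lt_mn]; first by have [z hz] := has_zero abC; exists z => //; exact: G0.
have [t Gt ht] := IH (ltnW lt_mn); pose j := Ordinal lt_mn.
have [u bu] := has_biproducts abC t (s j); exists u; first exact: GD bu _ _.
have [a [b [p [q [pa qb _ _ _]]]]] := bu.
move=> i; rewrite ltnS leq_eqVlt => /predU1P[eij|/ht[f [r rf]]]; last first.
  by exists (a ∘ f), (r ∘ p); rewrite -comp_assoc (comp_pre pa) comp_id_l.
by have -> : i = j by [apply: val_inj]; exists b, q.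
Qed.

Lemma simple_nonzero s x (f : mor x s) : simple_ob s -> epimor f -> f <> 0.
Proof.
move=> [nz _] ef f0; apply: nz; apply/zero_id; apply: ef.
by rewrite comp_0l f0 comp_0r.
Qed.

Lemma short_exact_iso x y z (i : mor x y) (p : mor y z) y' (s : isomor y y') :
  short_exact i p -> short_exact (s ∘ i) (p ∘ bwd s).
Proof.
case=> ki cp; split; last exact: cokernel_iso_mid.
exact: (kernel_iso_mid (iso_inv s) ki).
Qed.

Lemma finite_length_iso x y : isomor x y -> finite_length x -> finite_length y.
Proof.
move=> s fx; case: x / fx s => [x zx s|x' x t i p ex fx st s].
  apply: finite_length_zero; apply/zero_id.
  by rewrite -(bwdK s) -(comp_id_r (fwd s)) (proj1 (zero_id x) zx) comp_0r comp_0l.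
exact: finite_length_ext (short_exact_iso s ex) fx st.
Qed.

Lemma finite_length_simple s : simple_ob s -> finite_length s.
Proof.
move=> ss; have [z hz] := has_zero abC.
apply: (@finite_length_ext _ _ z s s 0 (idmor s)) => //; last exact: finite_length_zero.
split; first apply: mk_kernel.
- exact: comp_0r.
- exact: zero_src_mono.
- by move=> v g; rewrite comp_id_l => ->; exists 0; rewrite comp_0r.
apply: mk_cokernel; first exact: comp_0r; first exact: id_epi.
by move=> v g _; exists g; rewrite comp_id_r.
Qed.

(** Induction on a composition series of the quotient [z]: the preimage [y0] in [y] of the subobject
    [z0] of [z] is an extension of [z0] by [x], and [y] is an extension of the simple [s] by
    [y0]. *)
Lemma finite_length_exact x y z (i : mor x y) (p : mor y z) :
  short_exact i p -> finite_length x -> finite_length z -> finite_length y.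
Proof.
move=> ex fx fz; elim: z / fz y p i ex => [z zz|z0 z s j q exz _ IH ss] y p i ex.
  have ii : is_iso i.
    apply: mono_epi_iso => //; first exact: kernel_mono (proj1 ex).
    apply: epi_of0 => w g gi; have [h <-] := cokernel_desc (proj2 ex) gi.
    by have [_ h0] := zz w; rewrite (h0 h) comp_0l.
  by have [t _] := isomor_of ii; exact: finite_length_iso t fx.
have [kj cq] := exz; have [ki cp] := ex.
have eqp := epi_comp (cokernel_epi cq) (cokernel_epi cp).
have [y0 [l kl]] := has_kernels abC (q ∘ p).
have [|p0 ep0] := kernel_lift kj (g := p ∘ l); first by rewrite comp_assoc (proj1 kl).
have [|i0 ei0] := kernel_lift kl (g := i); first by rewrite -comp_assoc (proj1 ki) comp_0r.
apply: (finite_length_ext (i := l) (p := q ∘ p)) => //.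
  by split=> //; exact: epi_cokernel_ker.
have kp0 : is_kernel p0 i0.
  apply: mk_kernel.
  - by apply: (kernel_mono kj); rewrite comp_assoc ep0 -comp_assoc ei0 (proj1 ki) comp_0r.
  - by apply: (@mono_cancel _ _ _ _ _ l); rewrite ei0; exact: kernel_mono ki.
  - move=> v g g0; have [|h eh] := kernel_lift ki (g := l ∘ g).
      by rewrite comp_assoc -ep0 -comp_assoc g0 comp_0r.
    by exists h; apply: (kernel_mono kl); rewrite comp_assoc ei0.
apply: (IH y0 p0 i0); split=> //; apply: epi_cokernel_ker => //.
(* To see that [p0] is epi, pull [p] back along [j]: the resulting epimorphism onto [z0] factors
   through [p0]. *)
have [w [a [b [eab eb]]]] := pullback_epi abC j (cokernel_epi cp).
have [|c ec] := kernel_lift kl (g := a).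
  by rewrite -comp_assoc eab comp_assoc (proj1 kj) comp_0l.
apply: (@epi_cancel _ _ _ _ _ _ c); have -> // : p0 ∘ c = b.
by apply: (kernel_mono kj); rewrite comp_assoc ep0 -comp_assoc ec.
Qed.

(** A map to a simple object either is nonzero on [x], or factors through the simple quotient [s]
    and identifies it with the target. Applied to a functor that maps nontrivially to every simple
    functor, this bounds the simple objects of the functor category. *)
Lemma simple_quotients y : finite_length y -> exists (n : nat) (s : 'I_n -> C),
  forall t (f : mor y t), simple_ob t -> f <> 0 -> exists i, isomorphic t (s i).
Proof.
elim: y / => [x zx|x y s i p ex _ [n [u hu]] ss].
  exists 0, (fun _ => x) => t f _ f0; case: f0.
  by have [_ h] := zx t; exact: h.
exists n.+1, (fun j => if unlift ord0 j is Some l then u l else s) => t f st f0.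
case: (pselect (f ∘ i = 0)) => [fi|fi]; last first.
  by have [j hj] := hu t _ st fi; exists (lift ord0 j); rewrite liftK.
exists ord0; rewrite unlift_none.
have [h eh] := cokernel_desc (proj2 ex) fi.
have h0 : h <> 0 by move=> h0; apply: f0; rewrite -eh h0 comp_0l.
by have [g [hg gh]] := simple_iso abC ss st h0; exists g, h.
Qed.

End AbelianConstructions.

Section FiniteCategory.
Variables (k : fieldType) (C : linCat k).
Hypothesis finC : finite_category C.
Let abC := fin_abelian finC.
Implicit Types x y z w s t p q : C.

(** Generation is tested on simple objects alone. [gen_epi] extends it to all objects along
    composition series. *)
Definition proj_gen p := projective_ob p /\
  forall s, simple_ob s -> exists f : mor p s, f <> 0.

Lemma exists_proj_gen : exists p, proj_gen p.
Proof.
have [n [s hs]] := fin_simples finC.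
have [P hP] := choice (fun i => fin_projectives finC (s i)).
have [|||p pp hp] := @sum_retracts _ _ abC (@projective_ob _ _) n P.
- exact: proj_zero.
- exact: proj_biproduct.
- by move=> i; have [e []] := hP i.
exists p; split=> // t st; have [i [f [g [gf fg]]]] := hs t st.
have [e [_ ee]] := hP i; have [a [r ra]] := hp i.
exists (g ∘ e ∘ r); apply: simple_nonzero => //.
by apply: epi_comp; [exact: split_epi gf | apply: epi_comp => //; exact: split_epi ra].
Qed.

Section Generator.
Variable p : C.
Hypothesis gp : proj_gen p.

(** The predicate [G] stands in for being a finite sum of copies of [p]: any property of [p] that
    zero objects have and biproducts inherit holds for some cover of [y]. The cover grows along a
    composition series of [y], adding one copy of [p] for each simple factor. *)
Lemma gen_epi (G : C -> Prop) : G p -> (forall z, is_zero z -> G z) ->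
  (forall x y t, is_biproduct x y t -> G x -> G y -> G t) ->
  forall y, exists2 q, G q & exists e : mor q y, epimor e.
Proof.
move=> Gp G0 GD y; elim: y / (fin_length finC y) => [x zx|x y s i pr ex _ [q Gq [e ee]] ss].
  by exists x; [exact: G0 | exists (idmor x); exact: id_epi].
have [pp /(_ s ss) [f f0]] := gp.
have [g eg] := proj_lift f pp (cokernel_epi (proj2 ex)).
have [t bt] := has_biproducts abC q p; exists t; first exact: GD bt _ _.
have [a [b [c [d [ca db cb da dec]]]]] := bt.
exists (i ∘ e ∘ c + g ∘ d); apply: epi_of0 => w h; rewrite compDr => eh.
have hi : h ∘ i = 0.
  apply: (epir0 ee); have := congr1 (fun l => l ∘ a) eh.
  by rewrite comp_0l compDl -!comp_assoc ca da !comp_0r addr0 comp_id_r.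
have hg : h ∘ g = 0.
  have := congr1 (fun l => l ∘ b) eh.
  by rewrite comp_0l compDl -!comp_assoc cb db !comp_0r add0r comp_id_r.
have [l el] := cokernel_desc (proj2 ex) hi.
rewrite -el (epir0 (simple_epi abC ss f0) (g := l)) ?comp_0l //.
by rewrite -eg comp_assoc el.
Qed.

Lemma gen_faithful x y (f : mor x y) : (forall g : mor p x, f ∘ g = 0) -> f = 0.
Proof.
move=> h; have [|||q hq [e ee]] := gen_epi (G := fun q => forall g : mor q x, f ∘ g = 0) _ _ _ x.
- by [].
- by move=> z zz g; have [_ hz] := zz x; rewrite (hz g) comp_0r.
- move=> a b t [i [j [c [d [_ _ _ _ dec]]]]] ha hb g.
  by rewrite -(comp_id_r g) -dec !compDr !comp_assoc -(comp_assoc f) ha -(comp_assoc f) hb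
    !comp_0l addr0.
by apply: (epir0 ee); exact: hq.
Qed.

(** Together with the next lemma, this makes the dimension of Hom(p, -) a measure that drops
    strictly on proper quotients and proper subobjects. *)
Lemma gen_quot_lt x z (e : mor x z) n : epimor e -> ~ monomor e -> spanned (mor p x) n ->
  exists2 m, (m < n)%N & spanned (mor p z) m.
Proof.
move=> ee nm sp; apply: (@spanned_quot_lt _ _ _ (fun f : mor p x => e ∘ f)) sp _.
- by move=> *; exact: comp_lin_r.
- by move=> v; have [g eg] := proj_lift v (proj1 gp) ee; exists g.
apply: contrapT => h; apply: nm; apply: mono_of0 => w g eg; apply: gen_faithful => l.
apply: contrapT => l0; apply: h; exists (g ∘ l) => //.
by rewrite comp_assoc eg comp_0l.
Qed.

Lemma gen_sub_lt x y (i : mor x y) n : monomor i -> ~ epimor i -> spanned (mor p y) n ->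
  exists2 m, (m < n)%N & spanned (mor p x) m.
Proof.
move=> mi ne sp; apply: (@spanned_sub_lt _ _ _ (fun f : mor p x => i ∘ f)) sp _.
- by move=> *; exact: comp_lin_r.
- by move=> f g; exact: mi.
apply: contrapT => h; apply: ne; apply: epi_of0 => w g gi; apply: gen_faithful => l.
apply: contrapT => gl; apply: h; exists l => u ul.
by apply: gl; rewrite -ul comp_assoc gi comp_0l.
Qed.

End Generator.

End FiniteCategory.

Section ProjectiveCovers.
Variables (k : closedFieldType) (C : linCat k).
Hypothesis finC : finite_category C.
Let abC := fin_abelian finC.
Implicit Types x y z w s t p q : C.

(** The object [T] contains every simple object, and Hom(p, T) is made as small as possible. If some
    [f : p -> t] does not factor through [pi], then [pi] is still nonzero on the kernel [i] of [f],
    so it lifts to [l] with [pi ∘ i ∘ l = pi]. The endomorphism [i ∘ l] is killed by [f] and fixed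
    by [pi]. Its Fitting idempotent splits off a summand [q] on which [pi] survives and [f]
    vanishes, so that Hom(q, T) is strictly smaller. *)
Lemma proj_cover s : simple_ob s -> exists p (pi : mor p s),
  [/\ projective_ob p, pi <> 0 &
    forall t (f : mor p t), simple_ob t -> exists g : mor s t, f = g ∘ pi].
Proof.
move=> ss; have [n [r hr]] := fin_simples finC.
have [T _ hT] := @sum_retracts _ _ abC (fun=> True) n r
  (fun _ _ => I) (fun _ _ _ _ _ _ => I) (fun=> I).
have [p0 [pi0 [pp0 epi0]]] := fin_projectives finC s.
have [d [b hb]] := fin_hom finC p0 T.
have sp0 : spanned (mor p0 T) d by exists b.
have pi00 := simple_nonzero ss epi0.
have [m] := ubnP d.
elim: m d p0 pi0 pp0 pi00 sp0 {b hb epi0} => // m IH d p pi pp pi0 sp dm.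
case: (pselect (forall t (f : mor p t), simple_ob t -> exists g : mor s t, f = g ∘ pi)).
  by move=> h; exists p, pi.
move=> /existsNP[t /existsNP[f /not_implyP[st nf]]].
have f0 : f <> 0 by move=> f0; apply: nf; exists 0; rewrite comp_0l.
have [w [i ki]] := has_kernels abC f.
have ef := simple_epi abC st f0; have cf := epi_cokernel_ker abC ef ki.
have pii : pi ∘ i <> 0.
  move=> pii; have [g eg] := cokernel_desc cf pii.
  have g0 : g <> 0 by move=> g0; apply: pi0; rewrite -eg g0 comp_0l.
  have [h [hg gh]] := simple_iso abC st ss g0; apply: nf; exists h.
  by rewrite -eg comp_assoc hg comp_id_l.
have [l el] := proj_lift pi pp (simple_epi abC ss pii).
have [c [bc hbc]] := fin_hom finC p p.
have [e [ee kille keepe]] := fitting_idempotent (i ∘ l) (ex_intro _ bc hbc : spanned _ c).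
have fe : f ∘ e = 0 by apply: kille; rewrite comp_assoc (proj1 ki) comp_0l.
have pie : pi ∘ e = pi by apply: keepe; rewrite comp_assoc.
have [q [a [u [au ua]]]] := split_idempotent abC ee.
have [m' lt sq] : exists2 m', (m' < d)%N & spanned (mor q T) m'.
  apply: (@spanned_sub_lt _ _ _ (fun h : mor q T => h ∘ u)) sp _.
  - by move=> *; exact: comp_lin_l.
  - by move=> h h' eh; rewrite -(comp_id_r h) -ua comp_assoc eh -comp_assoc ua comp_id_r.
  have [j [g [g' [g'g gg']]]] := hr t st; have [v [v' v'v]] := hT j.
  exists (v ∘ g ∘ f) => h eh; apply: f0.
  have mvg : monomor (v ∘ g) by apply: mono_comp; [exact: split_mono v'v | exact: split_mono g'g].
  apply: (monor0 mvg); rewrite -comp_assoc -eh -(comp_id_r (h ∘ u)) -comp_assoc.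
  have -> : u ∘ idmor p = u ∘ e by rewrite -au comp_assoc ua comp_id_l comp_id_r.
  by rewrite comp_assoc eh -!comp_assoc fe !comp_0r.
apply: (IH m' q (pi ∘ a)) => //; first exact: proj_retract ua pp.
  move=> pia; apply: pi0.
  by rewrite -pie -au comp_assoc pia comp_0l.
by apply: leq_trans lt _; rewrite -ltnS.
Qed.

Lemma proj_covers : exists (I : Type) (S P : I -> C) (pi : forall i, mor (P i) (S i)),
  [/\ forall i, simple_ob (S i), forall i, projective_ob (P i) /\ epimor (pi i),
      forall i j (f : mor (P i) (S j)), f <> 0 -> i = j,
      forall i (f : mor (P i) (S i)), exists c : k, f = c *: pi i
    & forall s, simple_ob s -> exists i, isomorphic (S i) s].
Proof.
have [n [r hr]] := fin_simples finC.
(* The list [r] may contain objects that are not simple and may repeat isomorphism classes. Keeping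
   the least index of each class of simple objects makes distinct indices non-isomorphic. *)
pose rep (i : 'I_n) := simple_ob (r i) /\
  forall j : 'I_n, isomorphic (r i) (r j) -> (i <= j)%N.
pose I := {i | rep i}; pose S (i : I) := r (sval i).
have hS (i : I) : simple_ob (S i) by have [] := svalP i.
have [P hP] := choice (fun i => proj_cover (hS i)).
have [pi hpi] : exists pi : forall i, mor (P i) (S i), forall i,
    [/\ projective_ob (P i), pi i <> 0 &
      forall t (f : mor (P i) t), simple_ob t -> exists g : mor (S i) t, f = g ∘ pi i].
  by exists (fun i => sval (cid (hP i))) => i; exact: (svalP (cid (hP i))).
exists I, S, P, pi; split=> //.
- by move=> i; have [pp pi0 _] := hpi i; split=> //; exact: simple_epi.
- move=> i j f f0; have [_ _ /(_ _ f (hS j))[g eg]] := hpi i.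
  have g0 : g <> 0 by move=> g0; apply: f0; rewrite eg g0 comp_0l.
  have [h [hg gh]] := simple_iso abC (hS i) (hS j) g0.
  have [_ mi] := svalP i; have [_ mj] := svalP j.
  have eij : sval i = sval j.
    apply: val_inj; apply/eqP; rewrite eqn_leq mi ?mj //; first by exists h, g.
    by exists g, h.
  by case: (i) (j) eij => [a ra] [b rb] /= eab; case: b / eab rb => rb; congr exist; exact: Prop_irrelevance.
- move=> i f; have [_ _ /(_ _ f (hS i))[g ->]] := hpi i.
  have [d sp] := fin_hom finC (S i) (S i); have [c ->] := schur abC g (hS i) sp.
  by exists c; rewrite compZl comp_id_l.
move=> s ss; pose Q m := `[< exists2 i : 'I_n, isomorphic s (r i) & val i = m >].
have Qex : exists m, Q m.
  by have [i hi] := hr s ss; exists i; apply/asboolP; exists i.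
have [m /asboolP[i si im] mm] := ex_minnP Qex.
have ri : rep i.
  split=> [|j ij]; first exact: iso_simple si ss.
  rewrite im; apply: mm; apply/asboolP; exists j => //.
  have [f [f' [e1 e2]]] := si; have [g [g' [e3 e4]]] := ij.
  exists (g ∘ f), (f' ∘ g'); split.
    by rewrite -comp_assoc (comp_pre e3) comp_id_l.
  by rewrite -comp_assoc (comp_pre e2) comp_id_l.
by exists (exist _ i ri); have [f [f' [e1 e2]]] := si; exists f', f.
Qed.

End ProjectiveCovers.

(** * Representability of left exact contravariant functors *)

Section Representability.
Variables (k : fieldType) (C : linCat k).
Hypothesis finC : finite_category C.
Let abC := fin_abelian finC.
Variables (p : C) (gp : proj_gen p).
Variables (Phi : C -> lmodType k) (pull : forall x y : C, mor x y -> Phi y -> Phi x).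
Hypothesis pull_id : forall x (u : Phi x), pull (idmor x) u = u.
Hypothesis pull_comp : forall x y z (g : mor y z) (f : mor x y) (u : Phi z),
  pull (g ∘ f) u = pull f (pull g u).
Hypothesis pull_lin_l : forall x y (u : Phi y), lin_map (fun f : mor x y => pull f u).
Hypothesis pull_lin_r : forall x y (f : mor x y), lin_map (pull f).
Hypothesis pull_epi : forall x y (e : mor x y), epimor e -> forall u, pull e u = 0 -> u = 0.
Hypothesis pull_coker : forall x y z (f : mor x y) (e : mor y z), is_cokernel f e ->
  forall u, pull f u = 0 -> exists v, pull e v = u.
Variable n0 : nat.
Hypothesis Phi_fin : spanned (Phi p) n0.

(** By Yoneda, [u] is a map from Hom(-, x) to [Phi]. The condition makes this map injective, so that
    [x] is a subobject of [Phi]. *)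
Definition mono_elt x (u : Phi x) := forall y (f : mor y x), pull f u = 0 -> f = 0.

(* Divide [x] by the largest subobject on which [u] vanishes. *)
Lemma mono_elt_quot x (u : Phi x) : exists z (e : mor x z) (v : Phi z),
  pull e v = u /\ mono_elt v.
Proof.
have [d [b hb]] := fin_hom finC p x; have sp : spanned (mor p x) d by exists b.
have [m] := ubnP d; elim: m d x u sp {b hb} => // m IH d x u sp dm.
case: (pselect (mono_elt u)) => [mu|]; first by exists x, (idmor x), u.
move=> /existsNP[y /existsNP[f /not_implyP[fu f0]]].
have [w [i [e [ie mi ee]]]] := image_fact abC f.
have iu : pull i u = 0 by apply: (pull_epi ee); rewrite -pull_comp ie.
have [z [q [ki cq]]] := mono_short_exact abC mi.
have [v ev] := pull_coker cq iu.
have nm : ~ monomor q.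
  move=> /monor0 mq; apply: f0; rewrite -ie (mq _ i) ?comp_0l //; exact: proj1 ki.
have [d' lt sz] := gen_quot_lt finC gp (cokernel_epi cq) nm sp.
have [|t [e' [v' [ev' mv']]]] := IH d' z v sz.
  by apply: leq_trans lt _; rewrite -ltnS.
by exists t, (e' ∘ q), v'; rewrite pull_comp ev'.
Qed.

Lemma mono_elt_join x y (u : Phi x) (v : Phi y) : exists z (w : Phi z),
  mono_elt w /\ exists (f : mor x z) (g : mor y z), pull f w = u /\ pull g w = v.
Proof.
have [s [i [j [a [b [ai bj aj bi dec]]]]]] := has_biproducts abC x y.
have [z [e [w [ew mw]]]] := mono_elt_quot (pull a u + pull b v).
exists z, w; split=> //; exists (e ∘ i), (e ∘ j).
rewrite !pull_comp ew !(lin_mapD (pull_lin_r _)) -!pull_comp ai bi aj bj !pull_id.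
by rewrite !(lin_map0 (pull_lin_l _)) addr0 add0r.
Qed.

(** Representable subobjects of [Phi] can be joined, and [Phi p] is spanned by [n0] vectors, so [n0]
    joins reach one that contains all of [Phi p]. *)
Lemma mono_elt_span : exists x (u : Phi x), mono_elt u /\
  forall v : Phi p, exists f : mor p x, pull f u = v.
Proof.
have [b hb] := Phi_fin.
suff H m : (m <= n0)%N -> exists x (u : Phi x), mono_elt u /\
    forall i : 'I_n0, (i < m)%N -> exists f : mor p x, pull f u = b i.
  have [x [u [mu hu]]] := H n0 (leqnn n0); exists x, u; split=> // v; have [a ->] := hb v.
  have [f ef] := choice (fun i => hu i (ltn_ord i)).
  exists (\sum_i a i *: f i); rewrite (lin_map_sum (pull_lin_l u)).
  by apply: eq_bigr => i _; rewrite (lin_mapZ (pull_lin_l u)) ef.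
elim: m => [_|m IH lt].
  by have [x [_ [u [_ mu]]]] := mono_elt_quot (0 : Phi p); exists x, u.
have [x [u [mu hu]]] := IH (ltnW lt).
have [z [w [mw [f [g [ef eg]]]]]] := mono_elt_join u (b (Ordinal lt)).
exists z, w; split=> // i; rewrite ltnS leq_eqVlt => /predU1P[ei|/hu[h eh]].
  by exists g; rewrite eg; congr b; apply: val_inj.
by exists (f ∘ h); rewrite pull_comp ef.
Qed.

(** A representable subobject containing all of [Phi p] is all of [Phi]. Containment passes from [p]
    to biproducts, hence to a cover [e : q -> y]. The map [f : q -> x] that classifies the pullback
    of [v] vanishes on the kernel of [e], because [u] is injective, and so descends to [y]. *)
Lemma representable : exists x (u : Phi x),
  forall y (v : Phi y), exists! f : mor y x, pull f u = v.
Proof.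
have [x [u [mu hu]]] := mono_elt_span; exists x, u => y v.
have inj z (f g : mor z x) : pull f u = pull g u -> f = g.
  by move=> e; apply/subr0_eq/mu; rewrite (lin_mapB (pull_lin_l u)) e subrr.
suff [f ef] : exists f, pull f u = v.
  by exists f; split=> // g eg; apply: inj; rewrite ef eg.
pose G q := forall w : Phi q, exists f : mor q x, pull f u = w.
have [|||q Gq [e ee]] := gen_epi finC gp (G := G) _ _ _ y.
- exact: hu.
- move=> z /zero_id zz w; exists 0.
  by rewrite -(pull_id w) zz (lin_map0 (pull_lin_l w)) (lin_map0 (pull_lin_l u)).
- move=> a b s [i [j [c [d [_ _ _ _ dec]]]]] Ga Gb w.
  have [f ef] := Ga (pull i w); have [g eg] := Gb (pull j w).
  exists (f ∘ c + g ∘ d); rewrite (lin_mapD (pull_lin_l u)) !pull_comp ef eg -!pull_comp.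
  by rewrite -(lin_mapD (pull_lin_l w)) dec pull_id.
have [f ef] := Gq (pull e v); have [w [i [ki ce]]] := epi_short_exact abC ee.
have fi : f ∘ i = 0.
  by apply: mu; rewrite pull_comp ef -pull_comp (proj1 ki) (lin_map0 (pull_lin_l v)).
have [h eh] := cokernel_desc ce fi; exists h; apply/subr0_eq/(pull_epi ee).
by rewrite (lin_mapB (pull_lin_r e)) -pull_comp eh ef subrr.
Qed.

End Representability.

(** * Functors that split short exact sequences *)

Section LinearFunctors.
Variables (k : fieldType) (A B : linCat k) (F : linFun A B).

Lemma fmor_linmap x y : lin_map (fun f : mor x y => fmor F f).
Proof. by move=> *; exact: fmor_lin. Qed.

Lemma fmor0 x y : fmor F (0 : mor x y) = 0.
Proof. exact: (lin_map0 (@fmor_linmap x y)). Qed.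

Lemma fmorD x y (f g : mor x y) : fmor F (f + g) = fmor F f + fmor F g.
Proof. exact: (lin_mapD (@fmor_linmap x y)). Qed.

Lemma fmor_zero x : is_zero x -> is_zero (fob F x).
Proof. by move=> /zero_id zx; apply/zero_id; rewrite -fmor_id zx fmor0. Qed.

Definition splits_exact := forall x y z (i : mor x y) (p : mor y z), short_exact i p ->
  exists (r : mor (fob F y) (fob F x)) (s : mor (fob F z) (fob F y)),
    [/\ r ∘ fmor F i = idmor _, fmor F p ∘ s = idmor _ & fmor F i ∘ r + s ∘ fmor F p = idmor _].

End LinearFunctors.

Definition natural_tr (k : fieldType) (A B : linCat k) (F G : linFun A B)
  (t : forall x, mor (fob F x) (fob G x)) :=
  forall x y (f : mor x y), t y ∘ fmor F f = fmor G f ∘ t x.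

(* A functor that splits short exact sequences and has projective values is
   [(+)_i Hom(P_i, -) (x) X(S_i)], with [P_i] the projective cover of the simple
   [S_i]; such functors are projective. The isomorphism is stated as a universal
   property of [X m], which is checked along a composition series of [m]. *)
Section SplittingFunctors.
Variables (k : closedFieldType) (M N : linCat k) (X : linFun M N).
Hypotheses (finM : finite_category M) (Xsplit : splits_exact X).
Hypothesis Xproj : forall m, projective_ob (fob X m).
Variables (I : Type) (S P : I -> M) (pi : forall i, mor (P i) (S i)).
Hypothesis simpleS : forall i, simple_ob (S i).
Hypothesis projP : forall i, projective_ob (P i) /\ epimor (pi i).
Hypothesis homPS : forall i j (f : mor (P i) (S j)), f <> 0 -> i = j.
Hypothesis homPP : forall i (f : mor (P i) (S i)), exists c : k, f = c *: pi i.
Hypothesis coverS : forall s, simple_ob s -> exists i, isomorphic (S i) s.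
Variable sg : forall i, mor (fob X (S i)) (fob X (P i)).
Hypothesis sgK : forall i, fmor X (pi i) ∘ sg i = idmor _.

(** The universal property of the sum over i of Hom(P i, m) tensored with X (S i), where the
    inclusion of the copy of X (S i) labelled by [f] is [fmor X f ∘ sg i]. *)
Let free m := forall (y : N) (g : forall i, mor (P i) m -> mor (fob X (S i)) y),
  (forall i, lin_map (g i)) ->
  exists! h : mor (fob X m) y, forall i (f : mor (P i) m), h ∘ fmor X f ∘ sg i = g i f.

Let free_inj m : free m -> forall (y : N) (h h' : mor (fob X m) y),
  (forall i (f : mor (P i) m), h ∘ fmor X f ∘ sg i = h' ∘ fmor X f ∘ sg i) -> h = h'.
Proof.
move=> fm y h h' e; have [|l [_ ul]] := fm y (fun i f => h ∘ fmor X f ∘ sg i).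
  by move=> i a u v; rewrite fmor_lin comp_lin_l comp_lin_r.
by rewrite -(ul h) // -(ul h').
Qed.

Lemma free_simple s : simple_ob s -> free s.
Proof.
move=> ss y g lg; have [j [f [f' [f'f ff']]]] := coverS ss.
have sgf : fmor X (f ∘ pi j) ∘ sg j = fmor X f.
  by rewrite fmor_comp -comp_assoc sgK comp_id_r.
exists (g j (f ∘ pi j) ∘ fmor X f'); split=> [i l|h hh]; last first.
  by rewrite -hh sgf -comp_assoc -fmor_comp ff' fmor_id comp_id_r.
have lE : l = f ∘ f' ∘ l by rewrite comp_assoc ff' comp_id_l.
case: (pselect (f' ∘ l = 0)) => [f'l|/homPS ij].
  by rewrite lE f'l comp_0r fmor0 comp_0l comp_0r (lin_map0 (lg i)).
case: j / ij f f' f'f ff' sgf lE => f f' f'f ff' sgf lE.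
have [c ec] := homPP (f' ∘ l); rewrite lE ec compZr (lin_mapZ (lg i)).
rewrite (lin_mapZ (@fmor_linmap _ _ _ X _ _)) compZl compZr sgf.
by rewrite -comp_assoc -fmor_comp f'f fmor_id comp_id_r.
Qed.

(** The map [h] found on [x] is extended to [y] by the retraction [r]. The remainder [g1] vanishes
    on maps that factor through [i], so it depends only on the composite with [p]. The property of
    [z] then applies, each map [P j -> z] being lifted to [y] by projectivity. *)
Lemma free_exact x y z (i : mor x y) (p : mor y z) :
  short_exact i p -> free x -> free z -> free y.
Proof.
move=> ex fx fz w g lg; have [r [s [ri ps dec]]] := Xsplit ex.
have [ki cp] := ex.
have [h [hh _]] : exists! h, forall j (f : mor (P j) x), h ∘ fmor X f ∘ sg j = g j (i ∘ f).
  by apply: fx => j a u v; rewrite comp_lin_r lg.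
pose g1 j (f : mor (P j) y) := g j f - (h ∘ r) ∘ fmor X f ∘ sg j.
have lg1 j : lin_map (g1 j).
  move=> a u v; rewrite /g1 lg fmor_lin comp_lin_l comp_lin_r scalerBr.
  by rewrite opprD addrACA.
have g1i j (f : mor (P j) x) : g1 j (i ∘ f) = 0.
  rewrite /g1 -hh fmor_comp -!comp_assoc (comp_assoc r) ri comp_id_l.
  exact: subrr.
have lift j (f : mor (P j) z) : {f' : mor (P j) y | p ∘ f' = f}.
  exact: proj_lift (proj1 (projP j)) (cokernel_epi cp).
have g1p j (f f' : mor (P j) y) : p ∘ f = p ∘ f' -> g1 j f = g1 j f'.
  move=> e; have [|l el] := kernel_lift ki (g := f - f'); first by rewrite compBr e subrr.
  by apply/subr0_eq; rewrite -(lin_mapB (lg1 j)) -el g1i.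
have [h' [hh' _]] : exists! h', forall j (f : mor (P j) z),
    h' ∘ fmor X f ∘ sg j = g1 j (sval (lift j f)).
  apply: fz => j a u v; rewrite -lg1; apply: g1p.
  by rewrite comp_lin_r !(svalP (lift _ _)).
exists (h ∘ r + h' ∘ fmor X p); split=> [j f|h1 hh1].
  rewrite compDl -(comp_assoc h') (comp_assoc (fmor X p)) -fmor_comp hh'.
  by rewrite (g1p j _ f) ?(svalP (lift _ _)) // /g1 addrC subrK.
have eh : h = h1 ∘ fmor X i.
  by apply: (free_inj fx) => j f; rewrite hh -comp_assoc (comp_assoc (fmor X i)) -fmor_comp hh1.
have eh' : h' = h1 ∘ s.
  apply: (free_inj fz) => j f; rewrite hh' /g1 -hh1.
  case: (lift j f) => f' /= <-; rewrite eh fmor_comp.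
  rewrite -compBl -(comp_assoc (fmor X p)) (comp_assoc (h1 ∘ s)); congr (_ ∘ _).
  have e1 : h1 = (h1 ∘ fmor X i) ∘ r + (h1 ∘ s) ∘ fmor X p.
    by rewrite -!comp_assoc -compDr dec comp_id_r.
  by rewrite {1}e1 addrC addKr.
by rewrite eh eh' -!comp_assoc -compDr dec comp_id_r.
Qed.

Lemma free_all m : free m.
Proof.
elim: m / (fin_length finM m) => [z zz|x y s i p ex _ fx ss]; last first.
  exact: free_exact ex fx (free_simple ss).
move=> y g lg; exists 0; split=> [i f|h _].
  have [hz _] := zz (P i); rewrite (hz f) (lin_map0 (lg i)).
  by rewrite comp_0l.
by have [_ hz] := fmor_zero X zz y; rewrite (hz h).
Qed.

(** A transformation from [X] to [E] amounts to a choice of maps from X (S i) to E (P i). Such a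
    choice over [be (P i) ∘ sg i] exists because X (S i) is projective. Naturality and the equation
    with [be] are tested on the maps [fmor X l ∘ sg i]. *)
Lemma splitting_lift_aux (E E' : linFun M N) (al : forall m, mor (fob E m) (fob E' m))
    (be : forall m, mor (fob X m) (fob E' m)) :
  natural_tr al -> (forall m, epimor (al m)) -> natural_tr be ->
  exists t : forall m, mor (fob X m) (fob E m),
    natural_tr t /\ forall m, al m ∘ t m = be m.
Proof.
move=> nal eal nbe.
have lift i : {t : mor (fob X (S i)) (fob E (P i)) | al (P i) ∘ t = be (P i) ∘ sg i}.
  exact: proj_lift.
have [t ht] : exists t : forall m, mor (fob X m) (fob E m), forall m i (f : mor (P i) m),
    t m ∘ fmor X f ∘ sg i = fmor E f ∘ sval (lift i).
  suff ex m : {t | forall i (f : mor (P i) m),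
      t ∘ fmor X f ∘ sg i = fmor E f ∘ sval (lift i)}.
    by exists (fun m => sval (ex m)) => m; exact: svalP (ex m).
  apply: cid; have [|t [ht _]] := @free_all m _ (fun i f => fmor E f ∘ sval (lift i)).
    by move=> i a u v; rewrite fmor_lin comp_lin_l.
  by exists t.
exists t; split=> [m m' f|m].
  apply: (free_inj (@free_all m)) => i l.
  rewrite -comp_assoc (comp_assoc (fmor X f)) -fmor_comp ht.
  by rewrite -comp_assoc ht fmor_comp comp_assoc.
apply: (free_inj (@free_all m)) => i l.
rewrite -comp_assoc ht comp_assoc nal -comp_assoc (svalP (lift i)).
by rewrite comp_assoc -nbe -comp_assoc.
Qed.

End SplittingFunctors.

Lemma splitting_lift (k : closedFieldType) (M N : linCat k) (X : linFun M N) :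
  finite_category M -> splits_exact X -> (forall m, projective_ob (fob X m)) ->
  forall (E E' : linFun M N) (al : forall m, mor (fob E m) (fob E' m))
    (be : forall m, mor (fob X m) (fob E' m)),
  natural_tr al -> (forall m, epimor (al m)) -> natural_tr be ->
  exists t : forall m, mor (fob X m) (fob E m),
    natural_tr t /\ forall m, al m ∘ t m = be m.
Proof.
move=> finM Xs Xp; have [I [S [P [pi [sS pP hPS hPP cS]]]]] := proj_covers finM.
have sg i : {sg : mor (fob X (S i)) (fob X (P i)) | fmor X (pi i) ∘ sg = idmor _}.
  apply: cid; have [w [l ex]] := epi_short_exact (fin_abelian finM) (proj2 (pP i)).
  by have [r [s [_ ps _]]] := Xs _ _ _ _ _ ex; exists s.
exact: (splitting_lift_aux finM Xs Xp pP hPS hPP cS (fun i => svalP (sg i))).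
Qed.

(** * The category of module functors *)

Section ExactFunctors.
Variables (k : fieldType) (A B : linCat k) (F : linFun A B).
Hypotheses (abA : abelian_cat A) (exF : exact_functor F).

Lemma exact_functor_mono x y (f : mor x y) : monomor f -> monomor (fmor F f).
Proof.
by move=> /(mono_short_exact abA)[z [p /exF[kf _]]]; exact: kernel_mono kf.
Qed.

Lemma exact_functor_epi x y (f : mor x y) : epimor f -> epimor (fmor F f).
Proof.
by move=> /(epi_short_exact abA)[z [p /exF[_ cf]]]; exact: cokernel_epi cf.
Qed.

(** Exactness speaks of short exact sequences only. An arbitrary [f] is reduced to its epimorphic
    part by the image factorization, the monomorphic part being preserved. *)
Lemma exact_functor_kernel x y w (f : mor x y) (i : mor w x) :
  is_kernel f i -> is_kernel (fmor F f) (fmor F i).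
Proof.
have [v [m [e [<- mm ee]]]] := image_fact abA f.
move=> /(kernel_of_comp_mono mm) ki; rewrite fmor_comp.
apply: kernel_comp_mono; first exact: exact_functor_mono.
by have [] := exF (conj ki (epi_cokernel_ker abA ee ki)).
Qed.

Lemma exact_functor_cokernel x y w (f : mor x y) (p : mor y w) :
  is_cokernel f p -> is_cokernel (fmor F f) (fmor F p).
Proof.
have [v [m [e [<- mm ee]]]] := image_fact abA f.
move=> /(cokernel_of_comp_epi ee) cp; rewrite fmor_comp.
apply: cokernel_comp_epi; first exact: exact_functor_epi.
by have [] := exF (conj (mono_kernel_coker abA mm cp) cp).
Qed.

End ExactFunctors.

(* A functor [K] with a jointly monic family of projections to module functors [F b]
   that its structure maps respect: kernels, biproducts and zero objects of the
   functor category arise with one, two and no projections. *)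
Section SubModuleFunctor.
Variables (k : fieldType) (C : linMon k) (M N : modCat C) (B : Type) (F : B -> modFun M N).
Variables (K : M -> N) (ka : forall b m, mor (K m) (F b m)).
Hypothesis ka_mono : forall m w (g h : mor w (K m)),
  (forall b, ka b m ∘ g = ka b m ∘ h) -> g = h.
Hypothesis act_ka_mono : forall (x : C) m w (g h : mor w (x ▷ K m)),
  (forall b, (idmor x [▷] ka b m) ∘ g = (idmor x [▷] ka b m) ∘ h) -> g = h.
Variables (Km : forall m m', mor m m' -> mor (K m) (K m')).
Variable (Ks : forall (x : C) m, isomor (K (x ▷ m)) (x ▷ K m)).
Hypothesis KmE : forall b m m' (f : mor m m'), ka b m' ∘ Km f = fmor (F b) f ∘ ka b m.
Hypothesis KsE : forall b (x : C) m,
  (idmor x [▷] ka b m) ∘ Ks x m = mstr (F b) x m ∘ ka b (x ▷ m).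

Program Definition sub_linFun : linFun M N := @LinFun k M N K Km _ _ _.
Next Obligation. by move=> m; apply: ka_mono => b; rewrite KmE fmor_id comp_id_l comp_id_r. Qed.
Next Obligation.
move=> m1 m2 m3 g f; apply: ka_mono => b; rewrite comp_assoc !KmE fmor_comp.
by rewrite -!comp_assoc KmE.
Qed.
Next Obligation.
move=> m m' a f g; apply: ka_mono => b; rewrite comp_lin_r !KmE fmor_lin.
by rewrite comp_lin_l.
Qed.

Program Definition sub_modFun : modFun M N := @ModFun k C M N sub_linFun Ks _ _ _.
Next Obligation.
move=> x x' m m' f g; apply: act_ka_mono => b; rewrite /= comp_assoc KsE.
rewrite -comp_assoc KmE comp_assoc mstr_nat -comp_assoc -KsE.
by rewrite !comp_assoc -!bmor_comp comp_id_l comp_id_r KmE.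
Qed.
Next Obligation.
move=> x y m; apply: (iso_mono (i := iso_inv (massoc x y (K m)))); rewrite /=.
apply: act_ka_mono => b; apply: (iso_mono (i := massoc x y (F b m))).
rewrite 2!comp_assoc massoc_natr -!comp_assoc (comp_pre (bwdK _)) comp_id_l.
rewrite (comp_pre (esym (massoc_natr _ _ _))) -comp_assoc KsE (comp_pre (mstr_pentagon _ _ _ _)).
rewrite (comp_pre (massoc_natr _ _ _)) -!comp_assoc (comp_pre (bwdK _)) comp_id_l.
rewrite (comp_pre (esym (bmor_compr _ _ _ _))) KsE bmor_compr -!comp_assoc.
by rewrite (comp_pre (KsE _ _ _)) -comp_assoc KmE.
Qed.
Next Obligation.
move=> m; apply: ka_mono => b; rewrite /= KmE -mstr_triangle comp_assoc -munit_nat.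
by rewrite -!comp_assoc KsE.
Qed.

Lemma sub_modFun_nat b : @is_modNat k C M N sub_modFun (F b) (ka b).
Proof. by split=> [m m' f|x m]; [exact: KmE | rewrite KsE]. Qed.

Lemma sub_modFun_lift (G : modFun M N) (t : forall m, mor (G m) (K m)) :
  (forall b, @is_modNat k C M N G (F b) (fun m => ka b m ∘ t m)) ->
  @is_modNat k C M N G sub_modFun t.
Proof.
move=> h; split=> [m m' f|x m].
  apply: ka_mono => b; have [n _] := h b.
  by rewrite [RHS]comp_assoc KmE -[RHS]comp_assoc -n comp_assoc.
apply: act_ka_mono => b; have [_ s] := h b.
by rewrite /= comp_assoc KsE -comp_assoc s comp_assoc -bmor_compr.
Qed.

End SubModuleFunctor.

Section QuotientModuleFunctor.
Variables (k : fieldType) (C : linMon k) (M N : modCat C) (F : modFun M N).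
Variables (K : M -> N) (ka : forall m, mor (F m) (K m)).
Hypothesis ka_epi : forall m, epimor (ka m).
Variables (Km : forall m m', mor m m' -> mor (K m) (K m')).
Variable (Ks : forall (x : C) m, isomor (K (x ▷ m)) (x ▷ K m)).
Hypothesis KmE : forall m m' (f : mor m m'), Km f ∘ ka m = ka m' ∘ fmor F f.
Hypothesis KsE : forall (x : C) m, Ks x m ∘ ka (x ▷ m) = (idmor x [▷] ka m) ∘ mstr F x m.

Program Definition quot_linFun : linFun M N :=
  @LinFun k M N K Km _ _ _.
Next Obligation. by move=> m; apply: ka_epi; rewrite KmE fmor_id comp_id_l comp_id_r. Qed.
Next Obligation.
move=> m1 m2 m3 g f; apply: ka_epi; rewrite -comp_assoc !KmE fmor_comp.
by rewrite !comp_assoc KmE.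
Qed.
Next Obligation.
move=> m m' a f g; apply: ka_epi; rewrite comp_lin_l !KmE fmor_lin.
by rewrite comp_lin_r.
Qed.

Program Definition quot_modFun : modFun M N :=
  @ModFun k C M N quot_linFun Ks _ _ _.
Next Obligation.
move=> x x' m m' f g; apply: ka_epi; rewrite /= -!comp_assoc KsE.
rewrite KmE !comp_assoc KsE -comp_assoc mstr_nat.
by rewrite !comp_assoc -!bmor_comp comp_id_l comp_id_r KmE.
Qed.
Next Obligation.
move=> x y m; apply: ka_epi; rewrite /= -!comp_assoc KsE KmE.
rewrite comp_assoc massoc_natr -comp_assoc mstr_pentagon !comp_assoc -bmor_compr.
rewrite -KsE bmor_compr -!comp_assoc; congr (_ ∘ _).
by rewrite !comp_assoc KsE.
Qed.
Next Obligation.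
move=> m; apply: ka_epi; rewrite /= KmE -mstr_triangle comp_assoc -munit_nat.
by rewrite -!comp_assoc KsE.
Qed.

Lemma quot_modFun_nat : @is_modNat k C M N F quot_modFun ka.
Proof. by split=> [m m' f|x m]; [rewrite KmE | rewrite KsE]. Qed.

End QuotientModuleFunctor.

Section FunctorCategory.
Variables (k : fieldType) (C : linMon k) (M N : modCat C).
Hypotheses (abN : abelian_cat N) (exN : forall x : C, exact_functor (bfix_l (cact N) x)).
Local Notation Fun := (funCat M N).
Implicit Types F G H : Fun.

Definition comp_at F G (e : mor F G) (m : M) : mor (fob (ufun F) m) (fob (ufun G) m) := subval e m.

Definition mkNat (F G : modFun M N) (e : forall m, mor (F m) (G m)) (he : is_modNat e) :
  @mor k Fun F G := mkSub (modNat_closed F G) he.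

Lemma comp_at_nat F G (e : mor F G) m m' (f : mor m m') :
  comp_at e m' ∘ fmor (ufun F) f = fmor (ufun G) f ∘ comp_at e m.
Proof. by have [n _] := subspaceP e; exact: n. Qed.

Lemma comp_at_str F G (e : mor F G) (x : C) m :
  mstr G x m ∘ comp_at e (x ▷ m) = (idmor x [▷] comp_at e m) ∘ mstr F x m.
Proof. by have [_ s] := subspaceP e; exact: s. Qed.

Lemma natP F G (e e' : mor F G) : (forall m, comp_at e m = comp_at e' m) -> e = e'.
Proof. exact: modNat_eq. Qed.

Lemma natP0 F G (e : mor F G) : (forall m, comp_at e m = 0) -> e = 0.
Proof. by move=> h; apply: natP => m; rewrite h. Qed.

Lemma comp_at_comp F G H (g : mor G H) (f : mor F G) m :
  comp_at (g ∘ f) m = comp_at g m ∘ comp_at f m.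
Proof. by []. Qed.

Lemma comp_at_lin F G m : lin_map (fun e : mor F G => comp_at e m).
Proof. by []. Qed.

Lemma pointwise_mono F G (e : mor F G) : (forall m, monomor (comp_at e m)) -> monomor e.
Proof.
by move=> h H a b eab; apply: natP => m; apply: h; rewrite -!comp_at_comp eab.
Qed.

Lemma pointwise_epi F G (e : mor F G) : (forall m, epimor (comp_at e m)) -> epimor e.
Proof.
by move=> h H a b eab; apply: natP => m; apply: h; rewrite -!comp_at_comp eab.
Qed.

Lemma act_kernel (x : C) (m n l : N) (f : mor m n) (i : mor l m) :
  is_kernel f i -> is_kernel (idmor x [▷] f) (idmor x [▷] i).
Proof. exact: (exact_functor_kernel abN (exN x)). Qed.

Lemma act_cokernel (x : C) (m n l : N) (f : mor m n) (p : mor n l) :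
  is_cokernel f p -> is_cokernel (idmor x [▷] f) (idmor x [▷] p).
Proof. exact: (exact_functor_cokernel abN (exN x)). Qed.

Lemma pointwise_kernel F G H (e : mor F G) (i : mor H F) :
  (forall m, is_kernel (comp_at e m) (comp_at i m)) -> is_kernel e i.
Proof.
move=> ki; apply: mk_kernel.
- by apply: natP => m; rewrite comp_at_comp (proj1 (ki m)).
- by apply: pointwise_mono => m; exact: kernel_mono (ki m).
move=> L g eg.
have lift m : {h | comp_at i m ∘ h = comp_at g m}.
  by apply: (kernel_lift (ki m)); rewrite -comp_at_comp eg.
have [l lE] : exists l : forall m, mor (fob (ufun L) m) (fob (ufun H) m),
    forall m, comp_at i m ∘ l m = comp_at g m.
  by exists (fun m => sval (lift m)) => m; exact: svalP (lift m).
suff hn : @is_modNat k C M N L H l by exists (mkNat hn); apply: natP => m; exact: lE.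
split=> [m m' f|x m].
  apply: (kernel_mono (ki m')); rewrite !comp_assoc lE !comp_at_nat.
  by rewrite -!comp_assoc lE.
apply: (kernel_mono (act_kernel x (ki m))).
rewrite comp_assoc -comp_at_str -comp_assoc lE comp_at_str.
by rewrite comp_assoc -bmor_compr lE.
Qed.

Lemma pointwise_cokernel F G H (e : mor F G) (p : mor G H) :
  (forall m, is_cokernel (comp_at e m) (comp_at p m)) -> is_cokernel e p.
Proof.
move=> cp; apply: mk_cokernel.
- by apply: natP => m; rewrite comp_at_comp (proj1 (cp m)).
- by apply: pointwise_epi => m; exact: cokernel_epi (cp m).
move=> L g eg.
have lift m : {h | h ∘ comp_at p m = comp_at g m}.
  by apply: (cokernel_desc (cp m)); rewrite -comp_at_comp eg.
have [l lE] : exists l : forall m, mor (fob (ufun H) m) (fob (ufun L) m),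
    forall m, l m ∘ comp_at p m = comp_at g m.
  by exists (fun m => sval (lift m)) => m; exact: svalP (lift m).
suff hn : @is_modNat k C M N H L l by exists (mkNat hn); apply: natP => m; exact: lE.
split=> [m m' f|x m].
  apply: (cokernel_epi (cp m)); rewrite -!comp_assoc -comp_at_nat.
  by rewrite !comp_assoc !lE comp_at_nat -comp_assoc lE.
apply: (cokernel_epi (cp (x ▷ m))).
rewrite -!comp_assoc lE !comp_at_str.
by rewrite comp_assoc -bmor_compr lE.
Qed.

Lemma fun_kernel F G (e : mor F G) : exists H (i : mor H F),
  forall m, is_kernel (comp_at e m) (comp_at i m).
Proof.
have [K hK] := choice (fun m => has_kernels abN (comp_at e m)).
have [ka kK] : exists ka : forall m, mor (K m) (fob (ufun F) m),
    forall m, is_kernel (comp_at e m) (ka m).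
  by exists (fun m => sval (cid (hK m))) => m; exact: svalP (cid (hK m)).
have Km m m' (f : mor m m') : {g : mor (K m) (K m') | ka m' ∘ g = fmor (ufun F) f ∘ ka m}.
  apply: (kernel_lift (kK m')).
  by rewrite comp_assoc comp_at_nat -comp_assoc (proj1 (kK m)) comp_0r.
have Ks (x : C) m : {s : isomor (K (x ▷ m)) (x ▷ K m) |
    (idmor x [▷] ka m) ∘ s = mstr F x m ∘ ka (x ▷ m)}.
  apply: (kernel_transport (kK (x ▷ m)) (act_kernel x (kK m)) (t := mstr G x m)).
  by rewrite comp_at_str.
have ka_mono m w (g h : mor w (K m)) : (unit -> ka m ∘ g = ka m ∘ h) -> g = h.
  by move=> /(_ tt); exact: kernel_mono (kK m) _ g h.
have act_mono (x : C) m w (g h : mor w (x ▷ K m)) :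
    (unit -> (idmor x [▷] ka m) ∘ g = (idmor x [▷] ka m) ∘ h) -> g = h.
  by move=> /(_ tt); exact: kernel_mono (act_kernel x (kK m)) _ g h.
have KmE (b : unit) m m' f := svalP (Km m m' f); have KsE (b : unit) x m := svalP (Ks x m).
exists (@sub_modFun k C M N unit (fun=> F) K (fun=> ka) ka_mono act_mono _ _ KmE KsE).
by exists (mkNat (@sub_modFun_nat k C M N unit (fun=> F) K (fun=> ka) ka_mono act_mono _ _ KmE KsE tt)).
Qed.

Lemma fun_cokernel F G (e : mor F G) : exists H (p : mor G H),
  forall m, is_cokernel (comp_at e m) (comp_at p m).
Proof.
have [K hK] := choice (fun m => has_cokernels abN (comp_at e m)).
have [ka kK] : exists ka : forall m, mor (fob (ufun G) m) (K m),
    forall m, is_cokernel (comp_at e m) (ka m).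
  by exists (fun m => sval (cid (hK m))) => m; exact: svalP (cid (hK m)).
have Km m m' (f : mor m m') : {g : mor (K m) (K m') | g ∘ ka m = ka m' ∘ fmor (ufun G) f}.
  apply: (cokernel_desc (kK m)).
  by rewrite -comp_assoc -comp_at_nat comp_assoc (proj1 (kK m')) comp_0l.
have Ks (x : C) m : {s : isomor (K (x ▷ m)) (x ▷ K m) |
    s ∘ ka (x ▷ m) = (idmor x [▷] ka m) ∘ mstr G x m}.
  apply: (cokernel_transport (kK (x ▷ m)) (act_cokernel x (kK m)) (t := mstr F x m)).
  by rewrite comp_at_str.
have ka_epi m := cokernel_epi (kK m).
have KmE m m' f := svalP (Km m m' f); have KsE x m := svalP (Ks x m).
by exists (quot_modFun ka_epi KmE KsE), (mkNat (quot_modFun_nat ka_epi KmE KsE)).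
Qed.

(** Kernels can be formed pointwise, and a monomorphism makes the inclusion of its pointwise kernel
    zero. The dual argument and the uniqueness of kernels give the other pointwise descriptions. *)
Lemma fun_mono_at F G (e : mor F G) : monomor e -> forall m, monomor (comp_at e m).
Proof.
move=> me m; have [H [i ki]] := fun_kernel e.
have i0 : i = 0 by apply: (monor0 me); apply: natP => l; rewrite comp_at_comp (proj1 (ki l)).
apply: mono_of0 => w g eg; have [h <-] := kernel_lift (ki m) eg.
by rewrite i0 (_ : comp_at 0 m = 0) // comp_0l.
Qed.

Lemma fun_epi_at F G (e : mor F G) : epimor e -> forall m, epimor (comp_at e m).
Proof.
move=> me m; have [H [p cp]] := fun_cokernel e.
have p0 : p = 0 by apply: (epir0 me); apply: natP => l; rewrite comp_at_comp (proj1 (cp l)).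
apply: epi_of0 => w g eg; have [h <-] := cokernel_desc (cp m) eg.
by rewrite p0 (_ : comp_at 0 m = 0) // comp_0r.
Qed.

Lemma fun_kernel_at F G H (e : mor F G) (i : mor H F) :
  is_kernel e i -> forall m, is_kernel (comp_at e m) (comp_at i m).
Proof.
move=> ki m; have [K [j kj]] := fun_kernel e.
have [s <-] := kernel_unique ki (pointwise_kernel kj).
have [t et] : exists t : isomor (fob (ufun H) m) (fob (ufun K) m), fwd t = comp_at (fwd s) m.
  have e1 : comp_at (bwd s) m ∘ comp_at (fwd s) m = idmor _ by rewrite -comp_at_comp fwdK.
  have e2 : comp_at (fwd s) m ∘ comp_at (bwd s) m = idmor _ by rewrite -comp_at_comp bwdK.
  by exists (Isomor e1 e2).
by rewrite comp_at_comp -et; exact: kernel_iso_src.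
Qed.

Lemma fun_cokernel_at F G H (e : mor F G) (p : mor G H) :
  is_cokernel e p -> forall m, is_cokernel (comp_at e m) (comp_at p m).
Proof.
move=> cp m; have [K [q cq]] := fun_cokernel e.
have [s <-] := cokernel_unique (pointwise_cokernel cq) cp.
have [t et] : exists t : isomor (fob (ufun K) m) (fob (ufun H) m), fwd t = comp_at (fwd s) m.
  have e1 : comp_at (bwd s) m ∘ comp_at (fwd s) m = idmor _ by rewrite -comp_at_comp fwdK.
  have e2 : comp_at (fwd s) m ∘ comp_at (bwd s) m = idmor _ by rewrite -comp_at_comp bwdK.
  by exists (Isomor e1 e2).
by rewrite comp_at_comp -et; exact: cokernel_iso_tgt.
Qed.

Lemma fun_exactE F G H (i : mor F G) (p : mor G H) :
  short_exact i p <-> forall m, short_exact (comp_at i m) (comp_at p m).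
Proof.
split=> [[ki cp] m|h]; first by split; [exact: fun_kernel_at | exact: fun_cokernel_at].
by split; [apply: pointwise_kernel | apply: pointwise_cokernel] => m; case: (h m).
Qed.

End FunctorCategory.

(** * Duals and module categories *)

Section ActIso.
Variables (k : fieldType) (C : linMon k) (D : modCat C) (x : C) (m n : D) (i : isomor m n).

Lemma act_fwdK : (idmor x [▷] bwd i) ∘ (idmor x [▷] fwd i) = idmor (x ▷ m).
Proof. by rewrite -bmor_compr fwdK bmor_id. Qed.

Lemma act_bwdK : (idmor x [▷] fwd i) ∘ (idmor x [▷] bwd i) = idmor (x ▷ n).
Proof. by rewrite -bmor_compr bwdK bmor_id. Qed.

End ActIso.

Section DualPair.
Variables (k : fieldType) (C : linMon k) (v d : C).
Variables (ev : mor (d ⊗ v) unit_ob) (coev : mor unit_ob (v ⊗ d)).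
Hypothesis zigzag_v : runit v ∘ (idmor v [⊗] ev) ∘ tassoc v d v ∘ (coev [⊗] idmor v) = lunit v.
Hypothesis zigzag_d :
  lunit d ∘ (ev [⊗] idmor d) ∘ bwd (tassoc d v d) ∘ (idmor d [⊗] coev) = runit d.

Section Adjunction.
Variable D : modCat C.
Implicit Types m n : D.

(** Unit of the adjunction in which [d ▷ -] is left adjoint to [v ▷ -]; [act_eps] is the counit.
    Both are locked so that simplification does not expose their associators. *)
Definition act_eta m : mor m (v ▷ d ▷ m) :=
  locked (massoc v d m ∘ (coev [▷] idmor m) ∘ bwd (munit m)).

Definition act_eps m : mor (d ▷ v ▷ m) m :=
  locked (munit m ∘ (ev [▷] idmor m) ∘ bwd (massoc d v m)).

Lemma act_etaE m : act_eta m = massoc v d m ∘ (coev [▷] idmor m) ∘ bwd (munit m).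
Proof. by rewrite /act_eta -lock. Qed.

Lemma act_epsE m : act_eps m = munit m ∘ (ev [▷] idmor m) ∘ bwd (massoc d v m).
Proof. by rewrite /act_eps -lock. Qed.

Lemma act_eta_nat m n (f : mor m n) :
  (idmor v [▷] (idmor d [▷] f)) ∘ act_eta m = act_eta n ∘ f.
Proof.
rewrite !act_etaE comp_assoc -massoc_natr -!comp_assoc; congr (_ ∘ _).
rewrite comp_assoc bmor_rl -bmor_lr -comp_assoc; congr (_ ∘ _).
by apply: (iso_mono (i := munit n)); rewrite comp_assoc munit_nat -comp_assoc bwdK
  comp_id_r comp_assoc bwdK comp_id_l.
Qed.

Lemma act_eps_nat m n (f : mor m n) :
  f ∘ act_eps m = act_eps n ∘ (idmor d [▷] (idmor v [▷] f)).
Proof.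
rewrite !act_epsE comp_assoc -munit_nat -!comp_assoc; congr (_ ∘ _).
rewrite comp_assoc bmor_rl -bmor_lr -comp_assoc; congr (_ ∘ _).
by apply: (iso_mono (i := massoc d v n)); rewrite comp_assoc massoc_natr -comp_assoc bwdK
  comp_id_r comp_assoc bwdK comp_id_l.
Qed.

Lemma act_zigzag_v m : (idmor v [▷] act_eps m) ∘ act_eta (v ▷ m) = idmor (v ▷ m).
Proof.
apply: (iso_epi (i := munit (v ▷ m))); apply: (iso_epi (i := massoc unit_ob v m)).
rewrite comp_id_l munit_massoc -zigzag_v !bmor_compl.
rewrite !act_etaE -!comp_assoc (comp_pre (fwdK _)) comp_id_l -massoc_natl.
rewrite !act_epsE !bmor_compr -!comp_assoc (comp_pre (esym (act_pentagon _ _ _ _))).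
rewrite -!comp_assoc (comp_pre (act_fwdK _ _)) comp_id_l.
by rewrite (comp_pre (esym (massoc_natm _ _ _))) -!comp_assoc (comp_pre (act_triangle _ _)).
Qed.

Lemma act_zigzag_d m : act_eps (d ▷ m) ∘ (idmor d [▷] act_eta m) = idmor (d ▷ m).
Proof.
apply: (iso_epi (i := bmor_iso (cact D) (iso_id d) (munit m))).
apply: (iso_epi (i := massoc d unit_ob m)).
rewrite comp_id_l /= act_triangle -zigzag_d !bmor_compl.
rewrite !act_etaE !bmor_compr -!comp_assoc (comp_pre (act_fwdK _ _)) comp_id_l -massoc_natm.
have -> : (idmor d [▷] massoc v d m) ∘ massoc d (v ⊗ d) m ∘ ((idmor d [⊗] coev) [▷] idmor m)
  = massoc d v (d ▷ m) ∘ massoc (d ⊗ v) d m ∘ (bwd (tassoc d v d) [▷] idmor m)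
      ∘ ((idmor d [⊗] coev) [▷] idmor m).
  rewrite (comp_pre (esym (act_pentagon _ _ _ _))) -!comp_assoc.
  by rewrite (comp_pre (esym (bmor_compl _ _ _ _))) bwdK bmor_id comp_id_l.
rewrite act_epsE -!comp_assoc (comp_pre (fwdK _)) comp_id_l.
by rewrite (comp_pre (esym (massoc_natl _ _ _))) -!comp_assoc (comp_pre (munit_massoc _ _)).
Qed.

Lemma act_transpose_inj m n (f g : mor m (v ▷ n)) :
  act_eps n ∘ (idmor d [▷] f) = act_eps n ∘ (idmor d [▷] g) -> f = g.
Proof.
move=> /(congr1 (fun t => (idmor v [▷] t) ∘ act_eta m)).
rewrite !bmor_compr -!comp_assoc !act_eta_nat.
by rewrite !comp_assoc act_zigzag_v !comp_id_l.
Qed.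

Lemma act_transpose_K m n (f : mor (d ▷ m) n) :
  act_eps n ∘ (idmor d [▷] ((idmor v [▷] f) ∘ act_eta m)) = f.
Proof. by rewrite bmor_compr comp_assoc -act_eps_nat -comp_assoc act_zigzag_d comp_id_r. Qed.

Lemma act_transpose_K' m n (f : mor m (v ▷ n)) :
  (idmor v [▷] (act_eps n ∘ (idmor d [▷] f))) ∘ act_eta m = f.
Proof. by rewrite bmor_compr -comp_assoc act_eta_nat comp_assoc act_zigzag_v comp_id_l. Qed.

Lemma right_adjoint_kernel m n l (f : mor m n) (i : mor l m) :
  is_kernel f i -> is_kernel (idmor v [▷] f) (idmor v [▷] i).
Proof.
move=> ki; apply: mk_kernel.
- by rewrite -bmor_compr (proj1 ki) bmor_0r.
- move=> w g g' e; apply: act_transpose_inj; apply: (kernel_mono ki).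
  by rewrite !comp_assoc !act_eps_nat -!comp_assoc -!bmor_compr e.
move=> w g e; have [|h eh] := kernel_lift ki (g := act_eps m ∘ (idmor d [▷] g)).
  by rewrite comp_assoc act_eps_nat -comp_assoc -bmor_compr e bmor_0r comp_0r.
exists ((idmor v [▷] h) ∘ act_eta w).
by rewrite comp_assoc -bmor_compr eh act_transpose_K'.
Qed.

Lemma left_adjoint_cokernel m n l (f : mor m n) (p : mor n l) :
  is_cokernel f p -> is_cokernel (idmor d [▷] f) (idmor d [▷] p).
Proof.
move=> cp; apply: mk_cokernel.
- by rewrite -bmor_compr (proj1 cp) bmor_0r.
- move=> w g g' e; rewrite -(act_transpose_K g) -(act_transpose_K g'); congr (_ ∘ (_ [▷] _)).
  apply: (cokernel_epi cp).
  by rewrite -!comp_assoc -!act_eta_nat !comp_assoc -!bmor_compr e.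
move=> w g e; have [|h eh] := cokernel_desc cp (g := (idmor v [▷] g) ∘ act_eta n).
  by rewrite -comp_assoc -act_eta_nat comp_assoc -bmor_compr e bmor_0r comp_0l.
exists (act_eps w ∘ (idmor d [▷] h)).
by rewrite -comp_assoc -bmor_compr eh act_transpose_K.
Qed.

End Adjunction.

Section OplaxFunctor.
Variables (D E : modCat C) (T : linFun D E).
Variable s : forall (x : C) (m : D), mor (fob T (x ▷ m)) (x ▷ fob T m).
Hypothesis s_nat : forall x x' (m m' : D) (f : mor x x') (g : mor m m'),
  s x' m' ∘ fmor T (f [▷] g) = (f [▷] fmor T g) ∘ s x m.
Hypothesis s_pent : forall x y (m : D),
  massoc x y (fob T m) ∘ s (x ⊗ y) m
  = (idmor x [▷] s y m) ∘ s x (y ▷ m) ∘ fmor T (massoc x y m).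
Hypothesis s_tri : forall m : D, munit (fob T m) ∘ s unit_ob m = fmor T (munit m).

(** The pentagon turns the two structure maps into the one for [d ⊗ v], and naturality along [ev]
    reduces that one to the unit. With [oplax_eta], this is what allows duals to invert [s]. *)
Lemma oplax_eps m :
  act_eps (fob T m) ∘ (idmor d [▷] s v m) ∘ s d (v ▷ m) = fmor T (act_eps m).
Proof.
apply: (iso_epi (i := fmor_iso T (massoc d v m))); rewrite -!comp_assoc /= -s_pent.
rewrite !act_epsE -!comp_assoc (comp_pre (fwdK _)) comp_id_l -fmor_comp -!comp_assoc fwdK comp_id_r.
by rewrite fmor_comp -(fmor_id T) -s_nat comp_assoc s_tri.
Qed.

Lemma oplax_eta m :
  (idmor v [▷] s d m) ∘ s v (d ▷ m) ∘ fmor T (act_eta m) = act_eta (fob T m).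
Proof.
apply: (iso_epi (i := fmor_iso T (munit m))); rewrite /= -!comp_assoc -fmor_comp.
rewrite !act_etaE -!comp_assoc fwdK comp_id_r fmor_comp.
rewrite (comp_pre3 (esym (s_pent v d m))) -!comp_assoc s_nat fmor_id.
by rewrite -s_tri (comp_pre (fwdK _)) comp_id_l.
Qed.

End OplaxFunctor.

End DualPair.

Section RigidOplax.
Variables (k : fieldType) (C : linMon k).
Hypothesis rigC : rigid C.
Variables (D E : modCat C) (T : linFun D E).
Variable s : forall (x : C) (m : D), mor (fob T (x ▷ m)) (x ▷ fob T m).
Hypothesis s_nat : forall x x' (m m' : D) (f : mor x x') (g : mor m m'),
  s x' m' ∘ fmor T (f [▷] g) = (f [▷] fmor T g) ∘ s x m.
Hypothesis s_pent : forall x y (m : D),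
  massoc x y (fob T m) ∘ s (x ⊗ y) m
  = (idmor x [▷] s y m) ∘ s x (y ▷ m) ∘ fmor T (massoc x y m).
Hypothesis s_tri : forall m : D, munit (fob T m) ∘ s unit_ob m = fmor T (munit m).

(* The inverse of [s x m] is the mate of [s y (x ▷ m)], where [x] is a left dual of [y]. *)
Lemma oplax_is_iso x m : is_iso (s x m).
Proof.
have [_ [y [ev [coev [zv zd]]]]] := rigC x.
exists (act_eps ev (fob T (x ▷ m)) ∘ (idmor x [▷] (s y (x ▷ m) ∘ fmor T (act_eta coev m)))).
split.
  rewrite bmor_compr -!comp_assoc -s_nat (comp_pre3 (oplax_eps ev s_nat s_pent s_tri _)).
  by rewrite -fmor_comp (act_zigzag_d zd) fmor_id.
rewrite comp_assoc act_eps_nat -comp_assoc -bmor_compr (oplax_eta coev s_nat s_pent s_tri).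
exact: (act_zigzag_d zd (fob T m)).
Qed.

End RigidOplax.

(** * The reversed tensor product, and exactness of tensoring on both sides *)

Section ReverseTensor.
Variables (k : fieldType) (C : linMon k).

(** Reversal exchanges left and right duals and turns [- ⊗ x] into tensoring on the left, so that
    exactness on one side yields the other. *)
Program Definition rev_tens : bilinFun C C C :=
  @BilinFun k C C C (fun x y => y ⊗ x) (fun x x' y y' f g => g [⊗] f) _ _ _ _.
Next Obligation. by move=> *; exact: bmor_id. Qed.
Next Obligation. by move=> *; exact: bmor_comp. Qed.
Next Obligation. by move=> *; exact: bmor_lin_r. Qed.
Next Obligation. by move=> *; exact: bmor_lin_l. Qed.

Program Definition rev_mon : linMon k :=
  @LinMon k C rev_tens unit_ob (fun x y z => iso_inv (tassoc z y x)) runit lunit _ _ _ _ _.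
Next Obligation.
move=> x x' y y' z z' f g h /=; apply: (iso_mono (i := tassoc z' y' x')).
apply: (iso_epi (i := tassoc z y x)).
by rewrite -!comp_assoc (comp_pre (bwdK _)) comp_id_l fwdK comp_id_r tassoc_nat.
Qed.
Next Obligation. by move=> *; exact: runit_nat. Qed.
Next Obligation. by move=> *; exact: lunit_nat. Qed.
Next Obligation.
move=> x y z w /=.
pose L := iso_comp (bmor_iso (tens C) (iso_id w) (tassoc z y x))
  (iso_comp (tassoc w (z ⊗ y) x) (bmor_iso (tens C) (tassoc w z y) (iso_id x))).
apply: (iso_mono (i := L)); rewrite /= tens_pentagon -!comp_assoc.
rewrite (comp_pre (bwdK _)) comp_id_l bwdK (comp_pre (esym (tens_pentagon _ _ _ _))).
rewrite -!comp_assoc (comp_pre (esym (bmor_compl _ _ _ _))) bwdK bmor_id comp_id_l.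
by rewrite (comp_pre (bwdK _)) comp_id_l -bmor_compr bwdK bmor_id.
Qed.
Next Obligation.
move=> x y /=; apply: (iso_epi (i := tassoc y unit_ob x)).
by rewrite -comp_assoc fwdK comp_id_r tens_triangle.
Qed.

Lemma rev_left_dual x y : @is_left_dual k C x y -> @is_left_dual k rev_mon y x.
Proof. by move=> [ev [coev [e1 e2]]]; exists ev, coev; split. Qed.

Lemma rev_rigid : rigid C -> rigid rev_mon.
Proof.
by move=> h x; have [[y dy] [z dz]] := h x; split; [exists z | exists y]; exact: rev_left_dual.
Qed.

End ReverseTensor.

Section RigidExact.
Variables (k : fieldType) (C : linMon k).
Hypothesis rigC : rigid C.

(** The action of [x] is right adjoint to that of its left dual, so it preserves kernels. It is left
    adjoint to the action of its right dual, so it preserves cokernels. *)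
Lemma rigid_act_exact (D : modCat C) (x : C) : exact_functor (bfix_l (cact D) x).
Proof.
have [[y [ev [coev [e1 e2]]]] [y' [ev' [coev' [e1' e2']]]]] := rigC x.
move=> a b c i p [ki cp]; split.
  exact: (@right_adjoint_kernel _ _ _ _ _ _ e1 D _ _ _ _ _ ki).
exact: (@left_adjoint_cokernel _ _ _ _ _ _ e2' D _ _ _ _ _ cp).
Qed.

Lemma rigid_tens_exact_l (x : C) : exact_functor (bfix_l (tens C) x).
Proof. exact: (@rigid_act_exact (regMod C) x). Qed.

End RigidExact.

Lemma rigid_tens_exact_r (k : fieldType) (C : linMon k) (x : C) :
  rigid C -> exact_functor (bfix_r (tens C) x).
Proof. by move=> /(@rev_rigid k C) r; exact: (@rigid_tens_exact_l k (rev_mon C) r x). Qed.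

(** * Module functors out of an exact module category *)

Section ModuleFunctorExactness.
Variables (k : fieldType) (C : linMon k) (M N : modCat C) (H : modFun M N).
Hypotheses (finC : finite_category C) (exM : exact_module_category M).
Hypothesis modN : module_category N.

Lemma mstr_bwd_nat x x' (m m' : M) (f : mor x x') (g : mor m m') :
  bwd (mstr H x' m') ∘ (f [▷] fmor (ufun H) g) = fmor (ufun H) (f [▷] g) ∘ bwd (mstr H x m).
Proof.
apply: (iso_mono (i := mstr H x' m')); rewrite !comp_assoc bwdK comp_id_l mstr_nat.
by rewrite -comp_assoc bwdK comp_id_r.
Qed.

(** The functor [H] is only linear, but q ▷ H(-) is isomorphic to H(q ▷ -). As [q ▷ z] is projective
    in [M], the sequence acted on by [q] already splits there, and [H] preserves the splitting. *)
Lemma act_proj_splits q : projective_ob q ->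
  splits_exact (linFun_comp (bfix_l (cact N) q) (ufun H)).
Proof.
move=> pq x y z i p ex.
have [ki cp] := mod_exact_l (emod_module exM) q ex.
have [s0 /= es] := proj_split (@emod_projective _ _ _ exM q z pq) (cokernel_epi cp).
have [|r0 /= er] := kernel_lift ki (g := idmor _ - s0 ∘ (idmor q [▷] p)).
  by rewrite compBr comp_id_r comp_assoc /= es comp_id_l subrr.
have ri : r0 ∘ (idmor q [▷] i) = idmor _.
  apply: (kernel_mono ki); rewrite comp_assoc /= er compBl comp_id_l comp_id_r -comp_assoc.
  by rewrite (proj1 ki) comp_0r subr0.
exists (mstr H q x ∘ fmor (ufun H) r0 ∘ bwd (mstr H q y)).
exists (mstr H q y ∘ fmor (ufun H) s0 ∘ bwd (mstr H q z)); split=> /=.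
- by rewrite -!comp_assoc mstr_bwd_nat (comp_pre (esym (fmor_comp _ _ _))) ri fmor_id comp_id_l bwdK.
- rewrite comp_assoc -mstr_nat -comp_assoc (comp_pre (esym (fmor_comp _ _ _))) es fmor_id.
  by rewrite comp_id_l bwdK.
rewrite comp_assoc -mstr_nat -!comp_assoc mstr_bwd_nat -compDr !(comp_pre (esym (fmor_comp _ _ _))).
by rewrite -compDl -fmorD er subrK fmor_id comp_id_l bwdK.
Qed.

(** If [g] kills the image of [f] under [H], the splitting gives [idmor q [▷] g = 0]. The
    epimorphism from [q] to the unit, acted on H m', then cancels and leaves [g = 0]. *)
Lemma modFun_epi m m' (f : mor m m') : epimor f -> epimor (fmor (ufun H) f).
Proof.
have abM := fin_abelian (mod_finite (emod_module exM)).
move=> ef; have [q [e [pq ee]]] := fin_projectives finC unit_ob.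
have [l [i ex]] := epi_short_exact abM ef.
have [r [s /= [_ /split_epi eqf _]]] := act_proj_splits pq ex.
apply: epi_of0 => w g gf.
have qg : idmor q [▷] g = 0 by apply: (epir0 eqf); rewrite -bmor_compr gf bmor_0r.
have een := exact_functor_epi (fin_abelian finC) (mod_exact_r modN (H m')) ee.
apply: (iso_epi (i := munit (H m'))); rewrite comp_0l -munit_nat.
apply: een => /=; rewrite -comp_assoc bmor_rl -bmor_lr qg comp_0l !comp_0r.
by [].
Qed.

End ModuleFunctorExactness.

(** * Internal Homs and free module functors *)

Program Definition act_modFun (k : fieldType) (C : linMon k) (N : modCat C) (n : N) :
    modFun (regMod C) N :=
  @ModFun k C (regMod C) N (bfix_r (cact N) n) (fun x y => massoc x y n) _ _ _.
Next Obligation. by move=> * /=; exact: massoc_nat. Qed.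
Next Obligation. by move=> k C N n x y z /=; rewrite act_pentagon. Qed.
Next Obligation. by move=> k C N n x /=; exact: munit_massoc. Qed.

(** * Universal objects tensored with an object that has a dual *)

Section TwistedUniversality.
Variables (k : fieldType) (C : linMon k) (I : Type) (D : I -> modCat C).
Variables (J : forall i, modFun (regMod C) (D i)).

(** The uniqueness half of a universal property of [W], for families of maps [J i y -> T i]. One
    functor [- ▷ m0] gives the internal Hom; a family indexed by [option M] gives the universal
    covering. *)
Definition joint_mono (T : forall i, D i) (W : C) (w : forall i, mor (J i W) (T i)) :=
  forall y (g h : mor y W),
    (forall i, w i ∘ fmor (ufun (J i)) g = w i ∘ fmor (ufun (J i)) h) -> g = h.

Variables (T : forall i, D i) (W : C) (w : forall i, mor (J i W) (T i)).

Definition twist (v : C) i : mor (J i (v ⊗ W)) (v ▷ T i) :=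
  (idmor v [▷] w i) ∘ mstr (J i) v W.

Section Dual.
Variables (v d : C) (ev : mor (d ⊗ v) unit_ob) (coev : mor unit_ob (v ⊗ d)).
Hypothesis zigzag_v : runit v ∘ (idmor v [⊗] ev) ∘ tassoc v d v ∘ (coev [⊗] idmor v) = lunit v.
Let eps (E : modCat C) (m : E) := act_eps ev m.

Lemma twist_transpose y (g : mor y (v ⊗ W)) i :
  w i ∘ fmor (ufun (J i)) (eps (E := regMod C) W ∘ (idmor d [⊗] g))
  = eps (T i) ∘ (idmor d [▷] (twist v i ∘ fmor (ufun (J i)) g)) ∘ mstr (J i) d y.
Proof.
rewrite /eps fmor_comp.
rewrite -(oplax_eps ev (mstr_nat (J i)) (mstr_pentagon (J i)) (mstr_triangle (J i))).
rewrite comp_assoc comp_assoc act_eps_nat -!comp_assoc (mstr_nat (J i) (idmor d) g).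
by rewrite /twist !bmor_compr -!comp_assoc.
Qed.

(** Duality transposes maps [y -> v ⊗ W] to maps [d ⊗ y -> W], compatibly with evaluation by
    [twist_transpose]. [twist_lift] is the existence half of the same principle. *)
Lemma joint_mono_twist : joint_mono w -> joint_mono (T := fun i => v ▷ T i) (twist v).
Proof.
move=> jm y g h e; apply: (@act_transpose_inj _ _ _ _ _ _ zigzag_v (regMod C)).
by apply: jm => i; rewrite !twist_transpose e.
Qed.

Lemma twist_lift y (t : forall i, mor (J i y) (v ▷ T i)) (h : mor (d ⊗ y) W) :
  (forall i, w i ∘ fmor (ufun (J i)) h = eps (T i) ∘ (idmor d [▷] t i) ∘ mstr (J i) d y) ->
  exists g : mor y (v ⊗ W), forall i, twist v i ∘ fmor (ufun (J i)) g = t i.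
Proof.
move=> e; exists ((idmor v [⊗] h) ∘ act_eta (D := regMod C) coev y) => i.
rewrite fmor_comp /twist -comp_assoc (comp_pre (mstr_nat (J i) (idmor v) h)).
rewrite (comp_assoc (idmor v [▷] w i)) (comp_assoc (idmor v [▷] w i)) -bmor_compr e.
rewrite !bmor_compr -!comp_assoc.
rewrite (oplax_eta coev (mstr_nat (J i)) (mstr_pentagon (J i)) (mstr_triangle (J i))).
by rewrite act_eta_nat comp_assoc (act_zigzag_v zigzag_v) comp_id_l.
Qed.

End Dual.

End TwistedUniversality.

Section InternalHom.
Variables (k : fieldType) (C : linMon k) (M : modCat C) (m0 : M).
Hypotheses (finC : finite_category C) (rigC : rigid C) (modM : module_category M).

(** Exactness of [- ▷ m0] makes Hom(y ▷ m0, m) a left exact contravariant functor of [y], hence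
    representable. *)
Lemma internal_hom_exists m : exists (r : C) (u : mor (r ▷ m0) m),
  forall y (f : mor (y ▷ m0) m), exists! g : mor y r, u ∘ (g [▷] idmor m0) = f.
Proof.
have [p gp] := exists_proj_gen finC; have abC := fin_abelian finC.
have exm0 := mod_exact_r modM m0.
have [d [b hb]] := fin_hom (mod_finite modM) (p ▷ m0) m.
have sp : spanned (mor (p ▷ m0) m) d by exists b.
apply: (@representable _ C finC p gp (fun x => mor (x ▷ m0) m)
  (fun x y f u => u ∘ (f [▷] idmor m0)) _ _ _ _ _ _ d sp).
- by move=> x u; rewrite bmor_id comp_id_r.
- by move=> x y z g f u; rewrite bmor_compl comp_assoc.
- by move=> x y u a f g; rewrite bmor_lin_l comp_lin_r.
- by move=> x y f a u v; rewrite comp_lin_l.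
- by move=> x y e ee u; apply: epir0; exact: (exact_functor_epi abC exm0 ee).
move=> x y z f e ce u fu.
by have [v ev] := cokernel_desc (exact_functor_cokernel abC exm0 ce) fu; exists v.
Qed.

(* [R m] is the internal Hom from [m0] to [m], with evaluation map [u m]. *)
Lemma internal_hom : exists (R : modFun M (regMod C))
    (u : forall m, mor ((ufun R m : C) ▷ m0) m),
  [/\ forall m m' (f : mor m m'), u m' ∘ (fmor (ufun R) f [▷] idmor m0) = f ∘ u m,
      forall x m, (idmor x [▷] u m) ∘ massoc x (ufun R m : C) m0 ∘ (fwd (mstr R x m) [▷] idmor m0)
        = u (x ▷ m)
    & forall (y : C) m (f : mor (y ▷ m0) m),
        exists! g : mor y (ufun R m : C), u m ∘ (g [▷] idmor m0) = f].
Proof.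
have [R hR] := choice internal_hom_exists.
have [u uU] : exists u : forall m, mor (R m ▷ m0) m, forall m (y : C) (f : mor (y ▷ m0) m),
    exists! g : mor y (R m), u m ∘ (g [▷] idmor m0) = f.
  by exists (fun m => sval (cid (hR m))) => m; exact: svalP (cid (hR m)).
have uI m (y : C) (g h : mor y (R m)) :
    u m ∘ (g [▷] idmor m0) = u m ∘ (h [▷] idmor m0) -> g = h.
  by move=> e; have [l [_ ul]] := uU m y (u m ∘ (h [▷] idmor m0)); rewrite -(ul g e) -(ul h erefl).
have uE m (y : C) (f : mor (y ▷ m0) m) : {g : mor y (R m) | u m ∘ (g [▷] idmor m0) = f}.
  by apply: cid; have [g [eg _]] := uU m y f; exists g.
have [Rm RmE] : exists Rm : forall m m', mor m m' -> mor (R m) (R m'),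
    forall m m' (f : mor m m'), u m' ∘ (Rm _ _ f [▷] idmor m0) = f ∘ u m.
  by exists (fun m m' f => sval (uE m' _ (f ∘ u m))) => m m' f; exact: svalP (uE _ _ _).
have R1 m : Rm _ _ (idmor m) = idmor (R m).
  by apply: uI; rewrite RmE bmor_id comp_id_l comp_id_r.
have Rc m1 m2 m3 (g : mor m2 m3) (f : mor m1 m2) : Rm _ _ (g ∘ f) = Rm _ _ g ∘ Rm _ _ f.
  by apply: uI; rewrite RmE bmor_compl comp_assoc RmE -!comp_assoc RmE.
have Rl m m' (a : k) (f g : mor m m') : Rm _ _ (a *: f + g) = a *: Rm _ _ f + Rm _ _ g.
  by apply: uI; rewrite RmE bmor_lin_l comp_lin_l comp_lin_r !RmE.
pose RF := @LinFun k M C R Rm R1 Rc Rl.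
pose J (i : unit) := act_modFun m0.
have jm m : joint_mono (J := J) (T := fun i => m) (W := R m) (fun i => u m).
  by move=> y g h e; apply: uI; exact: (e tt).
have jm1 (x : C) m : joint_mono (J := J) (T := fun=> x ▷ m) (W := x ⊗ R m)
    (twist (J := J) (T := fun=> m) (fun i => u m) x).
  by have [[d [ev [coev [zv _]]]] _] := rigC x; exact: joint_mono_twist zv (jm m).
have jm2 (x y : C) m : joint_mono (J := J) (T := fun=> x ▷ y ▷ m) (W := x ⊗ (y ⊗ R m))
    (twist (J := J) (T := fun=> y ▷ m) (twist (J := J) (T := fun=> m) (fun i => u m) y) x).
  by have [[d [ev [coev [zv _]]]] _] := rigC x; exact: joint_mono_twist zv (jm1 y m).
have s_ex (x : C) m : {s : mor (R (x ▷ m)) (x ⊗ R m) |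
    (idmor x [▷] u m) ∘ massoc x (R m) m0 ∘ (s [▷] idmor m0) = u (x ▷ m)}.
  apply: cid; have [[d [ev [coev [zv _]]]] _] := rigC x.
  have [h eh] := uE m _ (act_eps ev m ∘ (idmor d [▷] u (x ▷ m)) ∘ massoc d (R (x ▷ m)) m0).
  have [|g eg] := @twist_lift _ _ unit (fun=> M) J (fun=> m) (R m) (fun=> u m) x d ev coev zv
    (R (x ▷ m)) (fun=> u (x ▷ m)) h.
    by move=> i; rewrite /= eh.
  by exists g; rewrite comp_assoc; exact: (eg tt).
have [s sE] : exists s : forall (x : C) m, mor (R (x ▷ m)) (x ⊗ R m), forall x m,
    (idmor x [▷] u m) ∘ massoc x (R m) m0 ∘ (s x m [▷] idmor m0) = u (x ▷ m).
  by exists (fun x m => sval (s_ex x m)) => x m; exact: svalP (s_ex x m).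
have s_nat (x x' : C) m m' (f : mor x x') (g : mor m m') :
    s x' m' ∘ Rm _ _ (f [▷] g) = (f [⊗] Rm _ _ g) ∘ s x m.
  apply: (jm1) => -[]; rewrite /twist /= !bmor_compl -!comp_assoc.
  rewrite (comp_pre3 (sE x' m')) RmE.
  rewrite (comp_pre (massoc_nat _ _ _)) -comp_assoc (comp_pre (esym (bmor_comp _ _ _ _ _))).
  have e : f [▷] (g ∘ u m) = (f [▷] g) ∘ (idmor x [▷] u m) by rewrite -bmor_comp comp_id_r.
  by rewrite comp_id_l RmE e -comp_assoc sE.
have s_pent (x y : C) m : tassoc x y (R m) ∘ s (x ⊗ y) m
    = (idmor x [⊗] s y m) ∘ s x (y ▷ m) ∘ Rm _ _ (massoc x y m).
  apply: (jm2) => -[]; rewrite /twist /= !bmor_compl !bmor_compr -!comp_assoc.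
  rewrite (comp_pre3 (act_pentagon x y (R m) m0)) -!comp_assoc.
  rewrite (comp_pre (esym (massoc_natr _ _ _))) -comp_assoc sE.
  have exy := congr1 (bmor (cact M) (idmor x)) (sE y m); rewrite !bmor_compr in exy.
  rewrite (comp_pre (massoc_natm x (s y m) m0)) -!comp_assoc (comp_pre3 exy).
  by rewrite (comp_pre3 (sE x (y ▷ m))) RmE.
have s_tri m : lunit (R m) ∘ s unit_ob m = Rm _ _ (munit m).
  apply: uI; rewrite RmE bmor_compl -munit_massoc -comp_assoc.
  by rewrite (comp_pre (esym (munit_nat _))) -comp_assoc sE.
have s_iso (x : C) m : {i : isomor (R (x ▷ m)) (x ⊗ R m) | fwd i = s x m}.
  exact: isomor_of (@oplax_is_iso _ _ rigC M (regMod C) RF s s_nat s_pent s_tri x m).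
pose RS (x : C) m := sval (s_iso x m).
have RSE x m : fwd (RS x m) = s x m := svalP (s_iso x m).
have RS_nat (x x' : C) (m m' : M) (f : mor x x') (g : mor m m') :
    RS x' m' ∘ Rm _ _ (f [▷] g) = (f [⊗] Rm _ _ g) ∘ RS x m by rewrite !RSE.
have RS_pent (x y : C) m : tassoc x y (R m) ∘ RS (x ⊗ y) m
    = (idmor x [⊗] RS y m) ∘ RS x (y ▷ m) ∘ Rm _ _ (massoc x y m) by rewrite !RSE.
have RS_tri m : lunit (R m) ∘ RS unit_ob m = Rm _ _ (munit m) by rewrite !RSE.
exists (@ModFun k C M (regMod C) RF RS RS_nat RS_pent RS_tri), u; split=> //.
by move=> x m; rewrite /= RSE.
Qed.

End InternalHom.

(** * The left adjoint of evaluation at an object *)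

Section FreeModuleFunctors.
Variables (k : fieldType) (C : linMon k) (M N : modCat C) (m0 : M).
Variables (R : modFun M (regMod C)) (u : forall m, mor ((ufun R m : C) ▷ m0) m).
Hypothesis u_nat : forall m m' (f : mor m m'),
  u m' ∘ (fmor (ufun R) f [▷] idmor m0) = f ∘ u m.
Hypothesis u_str : forall x m,
  (idmor x [▷] u m) ∘ massoc x (ufun R m : C) m0 ∘ (fwd (mstr R x m) [▷] idmor m0) = u (x ▷ m).
Hypothesis u_univ : forall (y : C) m (f : mor (y ▷ m0) m),
  exists! g : mor y (ufun R m : C), u m ∘ (g [▷] idmor m0) = f.
Local Notation Fun := (funCat M N).

(* The free module functor [R(-) ▷ n]: its morphisms to [H] are the morphisms [n -> H m0]. *)
Definition free_modFun (n : N) : Fun := modFun_comp (act_modFun n) R.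

Lemma u_inj y m (g h : mor y (ufun R m : C)) :
  u m ∘ (g [▷] idmor m0) = u m ∘ (h [▷] idmor m0) -> g = h.
Proof.
by move=> e; have [l [_ ul]] := u_univ (u m ∘ (h [▷] idmor m0)); rewrite -(ul g e) -(ul h erefl).
Qed.

Variables (eta : mor unit_ob (ufun R m0 : C)).
Hypothesis eta_u : u m0 ∘ (eta [▷] idmor m0) = munit m0.

(** The triangle identity of the adjunction between [- ▷ m0] and [R]. The unit of the adjunction is
    given at the unit object only, as [eta], and carried to [ufun R m] by the module structure of
    [R]. *)
Lemma free_triangle m :
  fmor (ufun R) (u m) ∘ bwd (mstr R (ufun R m : C) m0) ∘ (idmor (ufun R m : C) [⊗] eta)
  = runit (ufun R m : C).
Proof.
set r : C := ufun R m.
have e1 : u (r ▷ m0) ∘ (bwd (mstr R r m0) [▷] idmor m0)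
    = (idmor r [▷] u m0) ∘ massoc r (ufun R m0 : C) m0.
  by rewrite -u_str -!comp_assoc -bmor_compl bwdK bmor_id comp_id_r.
apply: u_inj; rewrite !bmor_compl comp_assoc u_nat -comp_assoc (comp_pre e1) -comp_assoc.
by rewrite massoc_natm (comp_pre (esym (bmor_compr _ _ _ _))) eta_u act_triangle.
Qed.

Section FreeMap.
Variables (n : N) (H : Fun).

Definition free_map_at (g : mor n (ufun H m0)) m : mor (ufun (free_modFun n) m) (ufun H m) :=
  fmor (ufun H) (u m) ∘ bwd (mstr H (ufun R m : C) m0) ∘ (idmor (ufun R m : C) [▷] g).

Lemma free_map_nat g : @is_modNat k C M N (free_modFun n) H (free_map_at g).
Proof.
split=> [m m' f|x m]; rewrite /free_map_at /=.
  rewrite [RHS]comp_assoc -[fmor _ f ∘ _]fmor_comp -u_nat fmor_comp -!comp_assoc bmor_rl.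
  have e2 := mstr_bwd_nat H (fmor (ufun R) f) (idmor m0); rewrite fmor_id in e2.
  by rewrite (comp_pre (esym e2)) -comp_assoc bmor_lr.
set r : C := ufun R m; rewrite -u_str !fmor_comp -!comp_assoc.
rewrite (comp_pre (mstr_nat H (idmor x) (u m))).
have e : mstr H x (r ▷ m0) ∘ fmor (ufun H) (massoc x r m0) ∘ bwd (mstr H (x ⊗ r) m0)
    = (idmor x [▷] bwd (mstr H r m0)) ∘ massoc x r (ufun H m0).
  apply: (iso_mono (i := bmor_iso (cact N) (iso_id x) (mstr H r m0))).
  rewrite /= (comp_assoc _ (fmor _ _)) (comp_assoc (idmor x [▷] _)) -mstr_pentagon.
  by rewrite -comp_assoc bwdK comp_id_r comp_assoc act_bwdK comp_id_l.
have e2 := mstr_bwd_nat H (fwd (mstr R x m)) (idmor m0); rewrite fmor_id in e2.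
rewrite (comp_pre (esym e2)) -!comp_assoc (comp_pre3 e) !bmor_compr -!comp_assoc; congr (_ ∘ _ ∘ _).
by rewrite (comp_pre (esym (massoc_natr _ _ _))) -comp_assoc bmor_lr bmor_rl.
Qed.

Definition free_map g : mor (free_modFun n) H := mkNat (free_map_nat g).

Definition free_val (t : mor (free_modFun n) H) : mor n (ufun H m0) :=
  comp_at t m0 ∘ (eta [▷] idmor n) ∘ bwd (munit n).

Lemma free_mapK g : free_val (free_map g) = g.
Proof.
rewrite /free_val /comp_at /= /free_map_at -!comp_assoc.
rewrite (comp_pre (bmor_rl _ _ _)) -bmor_lr.
have e2 := mstr_bwd_nat H eta (idmor m0); rewrite fmor_id in e2.
rewrite -!comp_assoc (comp_pre e2) -!comp_assoc (comp_pre (esym (fmor_comp _ _ _))) eta_u.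
rewrite -mstr_triangle -!comp_assoc (comp_pre (bwdK _)) comp_id_l (comp_pre (munit_nat _)).
by rewrite -comp_assoc bwdK comp_id_r.
Qed.

Lemma free_valK t : free_map (free_val t) = t.
Proof.
apply: natP => m; rewrite /comp_at /= /free_map_at /free_val !bmor_compr.
set r : C := ufun R m.
have e : fmor (ufun H) (u m) ∘ bwd (mstr H r m0) ∘ (idmor r [▷] comp_at t m0)
    = comp_at t m ∘ ((fmor (ufun R) (u m) ∘ bwd (mstr R r m0)) [▷] idmor n)
       ∘ bwd (massoc r (ufun R m0 : C) n).
  have es : bwd (mstr H r m0) ∘ (idmor r [▷] comp_at t m0)
      = comp_at t (r ▷ m0) ∘ bwd (mstr (free_modFun n : modFun M N) r m0).
    apply: (iso_mono (i := mstr H r m0)); rewrite comp_assoc bwdK comp_id_l [RHS]comp_assoc comp_at_str.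
    exact/esym/comp_bwdK.
  rewrite es comp_assoc -comp_at_nat /= -!comp_assoc; congr (_ ∘ _).
  by rewrite bmor_compl -!comp_assoc.
rewrite (comp_pre3 e) -!comp_assoc.
have en : bwd (massoc r (ufun R m0 : C) n) ∘ (idmor r [▷] (eta [▷] idmor n))
    = ((idmor r [⊗] eta) [▷] idmor n) ∘ bwd (massoc r unit_ob n).
  apply: (iso_mono (i := massoc r (ufun R m0 : C) n)); apply: (iso_epi (i := massoc r unit_ob n)).
  by rewrite -!comp_assoc fwdK comp_id_r (comp_pre (bwdK _)) comp_id_l massoc_natm.
rewrite (comp_pre en) -!comp_assoc (comp_pre (esym (bmor_compl _ _ _ _))) -comp_assoc.
rewrite free_triangle -act_triangle -!comp_assoc (comp_pre (bwdK _)) comp_id_l.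
by rewrite act_bwdK comp_id_r.
Qed.

End FreeMap.

Lemma free_val_nat n (H H' : Fun) (a : mor H H') (t : mor (free_modFun n) H) :
  free_val (a ∘ t) = comp_at a m0 ∘ free_val t.
Proof. by rewrite /free_val comp_at_comp -!comp_assoc. Qed.

Hypotheses (abN : abelian_cat N) (exN : forall x : C, exact_functor (bfix_l (cact N) x)).

Lemma free_modFun_projective n : projective_ob n -> projective_ob (free_modFun n).
Proof.
move=> pn H H' a t ea; have em : epimor (comp_at a m0) by exact: fun_epi_at.
have [g eg] := proj_lift (free_val t) pn em; exists (free_map g).
by rewrite -[RHS]free_valK -eg -[LHS]free_valK free_val_nat free_mapK.
Qed.

End FreeModuleFunctors.

(** * Finiteness of the category of module functors *)

Section FunctorCategoryFinite.
Variables (k : fieldType) (C : linMon k) (M N : modCat C).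
Hypotheses (finC : finite_category C) (rigC : rigid C).
Hypotheses (exM : exact_module_category M) (modN : module_category N).
Let finM := mod_finite (emod_module exM).
Let finN := mod_finite modN.
Let abN := fin_abelian finN.
Let exN := mod_exact_l modN.
Local Notation Fun := (funCat M N).

Lemma fun_abelian : abelian_cat Fun.
Proof.
split.
- have [z /zero_id zz] := has_zero abN.
  have to0 (w : N) (f g : mor w z) : f = g.
    by rewrite -(comp_id_l f) -(comp_id_l g) zz !comp_0l.
  have ito0 (x : C) (w : N) (f g : mor w (x ▷ z)) : f = g.
    have e : idmor (x ▷ z) = 0 by rewrite -(bmor_id (cact N)) zz bmor_0r.
    by rewrite -(comp_id_l f) -(comp_id_l g) e !comp_0l.
  pose Z := @sub_modFun k C M N void (fun b => match b with end) (fun=> z)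
    (fun b => match b with end) (fun m w g h _ => to0 w g h) (fun x m w g h _ => ito0 x w g h)
    (fun _ _ _ => 0) (fun x m => Isomor (to0 _ (0 ∘ 0) _) (ito0 x _ (0 ∘ 0) _))
    (fun b => match b with end) (fun b => match b with end).
  by exists (Z : Fun); apply/zero_id/natP0 => m; exact: to0.
- move=> F G.
  have [S hS] := choice (fun m => has_biproducts abN (ufun F m) (ufun G m)).
  have [i [j [p [q dec]]]] : exists (i : forall m, mor (ufun F m) (S m))
      (j : forall m, mor (ufun G m) (S m)) (p : forall m, mor (S m) (ufun F m))
      (q : forall m, mor (S m) (ufun G m)), forall m,
      [/\ p m ∘ i m = idmor _, q m ∘ j m = idmor _, p m ∘ j m = 0, q m ∘ i m = 0
        & i m ∘ p m + j m ∘ q m = idmor (S m)].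
    pose h1 m := cid (hS m); pose h2 m := cid (svalP (h1 m)).
    pose h3 m := cid (svalP (h2 m)); pose h4 m := cid (svalP (h3 m)).
    exists (fun m => sval (h1 m)), (fun m => sval (h2 m)), (fun m => sval (h3 m)),
      (fun m => sval (h4 m)) => m; exact: svalP (h4 m).
  pose FG (b : bool) : modFun M N := if b then F else G.
  pose ka (b : bool) m : mor (S m) (ufun (FG b) m) :=
    match b return mor (S m) (ufun (FG b) m) with true => p m | false => q m end.
  have ka_mono m w (g h : mor w (S m)) : (forall b, ka b m ∘ g = ka b m ∘ h) -> g = h.
    move=> e; have [_ _ _ _ d] := dec m; rewrite -(comp_id_l g) -(comp_id_l h) -d !compDl.
    by rewrite -!comp_assoc (e true) (e false).
  have act_mono (x : C) m w (g h : mor w (x ▷ S m)) :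
      (forall b, (idmor x [▷] ka b m) ∘ g = (idmor x [▷] ka b m) ∘ h) -> g = h.
    move=> e; have [_ _ _ _ d] := dec m.
    rewrite -(comp_id_l g) -(comp_id_l h) -(bmor_id (cact N)) -d.
    have -> : idmor x [▷] (i m ∘ p m + j m ∘ q m)
        = (idmor x [▷] i m) ∘ (idmor x [▷] p m) + (idmor x [▷] j m) ∘ (idmor x [▷] q m).
      by rewrite -!bmor_compr; exact: (lin_mapD (fun a u v => bmor_lin_r (cact N) a (idmor x) u v)).
    by rewrite !compDl -!comp_assoc (e true) (e false).
  have actD (x : C) (a b : N) (f g : mor a b) : idmor x [▷] (f + g) = (idmor x [▷] f) + (idmor x [▷] g).
    exact: (lin_mapD (fun a u v => bmor_lin_r (cact N) a (idmor x) u v)).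
  pose Km m m' (f : mor m m') : mor (S m) (S m') :=
    i m' ∘ fmor (ufun F) f ∘ p m + j m' ∘ fmor (ufun G) f ∘ q m.
  have KmE b m m' (f : mor m m') : ka b m' ∘ Km _ _ f = fmor (ufun (FG b)) f ∘ ka b m.
    have [pi qj pj qi d] := dec m'.
    by case: b; rewrite /Km /= compDr !comp_assoc ?pi ?qi ?pj ?qj !comp_0l ?comp_id_l ?addr0 ?add0r.
  pose s1 (x : C) m : mor (S (x ▷ m)) (x ▷ S m) :=
    (idmor x [▷] i m) ∘ mstr F x m ∘ p (x ▷ m) + (idmor x [▷] j m) ∘ mstr G x m ∘ q (x ▷ m).
  pose s2 (x : C) m : mor (x ▷ S m) (S (x ▷ m)) :=
    i (x ▷ m) ∘ bwd (mstr F x m) ∘ (idmor x [▷] p m)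
    + j (x ▷ m) ∘ bwd (mstr G x m) ∘ (idmor x [▷] q m).
  have s1E b (x : C) m : (idmor x [▷] ka b m) ∘ s1 x m = mstr (FG b) x m ∘ ka b (x ▷ m).
    have [pi qj pj qi d] := dec m.
    by case: b; rewrite /s1 /= compDr !comp_assoc -!bmor_compr ?pi ?qi ?pj ?qj bmor_id bmor_0r
      !comp_0l comp_id_l ?addr0 ?add0r.
  have s2E b (x : C) m : ka b (x ▷ m) ∘ s2 x m = bwd (mstr (FG b) x m) ∘ (idmor x [▷] ka b m).
    have [pi qj pj qi d] := dec (x ▷ m).
    by case: b; rewrite /s2 /= compDr !comp_assoc ?pi ?qi ?pj ?qj !comp_0l comp_id_l ?addr0 ?add0r.
  have s21 x m : s2 x m ∘ s1 x m = idmor _.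
    apply: ka_mono => b; rewrite comp_assoc s2E -comp_assoc s1E comp_assoc fwdK.
    by rewrite comp_id_l comp_id_r.
  have s12 x m : s1 x m ∘ s2 x m = idmor _.
    apply: act_mono => b; rewrite comp_assoc s1E -comp_assoc s2E comp_assoc bwdK.
    by rewrite comp_id_l comp_id_r.
  pose H := @sub_modFun k C M N bool FG S ka ka_mono act_mono Km
    (fun x m => Isomor (s21 x m) (s12 x m)) KmE s1E.
  pose P b : mor (H : Fun) (FG b) := mkNat (@sub_modFun_nat k C M N bool FG S ka ka_mono act_mono Km
    (fun x m => Isomor (s21 x m) (s12 x m)) KmE s1E b).
  have lift (L : Fun) (t : forall m, mor (ufun L m) (S m)) :
      (forall b, is_modNat (fun m => ka b m ∘ t m)) -> @is_modNat k C M N L H t.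
    exact: sub_modFun_lift.
  have idN (L : Fun) (t : forall m, mor (ufun L m) (ufun L m)) :
      (forall m, t m = idmor _) -> @is_modNat k C M N L L t.
    by move=> e; split=> *; rewrite !e ?bmor_id comp_id_l comp_id_r.
  have zeroN (L L' : Fun) (t : forall m, mor (ufun L m) (ufun L' m)) :
      (forall m, t m = 0) -> @is_modNat k C M N L L' t.
    by move=> e; split=> *; rewrite !e ?bmor_0r comp_0l comp_0r.
  have iN : @is_modNat k C M N F H i.
    by apply: (lift F) => -[]; [apply: (idN F) | apply: (zeroN F G)] => m; have [] := dec m.
  have jN : @is_modNat k C M N G H j.
    by apply: (lift G) => -[]; [apply: (zeroN G F) | apply: (idN G)] => m; have [] := dec m.
  exists (H : Fun), (mkNat iN), (mkNat jN), (P true), (P false).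
  by split; apply: natP => m; have [] := dec m.
- by move=> F G e; have [H [i ki]] := fun_kernel abN exN e; exists H, i; exact: pointwise_kernel ki.
- by move=> F G e; have [H [i ki]] := fun_cokernel abN exN e; exists H, i; exact: pointwise_cokernel ki.
- move=> F G i mi; have [H [p cp]] := fun_cokernel abN exN i; exists H, p.
  apply: pointwise_kernel => // m; apply: mono_kernel_coker (cp m) => //.
  exact: fun_mono_at.
- move=> F G p ep; have [H [i ki]] := fun_kernel abN exN p; exists H, i.
  apply: pointwise_cokernel => // m; apply: epi_cokernel_ker (ki m) => //.
  exact: fun_epi_at.
Qed.

(** Vanishing at [m0] passes to biproducts, hence to a cover [q] of any [m]. It descends from [q] to
    [m] because [F] preserves the covering epimorphism. *)
Lemma fun_at_faithful (m0 : M) (F G : Fun) (e : mor F G) :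
  proj_gen m0 -> comp_at e m0 = 0 -> e = 0.
Proof.
move=> gm0 e0; apply: natP0 => m.
have [|||q eq [f ef]] := gen_epi finM gm0 (G := fun m => comp_at e m = 0) _ _ _ m.
- by [].
- move=> z zz; have [_ h] := fmor_zero (ufun F) zz (fob (ufun G) z); exact: h.
- move=> x y t [i [j [p [q [_ _ _ _ dec]]]]] ex ey.
  rewrite -(comp_id_r (comp_at e t)) -fmor_id -dec fmorD compDr !fmor_comp !comp_assoc.
  by rewrite !comp_at_nat ex ey !comp_0r !comp_0l addr0.
have Ff := modFun_epi (H := F) finC exM modN ef.
by apply: (epir0 Ff); rewrite comp_at_nat eq comp_0r.
Qed.

(** Induction on a bound for the dimension of Hom(n0, F m0). A functor neither zero nor simple has a
    proper nonzero subobject. For this subobject and for its quotient the bound drops strictly,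
    since evaluation at [m0] is faithful. *)
Lemma fun_length (m0 : M) (n0 : N) (F : Fun) n : proj_gen m0 -> proj_gen n0 ->
  spanned (mor n0 (ufun F m0)) n -> finite_length F.
Proof.
move=> gm0 gn0; have [d] := ubnP n; elim: d n F => // d IH n F nd sp.
have abF := fun_abelian.
case: (pselect (is_zero F)) => [|nz]; first exact: finite_length_zero.
case: (pselect (simple_ob F)) => [sF|nsF]; first exact: finite_length_simple.
have /existsNP[K /existsNP[i /not_implyP[mi /not_orP[nzK niso]]]] :
    ~ forall K (i : mor K F), monomor i -> is_zero K \/ is_iso i.
  by move=> h; apply: nsF.
have [Q [p ex]] := mono_short_exact abF mi; have [ki cp] := ex.
have sub_lt : exists2 m, (m < n)%N & spanned (mor n0 (ufun K m0)) m.
  apply: (gen_sub_lt finN gn0 (i := comp_at i m0)) sp => //.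
    by move=> *; exact: (fun_mono_at abN exN mi).
  move=> ei; apply: niso; apply: mono_epi_iso => //; apply: epi_of0 => L g gi.
  apply: (fun_at_faithful gm0); apply: (epir0 ei).
  by rewrite -comp_at_comp gi.
have quot_lt : exists2 m, (m < n)%N & spanned (mor n0 (ufun Q m0)) m.
  apply: (gen_quot_lt finN gn0 (e := comp_at p m0)) sp.
    exact: (fun_epi_at abN exN (cokernel_epi cp)).
  move=> mp; apply: nzK; apply/zero_id; apply: mi; rewrite comp_id_r comp_0r.
  apply: (fun_at_faithful gm0); apply: (monor0 mp).
  by rewrite -comp_at_comp (proj1 ki).
have lt_d m : (m < n)%N -> (m < d)%N by move=> lt; apply: leq_trans lt _.
have [m1 /lt_d lt1 sp1] := sub_lt; have [m2 /lt_d lt2 sp2] := quot_lt.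
exact: finite_length_exact abF _ _ _ _ _ ex (IH _ _ lt1 sp1) (IH _ _ lt2 sp2).
Qed.

Lemma fun_finite : finite_category Fun.
Proof.
have abF := fun_abelian.
have [m0 gm0] := exists_proj_gen finM; have [n0 gn0] := exists_proj_gen finN.
have [R [u [u_nat u_str u_univ]]] := internal_hom m0 finC rigC (emod_module exM).
have [eta [eta_u _]] := u_univ _ _ (fwd (munit m0)).
have fl (F : Fun) : finite_length F.
  have [d [b hb]] := fin_hom finN n0 (ufun F m0).
  by apply: (@fun_length m0 n0 F d) => //; exists b.
split=> //.
- move=> F G; have [d [b hb]] := fin_hom finN (ufun F m0) (ufun G m0).
  have [] := @spanned_sub _ (mor F G) _ (fun e : mor F G => comp_at e m0) d.
  + by [].
  + move=> e e' ee'; apply/subr0_eq/(fun_at_faithful gm0).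
    have lin := @comp_at_lin _ _ _ _ F G m0.
    by rewrite (lin_mapB lin) ee' subrr.
  + by exists b.
  by move=> m _ [c hc]; exists m, c.
- move=> F; have [n [g [pn eg]]] := fin_projectives finN (ufun F m0).
  exists (free_modFun R n), (free_map u_nat u_str g); split.
    exact: (free_modFun_projective u_nat u_str u_univ eta_u abN exN pn).
  apply: epi_of0 => L c ce; apply: (fun_at_faithful gm0); apply: (epir0 eg).
  rewrite -(free_mapK u_nat u_str eta_u g) -free_val_nat ce /free_val.
  by rewrite (_ : comp_at 0 m0 = 0) // comp_0l.
(* Every simple [H] has [ufun H m0] nonzero, hence a nonzero map from [n0] to it and so, by
   adjunction, from the free functor on [n0]. The simple functors are therefore among the finitely
   many simple quotients of that one functor. *)
have [d [s hs]] := simple_quotients abF (fl (free_modFun R n0)).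
exists d, s => H sH.
have [g g0] : exists g : mor n0 (ufun H m0), g <> 0.
  apply: contrapT => h; case: sH => nz _; apply: nz; apply/zero_id.
  apply: (fun_at_faithful gm0); apply: (gen_faithful finN gn0) => g.
  apply: contrapT => g0; apply: h; exists g => ge.
  by apply: g0; rewrite ge comp_0r.
apply: (hs _ (free_map u_nat u_str g) sH) => e0; apply: g0.
rewrite -(free_mapK u_nat u_str eta_u g) e0 /free_val (_ : comp_at 0 m0 = 0) //.
by rewrite comp_0l.
Qed.

End FunctorCategoryFinite.

(** * Exactness of the action of the center *)

Section CenterExactness.
Variables (k : fieldType) (C : linMon k).
Hypotheses (abC : abelian_cat C) (rigC : rigid C).
Implicit Types z w v : centerCat C.

Definition under z w (f : mor z w) : mor (cob z) (cob w) := subval f.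

Definition mkCentral (z w : center_ob C) (f : mor (cob z) (cob w)) (cf : is_central f) :
  @mor k (centerCat C) z w := mkSub (central_closed z w) cf.

Lemma under_central z w (f : mor z w) : @is_central k C z w (under f).
Proof. exact: subspaceP f. Qed.

Lemma centralP z w (f g : mor z w) : under f = under g -> f = g.
Proof. exact: subspace_eq. Qed.

Lemma tens_kernel_l (x y a b : C) (f : mor y a) (i : mor b y) : is_kernel f i ->
  is_kernel (idmor x [⊗] f) (idmor x [⊗] i).
Proof. by move=> h; exact: (exact_functor_kernel abC (rigid_tens_exact_l rigC x) h). Qed.

Lemma tens_kernel_r (x y a b : C) (f : mor y a) (i : mor b y) : is_kernel f i ->
  is_kernel (f [⊗] idmor x) (i [⊗] idmor x).
Proof. by move=> h; exact: (@exact_functor_kernel k C C (bfix_r (tens C) x) abC (@rigid_tens_exact_r _ _ x rigC) _ _ _ _ _ h). Qed.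

Lemma tens_cokernel_l (x y a b : C) (f : mor y a) (i : mor a b) : is_cokernel f i ->
  is_cokernel (idmor x [⊗] f) (idmor x [⊗] i).
Proof. by move=> h; exact: (exact_functor_cokernel abC (rigid_tens_exact_l rigC x) h). Qed.

Lemma tens_cokernel_r (x y a b : C) (f : mor y a) (i : mor a b) : is_cokernel f i ->
  is_cokernel (f [⊗] idmor x) (i [⊗] idmor x).
Proof. by move=> h; exact: (@exact_functor_cokernel k C C (bfix_r (tens C) x) abC (@rigid_tens_exact_r _ _ x rigC) _ _ _ _ _ h). Qed.

Lemma under_mono z w (f : mor z w) : monomor (under f) -> monomor f.
Proof. by move=> mf v g h e; apply/centralP/mf; exact: (congr1 (@under _ _) e). Qed.

Lemma under_epi z w (f : mor z w) : epimor (under f) -> epimor f.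
Proof. by move=> mf v g h e; apply/centralP/mf; exact: (congr1 (@under _ _) e). Qed.

Lemma under_kernel z w v (f : mor z w) (i : mor v z) :
  is_kernel (under f) (under i) -> is_kernel f i.
Proof.
move=> ki; apply: mk_kernel.
- by apply: centralP; exact: proj1 ki.
- by apply: under_mono; exact: kernel_mono ki.
move=> y g fg; have [|h eh] := kernel_lift ki (g := under g).
  exact: (congr1 (@under _ _) fg).
suff ch : @is_central k C y v h by exists (mkCentral ch); exact: centralP.
move=> x; apply: (kernel_mono (tens_kernel_l x ki)).
rewrite comp_assoc -(under_central i x) -comp_assoc -bmor_compl eh.
by rewrite comp_assoc -bmor_compr eh; exact: (under_central g x).
Qed.

Lemma under_cokernel z w v (f : mor z w) (p : mor w v) :
  is_cokernel (under f) (under p) -> is_cokernel f p.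
Proof.
move=> cp; apply: mk_cokernel.
- by apply: centralP; exact: proj1 cp.
- by apply: under_epi; exact: cokernel_epi cp.
move=> y g fg; have [|h eh] := cokernel_desc cp (g := under g).
  exact: (congr1 (@under _ _) fg).
suff ch : @is_central k C v y h by exists (mkCentral ch); exact: centralP.
move=> x; apply: (cokernel_epi (tens_cokernel_r x cp)).
rewrite -!comp_assoc (under_central p x) [RHS]comp_assoc -bmor_compr eh -bmor_compl eh.
exact: (under_central g x).
Qed.

(** The forgetful functor creates kernels: by rigidity, tensoring on either side is exact, so the
    half-braiding of [z] restricts to an isomorphism on the kernel, and its axioms are tested after
    the inclusion. *)
Lemma center_kernel z w (f : mor z w) : exists v (i : mor v z), is_kernel (under f) (under i).
Proof.
have [K [ka kK]] := has_kernels abC (under f).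
have br_ex x : {b : isomor (K ⊗ x) (x ⊗ K) | (idmor x [⊗] ka) ∘ b = cbr z x ∘ (ka [⊗] idmor x)}.
  apply: (kernel_transport (tens_kernel_r x kK) (tens_kernel_l x kK) (t := cbr w x)).
  by rewrite (under_central f x).
have [b bE] : exists b : forall x, isomor (K ⊗ x) (x ⊗ K),
    forall x, (idmor x [⊗] ka) ∘ b x = cbr z x ∘ (ka [⊗] idmor x).
  by exists (fun x => sval (br_ex x)) => x; exact: svalP (br_ex x).
have mon x := kernel_mono (tens_kernel_l x kK).
have b_nat x x' (g : mor x x') : b x' ∘ (idmor K [⊗] g) = (g [⊗] idmor K) ∘ b x.
  apply: (mon x'); rewrite comp_assoc bE -comp_assoc bmor_lr -bmor_rl comp_assoc cbr_nat.
  by rewrite -comp_assoc -bE !comp_assoc bmor_lr bmor_rl.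
have b_hex x y : tassoc x y K ∘ b (x ⊗ y) ∘ tassoc K x y
    = (idmor x [⊗] b y) ∘ tassoc x K y ∘ (b x [⊗] idmor y).
  apply: (kernel_mono (tens_kernel_l x (tens_kernel_l y kK))).
  rewrite comp_assoc -tassoc_nat bmor_id -comp_assoc (comp_pre (bE _)).
  have e1 : (ka [⊗] idmor (x ⊗ y)) ∘ tassoc K x y
      = tassoc (z : C) x y ∘ ((ka [⊗] idmor x) [⊗] idmor y) by rewrite tassoc_nat bmor_id.
  rewrite -!comp_assoc e1 (comp_pre3 (cbr_hexagon z x y)) -!comp_assoc -bmor_compl -bE bmor_compl.
  rewrite (comp_pre (tassoc_nat _ _ _)) -!comp_assoc.
  by rewrite !(comp_pre (esym (bmor_compr _ _ _ _))) bE.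
have ck : @is_central k C (Center b_nat b_hex) z ka by move=> x; rewrite bE.
by exists (Center b_nat b_hex), (mkCentral ck).
Qed.

Lemma center_cokernel z w (f : mor z w) : exists v (p : mor w v), is_cokernel (under f) (under p).
Proof.
have [K [ka kK]] := has_cokernels abC (under f).
have br_ex x : {b : isomor (K ⊗ x) (x ⊗ K) | b ∘ (ka [⊗] idmor x) = (idmor x [⊗] ka) ∘ cbr w x}.
  apply: (cokernel_transport (tens_cokernel_r x kK) (tens_cokernel_l x kK) (t := cbr z x)).
  by rewrite (under_central f x).
have [b bE] : exists b : forall x, isomor (K ⊗ x) (x ⊗ K),
    forall x, b x ∘ (ka [⊗] idmor x) = (idmor x [⊗] ka) ∘ cbr w x.
  by exists (fun x => sval (br_ex x)) => x; exact: svalP (br_ex x).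
have ep x := cokernel_epi (tens_cokernel_r x kK).
have b_nat x x' (g : mor x x') : b x' ∘ (idmor K [⊗] g) = (g [⊗] idmor K) ∘ b x.
  apply: (ep x); rewrite -!comp_assoc bmor_rl bE -bmor_lr comp_assoc bE -comp_assoc cbr_nat.
  by rewrite !comp_assoc bmor_lr bmor_rl.
have b_hex x y : tassoc x y K ∘ b (x ⊗ y) ∘ tassoc K x y
    = (idmor x [⊗] b y) ∘ tassoc x K y ∘ (b x [⊗] idmor y).
  apply: (cokernel_epi (tens_cokernel_r y (tens_cokernel_r x kK))).
  rewrite -!comp_assoc -bmor_compl bE tassoc_nat bmor_id (comp_pre (bE _)) -comp_assoc.
  rewrite bmor_compl (comp_pre (tassoc_nat _ _ _)) -!comp_assoc.
  rewrite (comp_pre (esym (bmor_compr _ _ _ _))) bE bmor_compr -!comp_assoc.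
  by rewrite -cbr_hexagon -(bmor_id (tens C) x y) (comp_pre (tassoc_nat _ _ _)) -comp_assoc.
have ck : @is_central k C w (Center b_nat b_hex) ka by move=> x; rewrite bE.
by exists (Center b_nat b_hex), (mkCentral ck).
Qed.

Lemma under_iso z w (s : isomor z w) :
  {t : isomor (cob z) (cob w) | fwd t = under (fwd s)}.
Proof.
have e1 : under (bwd s) ∘ under (fwd s) = idmor _ by exact: (congr1 (@under _ _) (fwdK s)).
have e2 : under (fwd s) ∘ under (bwd s) = idmor _ by exact: (congr1 (@under _ _) (bwdK s)).
by exists (Isomor e1 e2).
Qed.

Lemma under_exact z w v (i : mor z w) (p : mor w v) :
  short_exact i p -> short_exact (under i) (under p).
Proof.
case=> ki cp; split.
  have [K [j kj]] := center_kernel p; have [s es] := kernel_unique ki (under_kernel kj).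
  have [t et] := under_iso s; have -> : under i = under j ∘ t by rewrite et -es.
  exact: kernel_iso_src.
have [K [q cq]] := center_cokernel i; have [s es] := cokernel_unique (under_cokernel cq) cp.
have [t et] := under_iso s; have -> : under p = t ∘ under q by rewrite et -es.
exact: cokernel_iso_tgt.
Qed.

End CenterExactness.

Section FunctorModuleCategoryExact.
Variables (k : fieldType) (C : linMon k) (M N : modCat C).
Hypotheses (finC : finite_category C) (rigC : rigid C).
Hypotheses (exM : exact_module_category M) (modN : module_category N).

Lemma fun_module_category : module_category (fun_modCat M N).
Proof.
have abN := fin_abelian (mod_finite modN); have exN := mod_exact_l modN.
have funE := fun_exactE (M := M) abN exN.
split; first exact: fun_finite.
- move=> z F G H i p /funE ex; apply/funE => m; exact: (exN (cob z) _ _ _ _ _ (ex m)).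
move=> H z w v i p /(under_exact (fin_abelian finC) rigC) ex; apply/funE => m.
exact: (mod_exact_r modN (ufun H m) ex).
Qed.

End FunctorModuleCategoryExact.

(** * Projective objects of the center *)

(** The unit law of a half-braiding, read off from the unit law of the module functor [z ⊗ -] on
    [C], evaluated at the unit object. *)
Lemma cbr_unit (k : fieldType) (C : linMon k) (z : center_ob C) :
  lunit (cob z) ∘ cbr z unit_ob = runit (cob z).
Proof.
apply: tens_unit_inj.
set s := fwd (strength (cbr z) (N := regMod C) unit_ob (unit_ob : C)).
have e : lunit (cob z ⊗ unit_ob) ∘ s = idmor (cob z) [⊗] lunit (unit_ob : C).
  exact: (mstr_triangle (center_act (regMod C) z) (unit_ob : C)).
have el : lunit (cob z ⊗ unit_ob) ∘ tassoc unit_ob (cob z) unit_ob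
    = lunit (cob z) [⊗] idmor (unit_ob : C).
  exact: (munit_massoc (N := regMod C) (cob z) (unit_ob : C)).
have ec : s ∘ tassoc (cob z) unit_ob unit_ob
    = tassoc unit_ob (cob z) unit_ob ∘ (cbr z unit_ob [⊗] idmor (unit_ob : C)).
  exact: (strength_massoc (cbr z) (N := regMod C) unit_ob (unit_ob : C)).
rewrite bmor_compl -el -comp_assoc -ec (comp_pre e).
exact: tens_triangle.
Qed.

(** * Half-braidings not assumed invertible *)

Section LaxHalfBraiding.
Variables (k : fieldType) (C : linMon k) (W : C).
Hypothesis rigC : rigid C.
Variable c : forall x, mor (W ⊗ x) (x ⊗ W).
Hypothesis c_nat : forall x x' (f : mor x x'),
  c x' ∘ (idmor W [⊗] f) = (f [⊗] idmor W) ∘ c x.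
Hypothesis c_hex : forall x y, tassoc x y W ∘ c (x ⊗ y) ∘ tassoc W x y
  = (idmor x [⊗] c y) ∘ tassoc x W y ∘ (c x [⊗] idmor y).
Hypothesis c_unit : lunit W ∘ c unit_ob = runit W.

Section Strength.
Variable N : modCat C.
Let T := bfix_l (cact N) W.

Definition lax_strength x (m : N) : mor (W ▷ x ▷ m) (x ▷ W ▷ m) :=
  locked (massoc x W m ∘ (c x [▷] idmor m) ∘ bwd (massoc W x m)).

Lemma lax_strength_massoc x m :
  lax_strength x m ∘ massoc W x m = massoc x W m ∘ (c x [▷] idmor m).
Proof. by rewrite /lax_strength -lock -!comp_assoc fwdK comp_id_r. Qed.

Lemma lax_strength_nat x x' m m' (f : mor x x') (g : mor m m') :
  lax_strength x' m' ∘ fmor T (f [▷] g) = (f [▷] fmor T g) ∘ lax_strength x m.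
Proof.
apply: (iso_epi (i := massoc W x m)).
rewrite -!comp_assoc lax_strength_massoc /= -massoc_nat (comp_pre (lax_strength_massoc _ _)).
rewrite (comp_pre (esym (massoc_nat _ _ _))) -!comp_assoc -!bmor_comp.
by rewrite c_nat comp_id_l comp_id_r.
Qed.

Lemma lax_strength_pentagon x y m :
  massoc x y (fob T m) ∘ lax_strength (x ⊗ y) m
  = (idmor x [▷] lax_strength y m) ∘ lax_strength x (y ▷ m) ∘ fmor T (massoc x y m).
Proof.
apply: (iso_epi (i := massoc W (x ⊗ y) m)).
apply: (iso_epi (i := bmor_iso (cact N) (tassoc W x y) (iso_id m))) => /=.
transitivity ((idmor x [▷] massoc y W m) ∘ massoc x (y ⊗ W) m
    ∘ ((tassoc x y W ∘ c (x ⊗ y) ∘ tassoc W x y) [▷] idmor m)).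
  rewrite -!comp_assoc (comp_pre (lax_strength_massoc _ _)) -!comp_assoc.
  by rewrite (comp_pre (esym (act_pentagon _ _ _ _))) -!comp_assoc !bmor_compl.
rewrite c_hex -!comp_assoc act_pentagon (comp_pre (lax_strength_massoc _ _)) -!comp_assoc.
rewrite -massoc_natl (comp_pre (esym (act_pentagon _ _ _ _))) -!comp_assoc.
rewrite (comp_pre (esym (bmor_compr _ _ _ _))) lax_strength_massoc bmor_compr -!comp_assoc.
by rewrite (comp_pre (esym (massoc_natm _ _ _))) !bmor_compl -!comp_assoc.
Qed.

Lemma lax_strength_triangle m : munit (fob T m) ∘ lax_strength unit_ob m = fmor T (munit m).
Proof.
apply: (iso_epi (i := massoc W unit_ob m)); rewrite -comp_assoc lax_strength_massoc /=.
by rewrite (comp_pre (munit_massoc _ _)) -bmor_compl c_unit act_triangle.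
Qed.

End Strength.

(** The strength that [c] induces on the regular module is an oplax structure on [W ⊗ -], which
    duals invert. At the unit object it is [c x] tensored with the unit, up to associators, and
    [c x] is recovered from that. The unit law is what excludes [c = 0], which satisfies naturality
    and the hexagon. *)
Lemma lax_braiding_iso x : is_iso (c x).
Proof.
have [t [e1 e2]] := oplax_is_iso rigC (@lax_strength_nat (regMod C))
  (@lax_strength_pentagon (regMod C)) (@lax_strength_triangle (regMod C)) x (unit_ob : C).
rewrite /= in t e1 e2; set s := lax_strength _ _ in e1 e2.
have ec : s ∘ tassoc W x unit_ob = tassoc x W unit_ob ∘ (c x [⊗] idmor unit_ob).
  exact: (@lax_strength_massoc (regMod C) x (unit_ob : C)).
pose cu := c x [⊗] idmor (unit_ob : C).
have cuE : cu = bwd (tassoc x W unit_ob) ∘ s ∘ tassoc W x unit_ob.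
  by rewrite ec comp_assoc fwdK comp_id_l.
pose d := bwd (tassoc W x unit_ob) ∘ t ∘ tassoc x W unit_ob.
have dcu : d ∘ cu = idmor _.
  rewrite cuE /d -!comp_assoc (comp_pre (bwdK _)) comp_id_l (comp_pre e1) comp_id_l.
  exact: fwdK.
have cud : cu ∘ d = idmor _.
  rewrite cuE /d -!comp_assoc (comp_pre (bwdK _)) comp_id_l (comp_pre e2) comp_id_l.
  exact: fwdK.
have cE : c x = runit (x ⊗ W) ∘ cu ∘ bwd (runit (W ⊗ x)).
  by rewrite (comp_pre (runit_nat _)) -comp_assoc bwdK comp_id_r.
clearbody d cu; exists (runit (W ⊗ x) ∘ d ∘ bwd (runit (x ⊗ W))); split; rewrite cE -!comp_assoc.
  by rewrite (comp_pre (fwdK _)) comp_id_l (comp_pre dcu) comp_id_l bwdK.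
by rewrite (comp_pre (fwdK _)) comp_id_l (comp_pre cud) comp_id_l bwdK.
Qed.

Lemma half_braiding_of_lax : exists b : forall x, isomor (W ⊗ x) (x ⊗ W),
  forall x, fwd (b x) = c x.
Proof.
have b_ex x : {b : isomor (W ⊗ x) (x ⊗ W) | fwd b = c x} := isomor_of (lax_braiding_iso x).
by exists (fun x => sval (b_ex x)) => x; exact: svalP (b_ex x).
Qed.

End LaxHalfBraiding.

Program Definition id_modFun (k : fieldType) (C : linMon k) (N : modCat C) : modFun N N :=
  @ModFun k C N N (linFun_id N) (fun x m => iso_id (x ▷ m)) _ _ _.
Next Obligation. by move=> * /=; rewrite comp_id_l comp_id_r. Qed.
Next Obligation. by move=> * /=; rewrite bmor_id !comp_id_l comp_id_r. Qed.
Next Obligation. by move=> * /=; rewrite comp_id_r. Qed.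

(** * The universal object through which [be] lifts *)

Section CentralLifting.
Variables (k : closedFieldType) (C : linMon k) (M N : modCat C).
Hypotheses (finC : finite_category C) (rigC : rigid C).
Hypotheses (exM : exact_module_category M) (exN : exact_module_category N).
Let modN := emod_module exN.
Local Notation Fun := (funCat M N).
Variables (p : center_ob C) (H F G : Fun).
Variables (al : mor F G) (be : mor (fun_act_ob p H : Fun) G).
Hypothesis al_epi : epimor al.

Definition covering (x : C) (f : mor x (cob p)) (t : forall m, mor (x ▷ ufun H m) (ufun F m)) :=
  (forall m m' (g : mor m m'), t m' ∘ (idmor x [▷] fmor (ufun H) g) = fmor (ufun F) g ∘ t m) /\
  (forall m, comp_at al m ∘ t m = comp_at be m ∘ (f [▷] idmor (ufun H m))).

Lemma proj_covering q (f : mor q (cob p)) : projective_ob q ->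
  exists t, covering f t.
Proof.
move=> pq; have finM := mod_finite (emod_module exM).
have [|||||t [tn ta]] := @splitting_lift k M N (linFun_comp (bfix_l (cact N) q) (ufun H)) finM
   _ _ (ufun F) (ufun G) (fun m => comp_at al m)
   (fun m => comp_at be m ∘ (f [▷] idmor (ufun H m))).
- exact: act_proj_splits exM q pq.
- by move=> m; exact: (emod_projective exN).
- by move=> m m' g; exact: comp_at_nat.
- move=> m; have abN := fin_abelian (mod_finite modN).
  exact: (fun_epi_at abN (mod_exact_l modN) al_epi).
- move=> m m' g /=; rewrite -comp_assoc bmor_lr -bmor_rl comp_assoc comp_assoc.
  by rewrite -(comp_at_nat be g).
by exists t; split.
Qed.

Local Notation fam x := (prodmod (fun m => mor (x ▷ ufun H m) (ufun F m))).

Lemma covering_closed x : lin_closed (fun v : (mor x (cob p) * fam x)%type => covering v.1 v.2).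
Proof.
split=> [|a u v [un uc] [vn vc]]; split=> *.
- by rewrite comp_0l comp_0r.
- by rewrite comp_0r bmor_0l comp_0r.
- by rewrite /= [LHS]comp_lin_l [RHS]comp_lin_r un vn.
- by rewrite /= [LHS]comp_lin_r bmor_lin_l comp_lin_r uc vc.
Qed.

Lemma covering_pull x y (h : mor x y) f t : @covering y f t ->
  covering (f ∘ h) (fun m => t m ∘ (h [▷] idmor (ufun H m))).
Proof.
move=> [tn tc]; split=> [m m' g|m].
  by rewrite -comp_assoc bmor_lr -bmor_rl !comp_assoc tn.
by rewrite comp_assoc tc bmor_compl comp_assoc.
Qed.

Lemma universal_covering : exists (W : C) (f : mor W (cob p)) t, @covering W f t /\
  forall x g s, @covering x g s -> exists! h : mor x W, f ∘ h = g /\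
    forall m, t m ∘ (h [▷] idmor (ufun H m)) = s m.
Proof.
have finM := mod_finite (emod_module exM); have finN := mod_finite modN.
have abC := fin_abelian finC; have abN := fin_abelian finN.
have [P gP] := exists_proj_gen finC; have [m0 gm0] := exists_proj_gen finM.
pose Phi x : lmodType k := subspace (covering_closed x).
pose pull x y (h : mor x y) (v : Phi y) : Phi x :=
  mkSub (covering_closed x) (v := (_, _)) (covering_pull h (subspaceP v)).
have eqP x (u v : Phi x) : (subval u).1 = (subval v).1 ->
    (forall m, (subval u).2 m = (subval v).2 m) -> u = v.
  move=> e1 e2; apply: subspace_eq; move: e1 e2.
  case: (subval u) (subval v) => [a b] [c d] /= -> e; congr (_, _).
  exact: functional_extensionality_dep.
have epiH x y (e : mor x y) m : epimor e -> epimor (e [▷] idmor (ufun H m)).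
  exact: (exact_functor_epi abC (mod_exact_r modN (ufun H m))).
(* The components of [t] range over all objects of [M], but a covering is determined by [f] and the
   component at the generator [m0]: the difference of two transformations that agree at [m0] is
   natural and vanishes on a cover of every object. *)
have [d sp] : exists d, spanned (Phi P) d.
  have [d1 [b1 hb1]] := fin_hom finC P (cob p).
  have [d2 [b2 hb2]] := fin_hom finN (P ▷ ufun H m0) (ufun F m0).
  have sp := spanned_prod (ex_intro _ b1 hb1 : spanned _ d1) (ex_intro _ b2 hb2 : spanned _ d2).
  have [] := @spanned_sub _ (Phi P) _
    (fun v => ((subval v).1, (subval v).2 m0)) _ _ _ sp; [by [] | | by move=> d _; exists d].
  move=> u v [e1 e2]; apply: eqP => // m; apply/subr0_eq.
  pose dif m := (subval u).2 m - (subval v).2 m.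
  have dn m1 m2 (g : mor m1 m2) :
      dif m2 ∘ (idmor P [▷] fmor (ufun H) g) = fmor (ufun F) g ∘ dif m1.
    by have [[un _] [vn _]] := (subspaceP u, subspaceP v); rewrite compBl compBr un vn.
  have [|||q dq [e ee]] := gen_epi finM gm0 (G := fun m => dif m = 0) _ _ _ m.
  - by rewrite /dif e2 subrr.
  - move=> z /(fmor_zero (ufun H))/(fmor_zero (bfix_l (cact N) P)) zz.
    by have [_ h] := zz (fob (ufun F) z); exact: h.
  - move=> x y t [i [j [r [s [_ _ _ _ dec]]]]] dx dy.
    have e : idmor (P ▷ ufun H t) = (idmor P [▷] fmor (ufun H) i) ∘ (idmor P [▷] fmor (ufun H) r)
        + (idmor P [▷] fmor (ufun H) j) ∘ (idmor P [▷] fmor (ufun H) s).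
      rewrite -!bmor_compr -!fmor_comp -(bmor_id (cact N)) -fmor_id -dec fmorD.
      exact: (lin_mapD (fun a u v => bmor_lin_r (cact N) a (idmor P) u v)).
    by rewrite -(comp_id_r (dif t)) e compDr !comp_assoc !dn dx dy !comp_0r !comp_0l addr0.
  have He := modFun_epi (H := H) finC exM modN ee.
  have PHe : epimor (idmor P [▷] fmor (ufun H) e).
    exact: (exact_functor_epi abN (mod_exact_l modN P) He).
  by apply: (epir0 PHe); rewrite dn dq comp_0r.
have [||||||W [v uv]] := @representable k C finC P gP Phi pull _ _ _ _ _ _ d sp.
- by move=> x u; apply: eqP => [|m] /=; rewrite ?bmor_id comp_id_r.
- by move=> x y z g f u; apply: eqP => [|m] /=; rewrite ?bmor_compl comp_assoc.
- move=> x y u a f g; apply: eqP => [|m] /=; first exact: comp_lin_r.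
  by rewrite bmor_lin_l comp_lin_r.
- by move=> x y f a u v; apply: eqP => [|m] /=; exact: comp_lin_l.
- move=> x y e ee u e0; have e1 := congr1 (fun v : Phi x => (subval v).1) e0.
  have e2 m := congr1 (fun v : Phi x => (subval v).2 m) e0.
  apply: eqP => [|m]; first exact: (epir0 ee e1).
  exact: (epir0 (epiH _ _ _ m ee) (e2 m)).
- move=> x y z f e ce u e0; have e1 := congr1 (fun v : Phi x => (subval v).1) e0.
  have e2 m := congr1 (fun v : Phi x => (subval v).2 m) e0.
  have [g eg] := cokernel_desc ce e1.
  have cH m := exact_functor_cokernel abC (mod_exact_r modN (ufun H m)) ce.
  have sm m := cokernel_desc (cH m) (e2 m).
  have [s sE] : exists s : fam z, forall m, s m ∘ (e [▷] idmor (ufun H m)) = (subval u).2 m.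
    by exists (fun m => sval (sm m)) => m; exact: svalP (sm m).
  have ee := cokernel_epi ce; have [un uc] := subspaceP u.
  have cv : covering g s.
    split=> [m m' l|m].
      apply: (epiH _ _ _ m ee); rewrite -!comp_assoc sE bmor_rl -bmor_lr comp_assoc sE.
      by rewrite un.
    apply: (epiH _ _ _ m ee); rewrite -!comp_assoc sE -bmor_compl eg.
    exact: uc.
  by exists (mkSub (covering_closed z) (v := (g, s)) cv); apply: eqP.
exists W, (subval v).1, (subval v).2; split; first exact: (subspaceP v).
move=> x g s cgs; have [h [eh uh]] := uv x (mkSub (covering_closed x) (v := (g, s)) cgs).
exists h; split=> [|h' [e1 e2]]; last by apply: uh; apply: eqP.
split; first exact: (congr1 (fun v : Phi x => (subval v).1) eh).
by move=> m; exact: (congr1 (fun v : Phi x => (subval v).2 m) eh).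
Qed.

End CentralLifting.

(** * The half-braiding on the universal covering *)

Section CoveringHalfBraiding.
Variables (k : closedFieldType) (C : linMon k) (M N : modCat C).
Hypothesis rigC : rigid C.
Local Notation Fun := (funCat M N).
Variables (p : center_ob C) (H F G : Fun).
Variables (al : mor F G) (be : mor (fun_act_ob p H : Fun) G).
Variables (W : C) (f : mor W (cob p)) (t : forall m, mor (W ▷ ufun H m) (ufun F m)).
Hypothesis cov : covering al be f t.
Hypothesis univ : forall x g s, @covering _ C M N p H F G al be x g s ->
  exists! h : mor x W, f ∘ h = g /\ forall m, t m ∘ (h [▷] idmor (ufun H m)) = s m.

(** The index [None] carries the map [f] to [p] and the index [Some m] the component [t m], so that
    the whole pair becomes one family to which twisting by [v] applies. *)
Let D (i : option M) : modCat C := if i is Some _ then N else regMod C.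
Let J i : modFun (regMod C) (D i) :=
  match i with Some m => act_modFun (ufun H m) | None => id_modFun (regMod C) end.
Let T i : D i := match i return D i with Some m => ufun F m | None => cob p end.
Let w i : mor (J i W) (T i) :=
  match i return mor (J i W) (T i) with Some m => t m | None => f end.

Let w_joint_mono : joint_mono w.
Proof.
move=> y g h e; have [l [_ ul]] := univ (covering_pull h cov).
have <- : l = h by exact: ul.
by apply/esym/ul; split=> [|m]; [exact: (e None) | exact: (e (Some m))].
Qed.

Let tw v i : mor (J i (v ⊗ W)) (v ▷ T i) := twist w v i.

Let tw_joint_mono v : joint_mono (T := fun i => v ▷ T i) (tw v).
Proof. by have [[d [ev [coev [zv _]]]] _] := rigC v; exact: joint_mono_twist zv w_joint_mono. Qed.

Lemma covering_inj y (g h : mor y W) : f ∘ g = f ∘ h ->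
  (forall m, t m ∘ (g [▷] idmor (ufun H m)) = t m ∘ (h [▷] idmor (ufun H m))) -> g = h.
Proof. by move=> e1 e2; apply: w_joint_mono => -[m|]; [exact: e2 | exact: e1]. Qed.

Lemma covering_inj1 v y (g h : mor y (v ⊗ W)) :
  (idmor v [⊗] f) ∘ g = (idmor v [⊗] f) ∘ h ->
  (forall m, (idmor v [▷] t m) ∘ massoc v W (ufun H m) ∘ (g [▷] idmor (ufun H m))
    = (idmor v [▷] t m) ∘ massoc v W (ufun H m) ∘ (h [▷] idmor (ufun H m))) -> g = h.
Proof.
move=> e1 e2; apply: (tw_joint_mono (v := v)) => -[m|]; rewrite /tw /twist /=.
  by rewrite -!comp_assoc; exact: e2.
by rewrite comp_id_r; exact: e1.
Qed.

Lemma covering_inj2 x v y (g h : mor y (x ⊗ (v ⊗ W))) :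
  (idmor x [⊗] (idmor v [⊗] f)) ∘ g = (idmor x [⊗] (idmor v [⊗] f)) ∘ h ->
  (forall m, (idmor x [▷] (idmor v [▷] t m)) ∘ (idmor x [▷] massoc v W (ufun H m))
      ∘ massoc x (v ⊗ W) (ufun H m) ∘ (g [▷] idmor (ufun H m))
    = (idmor x [▷] (idmor v [▷] t m)) ∘ (idmor x [▷] massoc v W (ufun H m))
      ∘ massoc x (v ⊗ W) (ufun H m) ∘ (h [▷] idmor (ufun H m))) -> g = h.
Proof.
have [[d [ev [coev [zv _]]]] _] := rigC x; move=> e1 e2.
apply: (joint_mono_twist zv (tw_joint_mono (v := v))) => -[m|]; rewrite /tw /twist /=.
  by rewrite !bmor_compr -!comp_assoc; exact: e2.
by rewrite !comp_id_r; exact: e1.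
Qed.

(** The object [v ⊗ W] represents coverings with [v ⊗ p], [v ▷ F] and [v ▷ G] in place of [p], [F]
    and [G]: transposing along the dual [d] of [v] gives an ordinary covering of [d ⊗ y]. *)
Lemma covering_twist v y (a : mor y (v ⊗ cob p)) (s : forall m, mor (y ▷ ufun H m) (v ▷ ufun F m)) :
  (forall m m' (g : mor m m'),
    s m' ∘ (idmor y [▷] fmor (ufun H) g) = (idmor v [▷] fmor (ufun F) g) ∘ s m) ->
  (forall m, (idmor v [▷] comp_at al m) ∘ s m
    = (idmor v [▷] comp_at be m) ∘ massoc v (cob p) (ufun H m) ∘ (a [▷] idmor (ufun H m))) ->
  exists g : mor y (v ⊗ W), (idmor v [⊗] f) ∘ g = a /\
    forall m, (idmor v [▷] t m) ∘ massoc v W (ufun H m) ∘ (g [▷] idmor (ufun H m)) = s m.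
Proof.
move=> sn sc; have [[d [ev [coev [zv _]]]] _] := rigC v.
have [|h [[h1 h2] _]] := @univ (d ⊗ y) (act_eps (D := regMod C) ev (cob p) ∘ (idmor d [⊗] a))
    (fun m => act_eps ev (ufun F m) ∘ (idmor d [▷] s m) ∘ massoc d y (ufun H m)).
  split=> [m m' g|m].
    rewrite -!comp_assoc massoc_natr (comp_pre (esym (bmor_compr _ _ _ _))) sn bmor_compr.
    by rewrite -!comp_assoc (comp_pre (esym (act_eps_nat _ _))) -!comp_assoc.
  rewrite comp_assoc act_eps_nat -comp_assoc (comp_pre (esym (bmor_compr _ _ _ _))) sc.
  rewrite !bmor_compr -!comp_assoc (comp_pre (esym (act_eps_nat _ _))) -!comp_assoc.
  pose Jm := act_modFun (ufun H m).
  have e := oplax_eps ev (mstr_nat Jm) (mstr_pentagon Jm) (mstr_triangle Jm) (cob p).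
  rewrite /= in e; rewrite bmor_compl -e -!comp_assoc; congr (_ ∘ _ ∘ _).
  by rewrite massoc_natm.
have [i|g eg] := @twist_lift _ _ _ D J T W w v d ev coev zv y
  (fun i => match i return mor (J i y) (v ▷ T i) with Some m => s m | None => a end) h.
  case: i => [m|]; first exact: h2.
  by rewrite /= comp_id_r; exact: h1.
exists g; split=> [|m].
  by have := eg None; rewrite /twist /= comp_id_r.
by have := eg (Some m); rewrite /twist /= -comp_assoc.
Qed.

(** The two equations say that [f] is central and that [t] respects the action of [v], the latter
    solved for the term containing [c]. Their right-hand sides form a twisted covering because [al]
    and [be] are module natural transformations. *)
Lemma covering_braiding_exists v : exists c : mor (W ⊗ v) (v ⊗ W),
  (idmor v [⊗] f) ∘ c = cbr p v ∘ (f [⊗] idmor v) /\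
  forall m, (idmor v [▷] t m) ∘ massoc v W (ufun H m) ∘ (c [▷] idmor (ufun H m))
    = mstr F v m ∘ t (v ▷ m) ∘ (idmor W [▷] bwd (mstr H v m)) ∘ massoc W v (ufun H m).
Proof.
have [tn tc] := cov.
have bs : mstr G v _ ∘ comp_at be (v ▷ _) = (idmor v [▷] comp_at be _)
    ∘ strength (cbr p) v (ufun H _) ∘ (idmor (cob p) [▷] mstr H v _) := comp_at_str be v _.
apply: covering_twist => [m m' g|m].
  rewrite -!comp_assoc massoc_natr (comp_pre (esym (bmor_compr _ _ _ _))) mstr_bwd_nat bmor_compr.
  by rewrite -comp_assoc (comp_pre (tn _ _ _)) -!comp_assoc (comp_pre (mstr_nat F _ _)) -!comp_assoc.
rewrite comp_assoc -comp_at_str -comp_assoc (comp_pre (tc _)) -comp_assoc.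
have se := strength_massoc (cbr p) v (ufun H m).
move: (strength (cbr p)) bs se => sp bs se; rewrite (comp_pre (bs m)) -!comp_assoc.
rewrite (comp_pre (bmor_rl _ _ _)) -(bmor_lr (cact N) f) -!comp_assoc (comp_pre (act_bwdK _ _)) comp_id_l.
rewrite -massoc_natl (comp_pre se) -!comp_assoc; congr (_ ∘ _ ∘ _).
by rewrite -bmor_compl.
Qed.

Section Braiding.
Variable c : forall v, mor (W ⊗ v) (v ⊗ W).
Hypothesis c_f : forall v, (idmor v [⊗] f) ∘ c v = cbr p v ∘ (f [⊗] idmor v).
Hypothesis c_t : forall v m,
  (idmor v [▷] t m) ∘ massoc v W (ufun H m) ∘ (c v [▷] idmor (ufun H m))
  = mstr F v m ∘ t (v ▷ m) ∘ (idmor W [▷] bwd (mstr H v m)) ∘ massoc W v (ufun H m).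

Let t_nat m m' (g : mor m m') :
  t m' ∘ (idmor W [▷] fmor (ufun H) g) = fmor (ufun F) g ∘ t m.
Proof. by have [tn _] := cov; exact: tn. Qed.

Lemma covering_braiding_nat v v' (g : mor v v') :
  c v' ∘ (idmor W [⊗] g) = (g [⊗] idmor W) ∘ c v.
Proof.
apply: covering_inj1 => [|m].
  rewrite comp_assoc c_f -comp_assoc bmor_lr -bmor_rl comp_assoc cbr_nat.
  by rewrite -comp_assoc -c_f !comp_assoc bmor_lr bmor_rl.
rewrite !bmor_compl (comp_pre3 (c_t _ m)) -!comp_assoc massoc_natm.
have e := mstr_bwd_nat H g (idmor m); rewrite fmor_id in e.
rewrite (comp_pre (esym (bmor_compr _ _ _ _))) e bmor_compr -!comp_assoc (comp_pre (t_nat _)).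
have e' := mstr_nat F g (idmor m); rewrite fmor_id in e'.
rewrite -!comp_assoc (comp_pre e') -!comp_assoc -c_t.
by rewrite (comp_pre (massoc_natl _ _ _)) -!comp_assoc (comp_pre (bmor_lr _ _ _))
  (comp_pre (bmor_rl _ _ _)).
Qed.

Lemma covering_braiding_hexagon x y : tassoc x y W ∘ c (x ⊗ y) ∘ tassoc W x y
  = (idmor x [⊗] c y) ∘ tassoc x W y ∘ (c x [⊗] idmor y).
Proof.
apply: covering_inj2 => [|m].
  rewrite comp_assoc -tassoc_nat bmor_id -comp_assoc (comp_pre (c_f _)).
  have e1 : (f [⊗] idmor (x ⊗ y)) ∘ tassoc W x y
      = tassoc (cob p) x y ∘ ((f [⊗] idmor x) [⊗] idmor y) by rewrite tassoc_nat bmor_id.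
  rewrite -!comp_assoc e1 (comp_pre3 (cbr_hexagon p x y)) -!comp_assoc -bmor_compl -c_f bmor_compl.
  rewrite (comp_pre (tassoc_nat _ _ _)) -!comp_assoc.
  by rewrite !(comp_pre (esym (bmor_compr _ _ _ _))) c_f.
have bF := mstr_pentagon F x y m.
have bH : fmor (ufun H) (massoc x y m) ∘ bwd (mstr H (x ⊗ y) m)
    = bwd (mstr H x (y ▷ m)) ∘ (idmor x [▷] bwd (mstr H y m)) ∘ massoc x y (ufun H m).
  apply: (iso_epi (i := mstr H (x ⊗ y) m)); rewrite -!comp_assoc fwdK comp_id_r mstr_pentagon.
  by rewrite (comp_pre (act_fwdK _ _)) comp_id_l (comp_pre (fwdK _)) comp_id_l.
(* The common value of both sides once evaluated: [t] at [x ▷ y ▷ m], preceded by the inverse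
   structure maps of [H] and followed by those of [F], for [x] and [y] in turn. *)
transitivity ((idmor x [▷] mstr F y m) ∘ mstr F x (y ▷ m) ∘ t (x ▷ y ▷ m)
  ∘ (idmor W [▷] bwd (mstr H x (y ▷ m))) ∘ (idmor W [▷] (idmor x [▷] bwd (mstr H y m)))
  ∘ massoc W x (y ▷ ufun H m) ∘ massoc (W ⊗ x) y (ufun H m)).
  rewrite !bmor_compl (comp_pre3 (act_pentagon x y W (ufun H m))) -!comp_assoc.
  rewrite (comp_pre (esym (massoc_natr _ _ _))) -!comp_assoc (comp_pre3 (c_t _ _)) -!comp_assoc.
  rewrite (comp_pre bF) -!comp_assoc (comp_pre (esym (t_nat _))) -!comp_assoc.
  rewrite (comp_pre (esym (bmor_compr _ W _ _))) bH !bmor_compr -!comp_assoc.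
  by rewrite act_pentagon.
have cy := congr1 (bmor (cact N) (idmor x)) (c_t y m); rewrite !bmor_compr in cy.
rewrite !bmor_compl (comp_pre (massoc_natm x (c y) _)) -!comp_assoc (comp_pre3 cy) -!comp_assoc.
rewrite (comp_pre3 (act_pentagon x W y (ufun H m))) -!comp_assoc massoc_natl.
have ch : (idmor x [▷] (idmor W [▷] bwd (mstr H y m))) ∘ massoc x W (y ▷ ufun H m)
    ∘ (c x [▷] idmor (y ▷ ufun H m))
  = massoc x W (ufun H (y ▷ m)) ∘ (c x [▷] idmor (ufun H (y ▷ m)))
    ∘ (idmor (W ⊗ x) [▷] bwd (mstr H y m)).
  by rewrite comp_assoc -massoc_natr -comp_assoc bmor_rl bmor_lr.
rewrite (comp_pre3 ch) -!comp_assoc (comp_pre3 (c_t x (y ▷ m))) -!comp_assoc.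
by rewrite (comp_pre (massoc_natr _ _ _)) -!comp_assoc.
Qed.

Lemma covering_braiding_unit : lunit W ∘ c unit_ob = runit W.
Proof.
apply: covering_inj => [|m].
  rewrite comp_assoc -lunit_nat -comp_assoc c_f comp_assoc cbr_unit.
  exact: runit_nat.
rewrite bmor_compl -munit_massoc -!comp_assoc (comp_pre (esym (munit_nat _))) -!comp_assoc c_t.
rewrite (comp_pre (mstr_triangle F m)) (comp_pre (esym (t_nat _))) -!comp_assoc.
rewrite (comp_pre (esym (bmor_compr _ W _ _))) -mstr_triangle -!comp_assoc bwdK comp_id_r.
by rewrite act_triangle.
Qed.

End Braiding.

End CoveringHalfBraiding.

Lemma act_center_projective (k : closedFieldType) (C : linMon k) (M N : modCat C)
    (p : drinfeld_center C) (H : funCat M N) :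
  finite_category C -> rigid C -> exact_module_category M -> exact_module_category N ->
  projective_ob p -> projective_ob (fun_act_ob p H : funCat M N).
Proof.
move=> finC rigC exM exN pp F G al be al_epi.
have [W [f [t [cov univ]]]] := universal_covering finC exM exN al be.
have [c hc] : exists c : forall v, mor (W ⊗ v) (v ⊗ W), forall v,
    (idmor v [⊗] f) ∘ c v = cbr p v ∘ (f [⊗] idmor v) /\
    forall m, (idmor v [▷] t m) ∘ massoc v W (ufun H m) ∘ (c v [▷] idmor (ufun H m))
      = mstr F v m ∘ t (v ▷ m) ∘ (idmor W [▷] bwd (mstr H v m)) ∘ massoc W v (ufun H m).
  have ex v := cid (covering_braiding_exists rigC cov univ v).
  by exists (fun v => sval (ex v)) => v; exact: svalP (ex v).
have c_f v := proj1 (hc v); have c_t v := proj2 (hc v).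
have c_nat := covering_braiding_nat rigC cov univ c_f c_t.
have c_hex := covering_braiding_hexagon rigC cov univ c_f c_t.
have c_unit := covering_braiding_unit cov univ c_f c_t.
have [b bE] := half_braiding_of_lax rigC c_nat c_hex c_unit.
have b_nat x x' (g : mor x x') : b x' ∘ (idmor W [⊗] g) = (g [⊗] idmor W) ∘ b x.
  by rewrite !bE.
have b_hex x y : tassoc x y W ∘ b (x ⊗ y) ∘ tassoc W x y
    = (idmor x [⊗] b y) ∘ tassoc x W y ∘ (b x [⊗] idmor y) by rewrite !bE.
pose Z := Center b_nat b_hex.
have cf : @is_central k C Z p f by move=> x; rewrite -c_f bE.
pose fZ : @mor k (centerCat C) Z p := mkCentral cf.
have f_epi : epimor f.
  have [q [g [pq eg]]] := fin_projectives finC (cob p).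
  have [s /univ[h [[eh _] _]]] := proj_covering exM exN be al_epi g pq.
  by apply: (@epi_cancel _ _ _ _ _ f h); rewrite eh.
have efZ : epimor fZ by apply: under_epi; exact: f_epi.
(* The splitting takes place in the center, so [s] is central and acts on [H] by a module natural
   transformation. Composed with [tZ] it gives the lift of [be]. *)
have [s fs] := @proj_split _ (centerCat C) Z p fZ pp efZ.
have [tn tc] := cov.
have bt : @is_modNat k C M N (fun_act_ob Z H) F t.
  split=> [m m' g|x m]; first exact: tn.
  have st := strength_massoc (cbr Z) x (ufun H m).
  change (mstr F x m ∘ t (x ▷ m)
    = (idmor x [▷] t m) ∘ strength (cbr Z) x (ufun H m) ∘ (idmor W [▷] mstr H x m)).
  (* The strength is made opaque: from here on, only its equation with [massoc], written with [c] in
     place of [b], matters. *)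
  move: (strength (cbr Z)) st => sZ st; rewrite /= bE in st.
  have e : (idmor x [▷] t m) ∘ sZ N x (ufun H m)
      = mstr F x m ∘ t (x ▷ m) ∘ (idmor W [▷] bwd (mstr H x m)).
    apply: (iso_epi (i := massoc W x (ufun H m))).
    by rewrite -!comp_assoc st c_t.
  by rewrite comp_assoc e -!comp_assoc act_fwdK comp_id_r.
pose tZ : @mor k (funCat M N) (fun_act_ob Z H) F := mkNat bt.
exists (tZ ∘ bmor (fun_act M N) s (idmor H)); apply: natP => m.
have e : comp_at al m ∘ comp_at tZ m = comp_at be m ∘ (f [▷] idmor (ufun H m)) := tc m.
rewrite comp_at_comp comp_at_comp comp_assoc e -comp_assoc.
have -> : comp_at (bmor (fun_act M N) s (idmor H)) m = under s [▷] idmor (ufun H m) by [].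
rewrite -bmor_compl.
have -> : f ∘ under s = idmor (cob p) by exact: (congr1 (@under _ _ _ _) fs).
by rewrite bmor_id comp_id_r.
Qed.

Unset Implicit Arguments.

Theorem theorem6p8 (k : closedFieldType) (C : linMon k) (M N : modCat C)
    (hC : finite_tensor_category C)
    (hM : exact_module_category M)
    (hN : exact_module_category N) :
  exact_module_category (fun_modCat M N).
Proof.
have [finC rigC _] := hC; split; first exact: fun_module_category finC rigC hM (emod_module hN).
by move=> p H; exact: act_center_projective.
Qed.
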